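(* Let $\kappa$ be a positive integer with $\log\kappa\ge 250000$. Then for every positive integer \[ n\ge \exp(143\log\kappa\,\log\log\kappa), \] the Fibonacci number $F_n$ has a primitive divisor distinct from each of the $2\kappa$ numbers \[ n\pm 1,\ 2n\pm 1,\ \ldots,\ \kappa n\pm 1. \] In particular, for such $n$, $F_n$ has a prime divisor greater than or equal to $(\kappa+1)n-1$.
   Context: $F_n$ denotes the $n$-th Fibonacci number, $F_n=\frac{\eta^n-\bar\eta^n}{\sqrt5}$ with $\eta=(1+\sqrt5)/2$, $\bar\eta=(1-\sqrt5)/2$. A prime $p$ is a primitive divisor of $F_n$ if $p\mid F_n$ but $p\nmid 5F_1F_2\cdots F_{n-1}$. *)

(* Defs.v *)
From mathcomp Require Import all_boot all_order all_algebra.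
From mathcomp Require Import ring.

Set Implicit Arguments.
Unset Strict Implicit.
Unset Printing Implicit Defensive.

Import Order.TTheory GRing.Theory Num.Theory.

Fixpoint fib (n : nat) : nat :=
  match n with
  | 0 => 0
  | 1 => 1
  | (m.+1 as k).+1 => fib k + fib m
  end.

Definition primitive_divisor (p n : nat) : bool :=
  [&& prime p, p %| fib n & ~~ (p %| 5 * \prod_(1 <= k < n) fib k)].

Local Open Scope ring_scope.

Lemma fib_binet (R : rcfType) (n : nat) :
  (fib n)%:R = (((1 + Num.sqrt 5) / 2) ^+ n - ((1 - Num.sqrt 5) / 2) ^+ n)
               / Num.sqrt 5 :> R.
Proof.
set s := Num.sqrt 5.
have s2 : s ^+ 2 = 5 by rewrite sqr_sqrtr ?ler0n.
have s0 : s != 0 by rewrite sqrtr_eq0 -ltNge ltr0n.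
pose a : R := (1 + s) / 2; pose b : R := (1 - s) / 2; rewrite -/a -/b.
have a2 : a ^+ 2 = a + 1.
  have -> : a ^+ 2 = a + 1 + (s ^+ 2 - 5) / 4 by rewrite /a; field.
  by rewrite s2 subrr mul0r addr0.
have b2 : b ^+ 2 = b + 1.
  have -> : b ^+ 2 = b + 1 + (s ^+ 2 - 5) / 4 by rewrite /b; field.
  by rewrite s2 subrr mul0r addr0.
have step (x : R) m : x ^+ 2 = x + 1 -> x ^+ m.+2 = x ^+ m.+1 + x ^+ m.
  by move=> x2; rewrite -addn2 exprD x2 mulrDr mulr1 -exprSr.
suff: (fib n)%:R = (a ^+ n - b ^+ n) / s /\
      (fib n.+1)%:R = (a ^+ n.+1 - b ^+ n.+1) / s by case.
elim: n => [|n [IH0 IH1]].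
  rewrite !expr0 subrr mul0r !expr1; split=> //.
  rewrite -[fib 1]/1%N /a /b; field.
  by rewrite s0.
split=> //.
have -> : fib n.+2 = (fib n.+1 + fib n)%N by [].
rewrite natrD IH0 IH1 (step a) // (step b) //.
by rewrite -mulrDl; congr (_ / _); ring.
Qed.

(* Main.v *)
From HB Require Import structures.
Require Import Defs.
From mathcomp Require Import all_boot all_order all_fingroup all_algebra all_solvable all_field.
From mathcomp Require Import reals sequences exp.
From mathcomp Require Import ring lra zify.

(** Dividing [F_n] by the lcm of the [F_(n/q)], [q] a prime factor of [n], leaves up to a
    divisor of [2n] only primitive primes, and a number of logarithm at least [n / (12 ln n)].
    If all primitive primes were among the [2 kappa] numbers [j n +- 1] with [j <= kappa], one
    of them would therefore divide [F_n] to a power of order [n / (kappa (ln n)^2)]. This is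
    excluded by a bound for the valuation of [F_n] at such a [p], obtained by a p-adic
    version of Baker's method.

    Let [u = 9 + 4 sqrt 5], a power of the fundamental unit. Its multiplicative order modulo [p]
    is large because [p] is primitive, but if [p^M] divides [F_n] then [u^(2n) = 1] modulo [p^M]
    and the p-adic logarithm of [u] vanishes. Powers of [u] thus enlarge the supply of terms of an
    auxiliary function without changing its analytic behaviour. Take [r = 2 floor(ln kappa)]
    elements [xi_j] of [Z[sqrt 5]] of small size whose norms involve distinct split primes.
    Siegel's lemma provides a small nonzero integral combination of the functions
    [s |-> u^(2 nu s) prod_j (xi_j / xi_j')^(lambda_j s)] that vanishes to a high order at one
    point. Extrapolating along the integers and half-integers, and using that square
    roots of the norms of the [xi_j] are independent, one keeps a single parity class
    of exponents and halves them. After 45 halvings too few exponents are left. *)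

Set Implicit Arguments.
Unset Strict Implicit.
Unset Printing Implicit Defensive.

Import Order.TTheory GRing.Theory Num.Theory.

Local Open Scope ring_scope.

(** * Quadratic extensions *)

(** Replacing the p-adic numbers by a quadratic extension of [Z / p ^ M] with [M <= p] keeps
    everything algebraic: the factorials that occur are units, truncated exponentials are exactly
    multiplicative, and the Teichmüller part of a unit [x] is the power [x ^ (p ^ (2 M))].

    The obstacle is that terms share one analytic expression only if their Teichmüller parts agree.
    Passing to one class of discrete logarithms divides the number of unknowns by about [p],
    possibly [kappa n], while the exponent of [u] supplies fewer than [n] values, since primitivity
    separates only those. The deficit, exponential in [r], must come from the other [r] exponents. A
    halving divides their range by 2 but multiplies the order of vanishing only by 17/32; this gains
    17/16 in each variable, hence [(17/16) ^ (45 r)] in 45 halvings.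

    Values at half-integers have degree [2 ^ r] over [Z[sqrt 5]], so their norms are small enough
    only after extrapolation from [2 ^ r] points, reached by repeatedly doubling an interval. Hence
    the factor [2 ^ r] in [M], which must still leave [kappa M] well below [n]. *)

(* The pair [(x, y)] stands for [x + y sqrt d]; the ring makes sense for any [d]. *)
Definition qext (A : comNzRingType) (d : A) : Type := (A * A)%type.

Section QExt.
Variables (A : comNzRingType) (d : A).
Local Notation K := (qext d).
HB.instance Definition _ := GRing.Zmodule.on K.
Definition qmul (x y : K) : K :=
  (x.1 * y.1 + d * (x.2 * y.2), x.1 * y.2 + x.2 * y.1).
Definition qone : K := (1, 0).
Lemma qmulA : associative qmul.
Proof. by case=> a b [c e] [f g]; congr pair => /=; ring. Qed.
Lemma qmulC : commutative qmul.
Proof. by case=> a b [c e]; congr pair => /=; ring. Qed.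
Lemma qmul1 : left_id qone qmul.
Proof. by case=> a b; congr pair => /=; ring. Qed.
Lemma qmulD : left_distributive qmul +%R.
Proof. by case=> a b [c e] [f g]; congr pair => /=; ring. Qed.
Lemma qone_neq0 : qone != 0.
Proof. by apply/eqP => -[] /eqP; rewrite oner_eq0. Qed.
HB.instance Definition _ :=
  GRing.Zmodule_isComNzRing.Build K qmulA qmulC qmul1 qmulD qone_neq0.

Definition qnorm (x : K) : A := x.1 ^+ 2 - d * x.2 ^+ 2.

Lemma qnormM (x y : K) : qnorm (x * y) = qnorm x * qnorm y.
Proof. by case: x y => a b [c e]; rewrite /qnorm /=; ring. Qed.

Lemma qnorm_inv (x : K) b : qnorm x * b = 1 -> x * ((x.1 * b, - x.2 * b) : K) = 1.
Proof.
case: x => u v; rewrite /qnorm /= => h; transitivity ((u ^+ 2 - d * v ^+ 2) * b, 0 : A).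
  by apply: injective_projections => /=; ring.
by rewrite h.
Qed.

Lemma fst_qsum (I : Type) (s : seq I) (P : pred I) (F : I -> K) :
  (\sum_(i <- s | P i) F i).1 = \sum_(i <- s | P i) (F i).1.
Proof. by elim/big_rec2: _ => //= i x y _ <-. Qed.

Lemma snd_qsum (I : Type) (s : seq I) (P : pred I) (F : I -> K) :
  (\sum_(i <- s | P i) F i).2 = \sum_(i <- s | P i) (F i).2.
Proof. by elim/big_rec2: _ => //= i x y _ <-. Qed.

Lemma qintE (z : int) : (z%:~R : K) = (z%:~R, 0).
Proof.
have natE n : (n%:R : K) = (n%:R, 0).
  by elim: n => // n IH; rewrite -!natr1 IH; congr pair; rewrite /= addr0.
case: z => n; first exact: natE.
by rewrite NegzE !mulrNz -!pmulrn natE; congr pair; rewrite /= oppr0.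
Qed.

Lemma qintM (z : int) (x : K) : z%:~R * x = (z%:~R * x.1, z%:~R * x.2).
Proof. by rewrite qintE; apply: injective_projections; rewrite /= ?mul0r ?mulr0 addr0. Qed.

(** Over a domain: [D] is not a square in the fraction field. Stated without fractions because the
    layers of the tower are only rings. *)
Definition sq_indep (D : A) := forall a b : A, a ^+ 2 = D * b ^+ 2 -> b = 0.

End QExt.

Definition is_dom (A : comNzRingType) := forall a b : A, a * b = 0 -> a = 0 \/ b = 0.
Definition no_tor (A : comNzRingType) := forall (n : nat) (a : A), a *+ n.+1 = 0 -> a = 0.

Section Kummer.
Variables (A : comNzRingType) (d : A).
Hypotheses (domA : is_dom A) (dA : sq_indep d).
Local Notation K := (qext d).

Lemma sqr0 (a : A) : a ^+ 2 = 0 -> a = 0.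
Proof. by rewrite expr2 => /domA[]. Qed.

Lemma qnorm_eq0 (x : K) : qnorm x = 0 -> x = 0.
Proof.
case: x => a b; rewrite /qnorm /= => /eqP; rewrite subr_eq0 => /eqP e.
have b0 := dA e; move: e; rewrite b0 expr0n mulr0 => /sqr0 ->; exact: erefl.
Qed.

Lemma qext_dom : is_dom K.
Proof.
move=> x y xy; have: qnorm x * qnorm y = 0.
  by rewrite -qnormM xy /qnorm /= expr0n mulr0 subr0.
by case/domA => /qnorm_eq0; [left | right].
Qed.

Lemma qext_no_tor : no_tor A -> no_tor K.
Proof.
move=> tA n [a b].
have E m : ((a, b) : K) *+ m = (a *+ m, b *+ m) by elim: m => // m IH; rewrite 3!mulrS IH.
by rewrite E => -[/tA -> /tA ->].
Qed.

(** One step of Kummer theory: [z] becomes a square after adjoining [sqrt d] only if [z] or [d z]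
    was one before. Multiplying by the conjugate of [b] brings the right-hand side into [A]; an
    element [s + t sqrt d] whose square lies in [A] has [s t = 0], and the two cases contradict the
    two hypotheses. *)
Lemma qext_sq_indep (z : int) : no_tor A -> sq_indep (z%:~R : A) ->
  sq_indep (d * z%:~R) -> sq_indep (z%:~R : K).
Proof.
move=> tA iz idz a b eab.
suff nb : qnorm b = 0 by exact: qnorm_eq0.
have domK := qext_dom.
pose b' : K := (b.1, - b.2).
have bb' : b * b' = (qnorm b, 0) :> K.
  by apply: injective_projections; rewrite /qnorm /b' /=; ring.
have: (a * b') ^+ 2 = z%:~R * (b * b') ^+ 2 by rewrite !exprMn eab -mulrA.
rewrite bb'; move: (a * b') => [s t]; rewrite qintE.
rewrite !expr2 => -[] /= e1 e2.
have /domA[s0|t0] : s * t = 0.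
- have e3 : s * t + t * s = 0 by rewrite e2; ring.
  by apply: (tA 1%N); rewrite mulr2n -[RHS]e3; ring.
- apply: (idz (d * t)).
  have e3 : d * (t * t) = z%:~R * qnorm b ^+ 2.
    by rewrite -[LHS](addKr (s * s)) e1 s0; ring.
  have -> : (d * t) ^+ 2 = d * (d * (t * t)) by ring.
  by rewrite e3; ring.
- apply: (iz s).
  have e3 : s * s = z%:~R * qnorm b ^+ 2.
    by rewrite -[LHS](addrK (d * (t * t))) e1 t0; ring.
  by rewrite expr2 e3.
Qed.

End Kummer.

Notation A5 := (qext (5 : int)).

Lemma leq_expl m n k : (m <= n)%N -> (m ^ k <= n ^ k)%N.
Proof. by case: k => // k; rewrite leq_exp2r. Qed.

Lemma int_dom : is_dom int.
Proof. by move=> a b /eqP; rewrite mulf_eq0 => /orP[] /eqP; [left | right]. Qed.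

Lemma int_no_tor : no_tor int.
Proof. by move=> n a /eqP; rewrite mulrn_eq0 => /eqP. Qed.

Lemma int_sq_indep (q : nat) (D : int) : prime q -> odd (logn q `|D|) -> sq_indep D.
Proof.
move=> qp oD a b e; apply/eqP; rewrite -absz_eq0; apply/negP => /negP b0.
have D0 : (0 < `|D|)%N by case: (`|D|)%N oD => //; rewrite logn0.
have /(congr1 (odd \o logn q)) /= : (`|a| * `|a| = `|D| * (`|b| * `|b|))%N.
  by rewrite -!abszM -!expr2 e.
have bb : (0 < `|b|)%N by rewrite lt0n.
have aa : (0 < `|a|)%N.
  rewrite lt0n absz_eq0; apply/eqP => a0; move: e => /eqP.
  rewrite a0 expr0n /= eq_sym mulf_eq0 sqrf_eq0 -!absz_eq0 -!leqn0 leqNgt D0 /=.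
  by rewrite leqNgt bb.
by rewrite !lognM ?muln_gt0 ?bb ?aa ?D0 // !oddD oD; case: (odd _); case: (odd _).
Qed.

(** * Towers of square roots over Z[sqrt 5] *)

Section Tower.
Variables (J : eqType) (N : J -> int).

(* Square roots of the integers [N j] are adjoined one after the other. When each [N j] is divisible
   exactly once by a prime [q j] dividing no other [N j], the result is a domain. *)
Fixpoint tower (js : seq J) : comNzRingType :=
  if js is j :: js' then qext ((N j)%:~R : tower js') else A5.

Section Domain.
Variable q : J -> nat.
Hypotheses (q_pr : forall j, prime (q j)) (q5 : forall j, q j != 5%N)
  (qN : forall j, logn (q j) `|N j| = 1%N)
  (qN' : forall j j', j != j' -> ~~ (q j %| `|N j'|)%N).

(** The third clause is the invariant that lets the tower grow: a prime other than 5, of odd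
    exponent in [D] and absent from the [N j] adjoined so far, still shows that [D] is not a square.
    One layer up, the claim for [D] follows from those for [D] and [N j * D], both odd at [p]. *)
Lemma tower_dom js : uniq js -> [/\ is_dom (tower js), no_tor (tower js) &
  forall p (D : int), prime p -> p != 5%N -> odd (logn p `|D|) ->
   (forall j, j \in js -> logn p `|N j| = 0%N) -> sq_indep (D%:~R : tower js)].
Proof.
elim: js => [_|j js IH /= /andP[jjs /IH [domA torA sqA]]].
  have i5 : sq_indep (5 : int) by apply: (@int_sq_indep 5).
  have domA : is_dom A5 by apply: (qext_dom int_dom i5).
  have torA : no_tor A5 by apply: (qext_no_tor int_no_tor).
  split=> // p D pp p5 oD _.
  have D0 : (0 < `|D|)%N by case: (`|D|)%N oD => //; rewrite logn0.
  apply: (qext_sq_indep int_dom i5 int_no_tor); rewrite intz; apply: (int_sq_indep pp) => //.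
  rewrite abszM lognM // oddD oD [logn p `|5%Z|](_ : _ = 0%N) //.
  by rewrite /= logn_prime // (negbTE p5).
have N0 j' : (0 < `|N j'|)%N by move: (qN j'); case: (`|N j'|)%N => //; rewrite logn0.
have lq0 j' j'' : j' != j'' -> logn (q j') `|N j''| = 0%N.
  by move=> jj; rewrite lognE q_pr N0 (negbTE (qN' jj)).
have ij : sq_indep ((N j)%:~R : tower js).
  apply: (sqA (q j)); rewrite ?qN // => j' j'js; apply: lq0.
  by apply: contraNneq jjs => ->.
split; [exact: qext_dom | exact: qext_no_tor |].
move=> p D pp p5 oD h.
have D0 : (0 < `|D|)%N by case: (`|D|)%N oD => //; rewrite logn0.
apply: qext_sq_indep => //.
  by apply: (sqA p) => // j' j'js; apply: h; rewrite inE j'js orbT.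
rewrite -intrM; apply: (sqA p) => //.
  by rewrite abszM lognM // h ?mem_head.
by move=> j' j'js; apply: h; rewrite inE j'js orbT.
Qed.

Lemma tnorm_layer_eq0 j js (x : tower (j :: js)) : uniq (j :: js) -> qnorm x = 0 -> x = 0.
Proof.
move=> /= /andP[jjs ujs]; have [dA tA sA] := tower_dom ujs; apply: qnorm_eq0 => //.
have N0 j' : (0 < `|N j'|)%N by move: (qN j'); case: (`|N j'|)%N => //; rewrite logn0.
apply: (sA (q j)); rewrite ?qN // => j' j'js.
rewrite lognE q_pr N0 (negbTE (qN' _)) //.
by apply: contraNneq jjs => ->.
Qed.

End Domain.

Fixpoint tnorm (js : seq J) : tower js -> A5 :=
  if js is j :: js' return tower js -> A5 then fun x => @tnorm js' (qnorm x)
  else fun x => x.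

Variable K : J -> nat.
Hypothesis NK : forall j, (`|N j| <= K j ^ 2)%N.

(* The weight 3, at least the square root of 5, makes the size submultiplicative on [A5]. *)
Fixpoint tsize (js : seq J) : tower js -> nat :=
  if js is j :: js' return tower js -> nat then
    fun x => (@tsize js' x.1 + K j * @tsize js' x.2)%N
  else fun x => (`|(x : A5).1| + 3 * `|(x : A5).2|)%N.

Lemma tsize0 js : tsize (0 : tower js) = 0%N.
Proof. by elim: js => //= j js ->; rewrite muln0. Qed.

Lemma tsizeD js (x y : tower js) : (tsize (x + y) <= tsize x + tsize y)%N.
Proof.
elim: js x y => [x y|j js IH [a b] [c e]] /=; first by lia.
apply: leq_trans (leq_add (IH a c) (leq_mul (leqnn (K j)) (IH b e))) _.
by rewrite mulnDr; lia.
Qed.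

Lemma tsizeZ js (z : int) (x : tower js) : (tsize (z%:~R * x) <= `|z| * tsize x)%N.
Proof.
elim: js x => [[a b]|j js IH [a b]]; rewrite qintM /=.
  by rewrite !intz !abszM; nia.
apply: leq_trans (leq_add (IH a) (leq_mul (leqnn (K j)) (IH b))) _.
by rewrite mulnDr mulnCA.
Qed.

Lemma tsizeM js (x y : tower js) : (tsize (x * y) <= tsize x * tsize y)%N.
Proof.
elim: js x y => [[a b] [c e]|j js IH [a b] [c e]] /=.
  have h1 : (absz (a * c + 5 * (b * e))%R <= absz a * absz c + 5 * (absz b * absz e))%N.
    by rewrite -!abszM; lia.
  have h2 : (absz (a * e + b * c)%R <= absz a * absz e + absz b * absz c)%N by rewrite -!abszM; lia.
  by move: h1 h2; move: (absz a) (absz b) (absz c) (absz e) (absz _) (absz _) => *; nia.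
have h1 : (tsize ((N j)%:~R * (b * e)) <= K j ^ 2 * (tsize b * tsize e))%N.
  by apply: leq_trans (tsizeZ _ _) _; apply: leq_mul.
apply: (@leq_trans (tsize a * tsize c + K j ^ 2 * (tsize b * tsize e) +
                   K j * (tsize a * tsize e + tsize b * tsize c))%N).
  apply: leq_add; [|apply: leq_mul => //].
    by apply: leq_trans (tsizeD _ _) _; apply: leq_add.
  by apply: leq_trans (tsizeD _ _) _; apply: leq_add.
by rewrite expnS expn1; lia.
Qed.

Lemma tsize_qnorm j js (x : tower (j :: js)) : (tsize (qnorm x : tower js) <= tsize x ^ 2)%N.
Proof.
case: x => a b; rewrite /qnorm -mulNr -mulrNz.
apply: leq_trans (tsizeD _ _) _.
apply: (@leq_trans (tsize a ^ 2 + K j ^ 2 * tsize b ^ 2)%N); last by rewrite /= !expnS !expn0; lia.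
apply: leq_add; first by rewrite expr2 expnS expn1; exact: tsizeM.
apply: leq_trans (tsizeZ _ _) _; rewrite abszN; apply: leq_mul => //.
by rewrite expr2 expnS expn1; exact: tsizeM.
Qed.

Lemma tsize_tnorm js (x : tower js) : (tsize (tnorm x : tower [::]) <= tsize x ^ (2 ^ size js))%N.
Proof.
elim: js x => [x|j js IH x]; first by rewrite expn0 expn1.
apply: leq_trans (IH _) _; rewrite /= expnS expnM; apply: leq_expl; exact: tsize_qnorm.
Qed.

Lemma tsize_sum js (I : Type) (s : seq I) (P : pred I) (F : I -> tower js) :
  (tsize (\sum_(i <- s | P i) F i) <= \sum_(i <- s | P i) tsize (F i))%N.
Proof.
elim/big_rec2: _ => [|i a b _ h]; first by rewrite tsize0.
by apply: leq_trans (tsizeD _ _) _; rewrite leq_add2l.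
Qed.

(** The element [a * prod sqrt (N j) ^ e j]: pairs of equal square roots are collected into
    integers, so at most one coordinate per layer is nonzero. *)
Fixpoint mono (js : seq J) (a : A5) (e : J -> nat) : tower js :=
  if js is j :: js' return tower js then
    let m := (N j ^+ (e j)./2)%:~R * mono js' a e in
    if odd (e j) then (0, m) else (m, 0)
  else a.

Lemma tsize_mono js a e :
  (tsize (mono js a e) <= tsize (a : tower [::]) * \prod_(j <- js) K j ^ e j)%N.
Proof.
elim: js => [|j js IH]; first by rewrite big_nil muln1.
rewrite big_cons /=; set m := _%:~R * _.
have hm : (tsize m <= K j ^ ((e j)./2).*2 * (tsize (a : tower [::]) * \prod_(j <- js) K j ^ e j))%N.
  apply: leq_trans (tsizeZ _ _) _; apply: leq_mul => //.
  by rewrite abszX -muln2 mulnC expnM; apply: leq_expl.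
rewrite mulnCA -{3}(odd_double_half (e j)) expnD.
case: (odd _) => /=; rewrite tsize0 ?muln0 ?addn0 ?add0n ?mul1n //.
by rewrite expn1 -mulnA leq_mul2l hm orbT.
Qed.

(* In the basis of square roots of products of the [N j], the coordinates of a sum of monomials
   collect the terms with a given parity of the exponents. *)
Lemma mono_parity (I : Type) (s : seq I) (js : seq J) (a : I -> A5) (e : I -> J -> nat)
    (eps : J -> bool) :
  \sum_(i <- s) mono js (a i) (e i) = 0 ->
  \sum_(i <- s | all (fun j => odd (e i j) == eps j) js)
     (\prod_(j <- js) N j ^+ (e i j)./2)%:~R * a i = 0.
Proof.
elim: js a s => [|j js IH] a s h.
  by rewrite -[RHS]h; apply: eq_bigr => i _; rewrite big_nil mul1r.
pose s' := [seq i <- s | odd (e i j) == eps j].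
have hs' : \sum_(i <- s') mono js ((N j ^+ (e i j)./2)%:~R * a i) (e i) = 0.
  have moZ (z : int) b (f : J -> nat) ks : mono ks (z%:~R * b) f = z%:~R * mono ks b f.
    elim: ks => //= k ks ->; rewrite qintM mulrCA.
    by case: (odd _); rewrite /= mulr0.
  have h1 := congr1 fst h; have h2 := congr1 snd h.
  rewrite fst_qsum /= in h1; rewrite snd_qsum /= in h2.
  rewrite big_filter; under eq_bigr do rewrite moZ.
  case: (eps j); [rewrite -[RHS]h2 | rewrite -[RHS]h1]; rewrite [RHS](bigID (fun i => odd (e i j))) /=.
    rewrite [X in _ + X]big1 ?addr0; last by move=> i /negbTE ->.
    by apply: eq_big => [i|i]; rewrite eqb_id // => ->.
  rewrite [X in X + _]big1 ?add0r; last by move=> i ->.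
  by apply: eq_big => [i|i]; rewrite eqbF_neg // => /negbTE ->.
have := IH _ _ hs'; rewrite big_filter_cond => h1; apply: etrans h1.
by apply: eq_big => // i _; rewrite big_cons intrM -mulrA mulrCA.
Qed.

(** * Evaluation of the tower at chosen square roots *)

Section Eval.
Variables (B : comNzRingType) (c : B) (rho : J -> B).
Hypotheses (c2 : c ^+ 2 = 5) (rho2 : forall j, rho j ^+ 2 = (N j)%:~R).

Fixpoint tev (js : seq J) : tower js -> B :=
  if js is j :: js' return tower js -> B then fun x => @tev js' x.1 + rho j * @tev js' x.2
  else fun x => (x : A5).1%:~R + c * (x : A5).2%:~R.

Lemma tevD js (x y : tower js) : tev (x + y) = tev x + tev y.
Proof.
elim: js x y => [x y|j js IH x y] /=; first by rewrite !intrD; ring.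
by rewrite !IH; ring.
Qed.

Lemma tev0 js : tev (0 : tower js) = 0.
Proof. by apply: (@addrI _ (tev (0 : tower js))); rewrite -tevD !addr0. Qed.

Lemma tev_sum js (I : Type) (s : seq I) (P : pred I) (F : I -> tower js) :
  tev (\sum_(i <- s | P i) F i) = \sum_(i <- s | P i) tev (F i).
Proof. by elim/big_rec2: _ => [|i a b _ <-]; rewrite ?tev0 ?tevD. Qed.

Lemma tev_int js (z : int) : tev (z%:~R : tower js) = z%:~R.
Proof.
elim: js => [|j js IH] /=; rewrite qintE /= ?intz ?mulr0 ?addr0 //.
by rewrite IH tev0 mulr0 addr0.
Qed.

Lemma tevM js (x y : tower js) : tev (x * y) = tev x * tev y.
Proof.
elim: js x y => [x y|j js IH x y] /=.
  have h5 : ((5 : int)%:~R : B) = c ^+ 2 by rewrite c2.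
  by case: x y => [a b] [d e] /=; rewrite !intrD !intrM h5; ring.
by rewrite !tevD !IH tev_int -rho2; ring.
Qed.

(** Each layer norm is [x] times its conjugate, so its value is a multiple of that of [x]. A power
    of [p] dividing the value thus survives the descent to [A5], where it meets a size bound. *)
Lemma tev_tnorm js (x : tower js) :
  exists y, tev (tnorm x : tower [::]) = tev x * y.
Proof.
elim: js x => [x|j js IH x]; first by exists 1; rewrite mulr1.
have [y hy] := IH (qnorm x); exists (y * (tev (x : tower (j :: js)).1 - rho j * tev (x : tower (j :: js)).2)).
rewrite [LHS]hy /qnorm -mulNr -mulrNz tevD !expr2 !tevM tev_int mulrNz -rho2 /=; ring.
Qed.

Lemma tev_mono js a e :
  tev (mono js a e) = tev (a : tower [::]) * \prod_(j <- js) rho j ^+ e j.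
Proof.
elim: js => [|j js IH]; first by rewrite big_nil mulr1.
rewrite big_cons /=.
have -> : rho j ^+ e j = rho j ^+ odd (e j) * ((N j)%:~R ^+ (e j)./2).
  by rewrite -rho2 -exprM -exprD mul2n odd_double_half.
by case: (odd _) => /=; rewrite tev0 tevM tev_int IH rmorphXn /=; ring.
Qed.

End Eval.
End Tower.

(** * Vanishing of generalized moments *)

Section Vanishing.
Variables (I J : finType) (A : comNzRingType).
Implicit Types (v : I -> A) (lam : I -> J -> nat) (t : J -> nat) (T : nat).

Definition lprod (s : seq (J * int)) (l : J -> nat) : int :=
  \prod_(x <- s) ((l x.1)%:Z - x.2).

Definition binp t (l : J -> nat) : nat := \prod_j 'C(l j, t j).

(* [van] says that the weights annihilate every polynomial of degree less than [T] that splits into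
   integral linear factors; [bvan] is its consequence for products of binomials, which is what
   Siegel's lemma provides and which implies it. *)
Definition van v lam T := forall s, (size s < T)%N ->
  \sum_i v i * (lprod s (lam i))%:~R = 0.

Definition bvan v lam T := forall t, (\sum_j t j < T)%N ->
  \sum_i v i * (binp t (lam i))%:R = 0.

Lemma van_le v lam T T' : (T' <= T)%N -> van v lam T -> van v lam T'.
Proof. by move=> le h s sz; apply: h; apply: leq_trans le. Qed.

Lemma van_ext v v' lam lam' T : (forall i, v i = v' i) ->
  (forall i, v i != 0 -> lam i =1 lam' i) -> van v lam T -> van v' lam' T.
Proof.
move=> ev el h s sz; rewrite -[RHS](h s sz); apply: eq_bigr => i _; rewrite -ev.
have [->|/el e] := eqVneq (v i) 0; first by rewrite !mul0r.
by congr (_ * _%:~R); apply: eq_bigr => x _; rewrite e.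
Qed.

Lemma bin_step (l t : nat) (c : int) :
  ((l%:Z - c) * 'C(l, t)%:Z = t.+1%:Z * 'C(l, t.+1)%:Z + (t%:Z - c) * 'C(l, t)%:Z)%R.
Proof.
have h : (t.+1 * 'C(l, t.+1) = (l - t) * 'C(l, t))%N by rewrite mul_bin_left.
case: (leqP t l) => tl; last first.
  by rewrite (bin_small tl) (@bin_small l t.+1) ?(leqW tl) // !mulr0.
have {}h : t.+1%:Z * 'C(l, t.+1)%:Z = (l%:Z - t%:Z) * 'C(l, t)%:Z.
  by rewrite -!PoszM h PoszM subzn.
by rewrite h; ring.
Qed.

Lemma binp_step t (l : J -> nat) j (c : int) :
  ((l j)%:Z - c) * (binp t l)%:Z =
  (t j).+1%:Z * (binp (fun k => t k + (k == j))%N l)%:Z + ((t j)%:Z - c) * (binp t l)%:Z.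
Proof.
rewrite /binp (bigD1 j) //= [in X in _ = _ * X + _](bigD1 j) //= eqxx addn1.
rewrite [in X in _ = _ * X + _](eq_bigr (fun k => 'C(l k, t k))); last first.
  by move=> k /negbTE ->; rewrite addn0.
by rewrite !PoszM !mulrA -mulrDl bin_step.
Qed.

(** Linear factors are absorbed into the binomials one at a time: by [binp_step], a factor
    [lam j - c] turns a product of binomials into a combination of itself and one of degree one
    higher. The degree of the binomials plus the number of remaining factors stays below [T]. *)
Lemma bvan_van v lam T : bvan v lam T -> van v lam T.
Proof.
move=> h s sz; suff: forall t, (\sum_j t j + size s < T)%N ->
    \sum_i v i * (binp t (lam i))%:R * (lprod s (lam i))%:~R = 0.
  move=> /(_ (fun=> 0%N)); rewrite big1 // => /(_ sz) e; rewrite -[RHS]e.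
  apply: eq_bigr => i _; congr (_ * _); rewrite /binp big1 ?mulr1 // => j _; exact: bin0.
elim: s {sz} => [|[j c] s IH] t sz.
  rewrite addn0 in sz; rewrite -[RHS](h _ sz); apply: eq_bigr => i _.
  by rewrite /lprod big_nil mulr1.
pose t' k := (t k + (k == j))%N.
have st : (\sum_k t' k = (\sum_k t k).+1)%N.
  by rewrite big_split /= -big_mkcond /= big_pred1_eq addn1.
have h1 : \sum_i v i * (binp t' (lam i))%:R * (lprod s (lam i))%:~R = 0.
  by apply: IH; rewrite st addSnnS.
have h2 : \sum_i v i * (binp t (lam i))%:R * (lprod s (lam i))%:~R = 0.
  by apply: IH; apply: leq_trans sz; rewrite /= addnS.
transitivity ((t j).+1%:Z%:~R * (\sum_i v i * (binp t' (lam i))%:R * (lprod s (lam i))%:~R) +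
  ((t j)%:Z - c)%:~R * \sum_i v i * (binp t (lam i))%:R * (lprod s (lam i))%:~R :> A); last first.
  by rewrite h1 h2 !mulr0 addr0.
rewrite !mulr_sumr -big_split /=; apply: eq_bigr => i _.
have /(congr1 (fun z : int => z%:~R : A)) := binp_step t (lam i) j c.
rewrite rmorphD !rmorphM /= -/t' => e.
rewrite {1}/lprod big_cons rmorphM /= -/(lprod s (lam i)).
transitivity (v i * ((((lam i j)%:Z - c)%:~R) * (binp t (lam i))%:~R) * (lprod s (lam i))%:~R).
  by ring.
by rewrite e; ring.
Qed.

Definition ffseq t : seq (J * int) :=
  flatten [seq [seq (j, k%:Z) | k <- iota 0 (t j)] | j <- index_enum J].

Lemma size_ffseq t : size (ffseq t) = \sum_j t j.
Proof.
rewrite /ffseq size_flatten /shape -map_comp sumnE big_map; apply: eq_bigr => j _.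
by rewrite /= size_map size_iota.
Qed.

Lemma lprod_ffseq t (l : J -> nat) :
  lprod (ffseq t) l = ((\prod_j (t j)`!) * binp t l)%N%:Z.
Proof.
rewrite /lprod /ffseq /binp -big_split /= big_flatten big_map /=.
rewrite (big_morph Posz PoszM (erefl _)); apply: eq_bigr => j _.
rewrite big_map /= mulnC bin_ffact; elim: (t j) => [|m IH]; first by rewrite big_nil ffactn0.
rewrite -addn1 iotaD big_cat /= IH big_cons big_nil mulr1 add0n addn1 ffactnSr.
case: (leqP m (l j)) => ml; first by rewrite PoszM subzn.
by rewrite ffact_small ?mul0r.
Qed.

(** The binomials split into the linear factors [ffseq t] after multiplication by factorials, which
    are then cancelled because [A] is torsion-free. The price is the degree of the binomials. *)
Lemma van_bin v lam T t : no_tor A -> van v lam T ->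
  van (fun i => v i * (binp t (lam i))%:R) lam (T - \sum_j t j).
Proof.
move=> tA h s sz; have f0 : (0 < \prod_j (t j)`!)%N by rewrite prodn_gt0 // => j; rewrite fact_gt0.
apply: (tA (\prod_j (t j)`!).-1); rewrite prednK //.
have := h (ffseq t ++ s); rewrite size_cat size_ffseq -ltn_subRL => /(_ sz) e.
rewrite -[RHS]e -mulr_natr mulr_suml; apply: eq_bigr => i _.
rewrite /lprod big_cat /= -!/(lprod _ _) lprod_ffseq rmorphM /= PoszM rmorphM /=.
by rewrite -!pmulrn; ring.
Qed.

(** Since [2 (lam' - c) = lam - (eps + 2 c)], a linear factor in [lam'] is half of one in [lam], and
    powers of 2 cancel. Halving the exponents costs no order of vanishing. *)
Lemma van_half v lam lam' (eps : J -> nat) T : no_tor A ->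
  (forall i, v i != 0 -> forall j, lam i j = (eps j + 2 * lam' i j)%N) ->
  van v lam T -> van v lam' T.
Proof.
move=> tA hl h s sz.
apply: (tA (2 ^ size s).-1)%N; rewrite prednK ?expn_gt0 //.
pose s' := [seq (x.1, (eps x.1)%:Z + 2 * x.2) | x <- s].
have := h s'; rewrite size_map => /(_ sz) e.
rewrite -[RHS]e -mulr_natr mulr_suml; apply: eq_bigr => i _.
have [->|/hl e2] := eqVneq (v i) 0; first by rewrite !mul0r.
have -> : lprod s' (lam i) = 2 ^+ size s * lprod s (lam' i).
  rewrite /lprod big_map; elim: (s) => [|x r IH]; first by rewrite !big_nil mulr1.
  by rewrite !big_cons IH e2 /= exprS PoszD PoszM; ring.
by rewrite rmorphM rmorphXn /= natrX -mulrA; congr (_ * _); rewrite mulrC.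
Qed.

End Vanishing.

(** * Truncated p-adic exponentials and extrapolation *)

Section Exponential.
Variables (p M : nat).

Section Additive.
Variables (A : comNzRingType) (f : nat -> A).
Hypotheses (pM : p%:R ^+ M = 0 :> A) (fK : forall k, (k < M)%N -> (k`!)%:R * f k = 1).

(* [f k] plays the role of [1 / k!], so that [expp x] is [exp (p x)]. *)
Definition expp (x : A) : A := \sum_(m < M) p%:R ^+ m * f m * x ^+ m.

Let E (x : A) := \poly_(m < M) (f m * x ^+ m).

Lemma exppE x : expp x = (E x).[p%:R].
Proof. by rewrite horner_poly; apply: eq_bigr => m _; rewrite -mulrA mulrC. Qed.

(** Evaluation at [p] sees only the coefficients below [M]; this makes the truncated exponential
    multiplicative without error. *)
Lemma horner_take (P : {poly A}) : P.[p%:R] = (take_poly M P).[p%:R].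
Proof. by rewrite -{1}(poly_take_drop M P) hornerD hornerM hornerXn pM mulr0 addr0. Qed.

Lemma expp_bin n i : (i <= n < M)%N -> f n * ('C(n, i))%:R = f i * f (n - i).
Proof.
move=> /andP[li ln].
have lin : (i < M)%N := leq_ltn_trans li ln.
have lnn : (n - i < M)%N := leq_ltn_trans (leq_subr _ _) ln.
transitivity (f n * ('C(n, i))%:R * ((i`!)%:R * f i) * (((n - i)`!)%:R * f (n - i))).
  by rewrite !fK ?mulr1.
transitivity ((f n * ('C(n, i) * (i`! * (n - i)`!))%:R) * (f i * f (n - i))).
  by rewrite !natrM; ring.
by rewrite bin_fact // (mulrC (f n)) fK // mul1r.
Qed.

Lemma exppD x y : expp (x + y) = expp x * expp y.
Proof.
rewrite !exppE mulrC -hornerM horner_take [RHS]horner_take; congr (_.[_]).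
apply/polyP => n; rewrite !coef_take_poly; case: ifP => // nM.
rewrite coefM coef_poly nM exprDn mulr_sumr; apply: eq_bigr => i _.
have le_in : (i <= n)%N by rewrite -ltnS.
rewrite !coef_poly (leq_ltn_trans le_in nM) (leq_ltn_trans (leq_subr _ _) nM).
have := @expp_bin n i; rewrite le_in nM => /(_ isT) e.
transitivity (f n * ('C(n, i))%:R * (x ^+ (n - i) * y ^+ i)); first by rewrite -mulr_natr; ring.
by rewrite e; ring.
Qed.

Lemma expp0 : (0 < M)%N -> expp 0 = 1.
Proof.
rewrite /expp; case: M fK => // M' fK' _; rewrite big_ord_recl big1 => [|i _]; last by rewrite expr0n mulr0.
by rewrite addr0 !expr0 mulr1 mul1r -(fK' 0%N) ?mul1r.
Qed.

Lemma expp_sum (I : Type) (s : seq I) (P : pred I) (F : I -> A) : (0 < M)%N ->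
  expp (\sum_(i <- s | P i) F i) = \prod_(i <- s | P i) expp (F i).
Proof. by move=> M0; rewrite (big_morph _ exppD (expp0 M0)). Qed.

Lemma exppMn x n : (0 < M)%N -> expp (x *+ n) = expp x ^+ n.
Proof.
by move=> M0; elim: n => [|n IH]; rewrite ?mulr0n ?expp0 // mulrS exppD IH exprS.
Qed.

Definition dv k (x : A) := exists y, x = p%:R ^+ k * y.

Lemma dvD k x y : dv k x -> dv k y -> dv k (x + y).
Proof. by move=> [a ->] [b ->]; exists (a + b); rewrite mulrDr. Qed.

Lemma dvN k x : dv k x -> dv k (- x).
Proof. by move=> [a ->]; exists (- a); rewrite mulrN. Qed.

Lemma dvMr k x y : dv k x -> dv k (x * y).
Proof. by move=> [a ->]; exists (a * y); rewrite mulrA. Qed.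

Lemma dvMl k x y : dv k x -> dv k (y * x).
Proof. by rewrite mulrC; exact: dvMr. Qed.

Lemma dv0 k : dv k 0.
Proof. by exists 0; rewrite mulr0. Qed.

Lemma dvW k k' x : (k' <= k)%N -> dv k x -> dv k' x.
Proof.
by move=> le [a ->]; exists (p%:R ^+ (k - k') * a); rewrite mulrA -exprD subnKC.
Qed.

Lemma dv_sum k (I : Type) (s : seq I) (P : pred I) (F : I -> A) :
  (forall i, P i -> dv k (F i)) -> dv k (\sum_(i <- s | P i) F i).
Proof. by move=> h; elim/big_rec: _ => [|i x Pi]; [exact: dv0 | apply: dvD; exact: h]. Qed.

Lemma dvM0 x : dv M x -> x = 0.
Proof. by move=> [y ->]; rewrite pM mul0r. Qed.

(** Successive approximation: if [expp l] agrees with [1 + p x] modulo [p ^ (k + 1)], multiplying it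
    by the exponential of the relative error gains one more power of [p], because [expp d] is
    [1 + p d] up to terms of order at least two. *)
Lemma expp_log x : (1 < M)%N -> exists l, 1 + p%:R * x = expp l.
Proof.
move=> M1; have M0 := ltnW M1.
have small k (d : A) : (0 < k)%N -> dv k (p%:R * d) -> dv k.+1 (expp d - (1 + p%:R * d)).
  move=> k0 [y hy]; rewrite /expp.
  case: M M1 fK => [|[|M']] // _ fK'.
  rewrite 2!big_ord_recl /= !expr0 !expr1 !mul1r mulr1.
  have f0 : f 0 = 1 by rewrite -(fK' 0%N) ?mul1r.
  have f1 : f 1 = 1 by rewrite -(fK' 1%N) ?mul1r.
  rewrite f0 f1 mulr1; set S := \sum_(_ < _) _.
  have -> : 1 + (p%:R * d + S) - (1 + p%:R * d) = S by ring.
  rewrite {}/S.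
  apply: dv_sum => i _; rewrite /bump /= !add1n.
  rewrite mulrAC -exprMn hy exprMn -exprM; apply: dvMr; apply: dvMr.
  exists (p%:R ^+ (k * i.+2 - k.+1)); rewrite -exprD subnKC //; nia.
suff [l hl] : exists l, dv M (1 + p%:R * x - expp l).
  by exists l; apply/eqP; rewrite -subr_eq0; apply/eqP; exact: dvM0.
rewrite -(prednK M0); elim: M.-1 => [|k [l hl]].
  by exists 0; rewrite expp0 // addrC addKr; exists x; rewrite expr1.
have ll : expp l * expp (- l) = 1 by rewrite -exppD subrr expp0.
have [y hy] := dvMl (expp (- l)) hl.
pose d := p%:R ^+ k * y.
have hd : dv k.+1 (p%:R * d) by exists y; rewrite exprS mulrA.
have := dvMl (expp l) (small _ _ (ltn0Sn k) hd) => h1.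
exists (l + d); rewrite exppD.
have -> : 1 + p%:R * x - expp l * expp d = - (expp l * (expp d - (1 + p%:R * d))).
  have e : p%:R * d = expp (- l) * (1 + p%:R * x - expp l).
    by rewrite hy exprS mulrA.
  rewrite e mulrBr mulrDr mulrA ll; ring.
exact: dvN.
Qed.

End Additive.

Section Peel.
Variables (B : comNzRingType).
Local Notation dv := (@dv B).

Lemma coef_XaddC_gt (c : B) m n : (m < n)%N -> ((('X + c%:P) ^+ m)`_n) = 0.
Proof.
move=> mn; apply: nth_default; apply: leq_trans mn; apply: leq_trans (size_exp_leq _ _) _.
by rewrite size_XaddC mul1n.
Qed.

Definition dvP e (Q : {poly B}) := forall m, dv (m + e) Q`_m.

Lemma dvP_shift e Q c : dvP e Q -> dvP e (Q \Po ('X + c%:P)).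
Proof.
move=> h n; rewrite comp_polyE coef_sum; apply: dv_sum => m _; rewrite coefZ.
case: (ltnP m n) => mn; first by rewrite coef_XaddC_gt // mulr0; exact: dv0.
by apply: dvMr; apply: dvW (h m); rewrite leq_add2r.
Qed.

(** With [c] a unit, [X + c] is invertible as a power series and cancels modulo [X ^ d]. *)
Lemma coef_unit_mul d (S : {poly B}) (c : B) k : (exists c', c * c' = 1) ->
  (forall m, (m < d)%N -> (S * ('X + c%:P) ^+ k)`_m = 0) ->
  forall m, (m < d)%N -> S`_m = 0.
Proof.
move=> [c' cc']; elim: k S => [|k IH] S h; first by move=> m md; have := h m md; rewrite expr0 mulr1.
have {}h : forall m, (m < d)%N -> (S * ('X + c%:P))`_m = 0.
  by apply: IH => m md; rewrite -mulrA -exprS; exact: h.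
elim=> [|m IHm] md.
  have := h 0%N md; rewrite mulrDr coefD coefMX coefMC add0r => e.
  by rewrite -[LHS]mulr1 -cc' mulrA e mul0r.
have := h m.+1 md; rewrite mulrDr coefD coefMX coefMC IHm ?(ltnW md) // add0r => e.
by rewrite -[LHS]mulr1 -cc' mulrA e mul0r.
Qed.

(* Such a [Q] is a power series in [p X]. Each zero of order [d] divides off a factor and
   gains [p ^ d], as long as the differences of the zeros are units. *)
Lemma peel d (pts : seq B) e (Q : {poly B}) : dvP e Q -> uniq pts ->
  (forall z, z \in pts -> forall m, (m < d)%N -> (Q \Po ('X + z%:P))`_m = 0) ->
  (forall z z', z \in pts -> z' \in pts -> z != z' -> exists c, (z - z') * c = 1) ->
  forall y, dv (e + d * size pts) Q.[y].
Proof.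
elim: pts e Q => [|z pts IH] e Q hQ /=.
  move=> _ _ _ y; rewrite muln0 addn0 horner_coef; apply: dv_sum => i _.
  by apply: dvMr; apply: dvW (hQ i); rewrite leq_addl.
move=> /andP[zp up] hz hd y.
pose Qz := Q \Po ('X + z%:P); pose R := drop_poly d Qz.
have QzE : Qz = R * 'X^d.
  rewrite -[LHS](poly_take_drop d); rewrite [X in X + _](_ : _ = 0) ?add0r //.
  apply/polyP => m; rewrite coef_take_poly coef0; case: ifP => // md.
  by apply: hz => //; rewrite mem_head.
pose Q1 := R \Po ('X + (- z)%:P).
have hQ1 : dvP (e + d) Q1.
  apply: dvP_shift => m; rewrite coef_drop_poly.
  by have := dvP_shift z hQ (m + d)%N; rewrite -addnA (addnC d).
have QE : Q = Q1 * ('X + (- z)%:P) ^+ d.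
  transitivity (Qz \Po ('X + (- z)%:P)); last by rewrite QzE comp_polyM rmorphXn /= comp_polyX.
  by rewrite -comp_polyA comp_polyD comp_polyX comp_polyC -addrA -polyCD addNr addr0 comp_polyXr.
have h1 : dv (e + d + d * size pts) Q1.[y].
  apply: IH => // [z' z'p m md|z' z'' hz' hz'']; last by apply: hd; rewrite inE ?hz' ?hz'' orbT.
  have [c hc] : exists c, (z' - z) * c = 1.
    by apply: hd; rewrite ?mem_head ?inE ?z'p ?orbT //; apply: contraNneq zp => <-.
  apply: (@coef_unit_mul d _ (z' - z) d) md; first by exists c.
  move=> m' m'd; rewrite -[RHS](hz z' _ m' m'd) ?inE ?z'p ?orbT //.
  rewrite [in RHS]QE comp_polyM rmorphXn /= comp_polyD comp_polyX comp_polyC.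
  by rewrite -addrA -polyCD.
by rewrite QE hornerM mulnS addnA; apply: dvMr.
Qed.

Variable f : nat -> B.
Hypotheses (pM : p%:R ^+ M = 0 :> B) (fK : forall k, (k < M)%N -> (k`!)%:R * f k = 1).

Let F k : {poly B} := (f k)%:P.
Let PpM : p%:R ^+ M = 0 :> {poly B}.
Proof. by rewrite -polyC_natr -polyC_exp pM. Qed.
Let PfK k : (k < M)%N -> (k`!)%:R * F k = 1 :> {poly B}.
Proof. by move=> kM; rewrite -polyC_natr -polyCM fK. Qed.

Lemma expp_comp (q x : {poly B}) : expp F x \Po q = expp F (x \Po q).
Proof.
rewrite /expp rmorph_sum; apply: eq_bigr => i _.
by rewrite !rmorphM !rmorphXn /= rmorph_nat comp_polyC.
Qed.

Lemma exppC x : expp F x%:P = (expp f x)%:P.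
Proof.
rewrite /expp rmorph_sum; apply: eq_bigr => i _.
by rewrite !rmorphM !rmorphXn /= rmorph_nat.
Qed.

Lemma coef_expp x k : (expp F (x%:P * 'X))`_k =
  if (k < M)%N then p%:R ^+ k * f k * x ^+ k else 0.
Proof.
rewrite /expp coef_sum; have E (m : 'I_M) :
    (p%:R ^+ m * F m * (x%:P * 'X) ^+ m)`_k = if m == k :> nat then p%:R ^+ m * f m * x ^+ m else 0.
  rewrite exprMn -polyC_natr -!polyC_exp mulrA -!polyCM coefCM coefXn.
  by rewrite eq_sym; case: eqP => _; rewrite ?mulr1 ?mulr0.
rewrite (eq_bigr _ (fun m _ => E m)) -big_mkcond /=; case: ifP => kM.
  by rewrite (big_pred1 (Ordinal kM)).
by rewrite big_pred0 // => m; apply/negbTE/eqP => mk; move: kM; rewrite -mk ltn_ord.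
Qed.

(** A p-adic Schwarz lemma. The Taylor coefficient of order [m] at [z] of the exponential sum is
    [p ^ m f m] times the sum in the hypothesis, so each [z] is a zero of order [d], and [peel]
    gains [p ^ d] from each. *)
Lemma extrapolation (I : finType) (v L : I -> B) d (pts : seq B) : (0 < M)%N -> uniq pts ->
  (forall z, z \in pts -> forall m, (m < d)%N ->
     \sum_i v i * expp f (L i * z) * L i ^+ m = 0) ->
  (forall z z', z \in pts -> z' \in pts -> z != z' -> exists c, (z - z') * c = 1) ->
  forall y, dv (d * size pts) (\sum_i v i * expp f (L i * y)).
Proof.
move=> M0 up hz hd y.
pose Q : {poly B} := \sum_i (v i)%:P * expp F ((L i)%:P * 'X).
have hQ : dvP 0 Q.
  move=> m; rewrite coef_sum addn0; apply: dv_sum => i _; rewrite coefCM; apply: dvMl.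
  by rewrite coef_expp; case: ifP => _; [exists (f m * L i ^+ m); rewrite mulrA | exact: dv0].
have Qshift z : Q \Po ('X + z%:P) =
    \sum_i (v i * expp f (L i * z))%:P * expp F ((L i)%:P * 'X).
  rewrite rmorph_sum /=; apply: eq_bigr => i _; rewrite rmorphM /= comp_polyC.
  rewrite expp_comp rmorphM /= comp_polyC comp_polyX mulrDr -polyCM (exppD PpM PfK) exppC.
  by rewrite polyCM; ring.
have QE : Q.[y] = \sum_i v i * expp f (L i * y).
  have -> : Q.[y] = (Q \Po ('X + y%:P)).[0] by rewrite horner_comp !hornerE.
  rewrite Qshift horner_sum; apply: eq_bigr => i _.
  rewrite hornerM hornerC [X in _ * X](_ : _ = 1) ?mulr1 //.
  by rewrite horner_coef0 coef_expp M0 !expr0 mul1r mulr1 -(fK M0) mul1r.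
rewrite -QE -[(d * _)%N]add0n; apply: peel => // z zp m md.
transitivity (p%:R ^+ m * f m * \sum_i v i * expp f (L i * z) * L i ^+ m); last by rewrite hz ?mulr0.
rewrite Qshift coef_sum mulr_sumr.
case: (ltnP m M) => mM; last first.
  have pm0 : p%:R ^+ m = 0 :> B by rewrite -(subnKC mM) exprD pM mul0r.
  rewrite [LHS]big1 => [|i _]; last by rewrite coefCM coef_expp ltnNge mM mulr0.
  by rewrite big1 // => i _; rewrite pm0 !mul0r.
by apply: eq_bigr => i _; rewrite coefCM coef_expp mM; ring.
Qed.

(** Powers of the linear form expand into products of the [lam i j], which are linear factors in the
    sense of [lprod]. So the order of vanishing in the exponents becomes one in the analytic
    variable. *)
Lemma van_pow (I J : finType) (v : I -> B) (lam : I -> J -> nat) (l : J -> B) d :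
  van v lam d -> forall m, (m < d)%N -> \sum_i v i * (\sum_j (lam i j)%:R * l j) ^+ m = 0.
Proof.
move=> h m md; suff: forall s, (size s + m < d)%N ->
    \sum_i v i * (lprod s (lam i))%:~R * (\sum_j (lam i j)%:R * l j) ^+ m = 0.
  move=> /(_ [::] md) e; rewrite -[RHS]e; apply: eq_bigr => i _.
  by rewrite /lprod big_nil mulr1.
elim: m {md} => [|m IH] s sz.
  rewrite addn0 in sz; rewrite -[RHS](h s sz); apply: eq_bigr => i _.
  by rewrite expr0 mulr1.
transitivity (\sum_j l j * \sum_i v i * (lprod ((j, 0) :: s) (lam i))%:~R *
   (\sum_j (lam i j)%:R * l j) ^+ m).
  under [RHS]eq_bigr do rewrite mulr_sumr.
  rewrite exchange_big /=; apply: eq_bigr => i _; rewrite exprS mulrA [in LHS]mulr_sumr mulr_suml.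
  apply: eq_bigr => j _; rewrite {2}/lprod big_cons -/(lprod _ _) /= subr0 rmorphM /=.
  by rewrite -pmulrn; ring.
by rewrite big1 // => j _; rewrite IH ?mulr0 //= addSnnS.
Qed.

End Peel.
End Exponential.

Lemma leq_bin_exp n k : ('C(n, k) <= 2 ^ n)%N.
Proof.
elim: n k => [|n IH] [|k]; rewrite ?bin0 ?expn_gt0 //.
by rewrite binS expnS mul2n -addnn leq_add.
Qed.

(** * The auxiliary function and the halving step *)

Definition a5size (x : A5) : nat := (absz x.1 + 3 * absz x.2)%N.
Definition a5conj (x : A5) : A5 := (x.1, - x.2).

Section A5Size.
Let N0 (j : unit) : int := 0.
Let K0 (j : unit) : nat := 0.
Let NK0 j : (absz (N0 j) <= K0 j ^ 2)%N. Proof. by []. Qed.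

Lemma a5sizeM x y : (a5size (x * y)%R <= a5size x * a5size y)%N.
Proof. exact: (@tsizeM _ N0 K0 NK0 [::]). Qed.
Lemma a5sizeZ (z : int) x : (a5size (z%:~R * x)%R <= absz z * a5size x)%N.
Proof. exact: (@tsizeZ _ N0 K0 [::]). Qed.
Lemma a5size_sum (I : finType) (F : I -> A5) :
  (a5size (\sum_i F i)%R <= \sum_i a5size (F i))%N.
Proof. exact: (@tsize_sum _ N0 K0 [::]). Qed.
End A5Size.

Lemma a5sizeX x n : (a5size (x ^+ n)%R <= a5size x ^ n)%N.
Proof.
elim: n => [|n IH]; first by rewrite expr0.
by rewrite exprS expnS; apply: leq_trans (a5sizeM _ _) _; apply: leq_mul.
Qed.

Lemma a5size_prod (J : finType) (F : J -> A5) (G : J -> nat) :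
  (forall j, a5size (F j) <= G j)%N -> (a5size (\prod_j F j)%R <= \prod_j G j)%N.
Proof.
move=> h; elim/big_rec2: _ => // j a b _ ab.
by apply: leq_trans (a5sizeM _ _) _; apply: leq_mul.
Qed.

Lemma a5conjM x y : a5conj (x * y) = a5conj x * a5conj y.
Proof. by apply: injective_projections => /=; ring. Qed.

Lemma a5size_conj x : a5size (a5conj x) = a5size x.
Proof. by rewrite /a5size /= abszN. Qed.

Lemma a5_dom : is_dom A5.
Proof. by apply: (qext_dom int_dom); apply: (@int_sq_indep 5). Qed.

Lemma a5_no_tor : no_tor A5.
Proof. exact: qext_no_tor int_no_tor. Qed.

Section Step.
Variables (I J : finType) (xi : J -> A5) (u : A5) (q : J -> nat).
Let xib j := a5conj (xi j).
Let ub := a5conj u.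
Let N j : int := qnorm (xi j).
Let K j := a5size (xi j).
Hypotheses (q_pr : forall j, prime (q j)) (q5 : forall j, q j != 5%N)
  (qN : forall j, logn (q j) (absz (N j)) = 1%N)
  (qN' : forall j j', j != j' -> ~~ (q j %| absz (N j'))%N).
Hypothesis (uub : u * ub = 1).

Lemma xiN j : xi j * xib j = (N j)%:~R.
Proof. by rewrite qintE intz; apply: injective_projections; rewrite /N /qnorm /=; ring. Qed.

Lemma NK j : (absz (N j) <= K j ^ 2)%N.
Proof.
have := a5sizeM (xi j) (xib j); rewrite a5size_conj xiN qintE intz /a5size /= muln0 addn0.
by rewrite expnS expn1.
Qed.

Lemma xi_neq0 j : xi j <> 0.
Proof. by move=> e; have := qN j; rewrite /N e (_ : qnorm 0 = 0) // logn0. Qed.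

Variables (p M : nat) (B : comNzRingType) (f : nat -> B) (c : B) (rho eta eta' : J -> B).
Hypotheses (p_pr : prime p) (p5 : (5 < p)%N) (M_gt0 : (0 < M)%N).
Hypotheses (pM : p%:R ^+ M = 0 :> B) (fK : forall k, (k < M)%N -> (k`!)%:R * f k = 1).
Hypotheses (Binv : forall k, (0 < k < p)%N -> exists y : B, k%:R * y = 1)
  (Bdvd : forall G (z : int), (G <= M)%N -> dv p G (z%:~R : B) -> (p ^ G %| absz z)%N).
Hypotheses (c2 : c ^+ 2 = 5) (rho2 : forall j, rho j ^+ 2 = (N j)%:~R)
  (rhoU : forall j, exists y, rho j * y = 1).

Local Notation phi := (@tev J N B c rho [::]).
Local Notation phi' := (@tev J N B (- c) rho [::]).

Let c2' : (- c) ^+ 2 = 5. Proof. by rewrite sqrrN. Qed.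

Hypotheses (etaE : forall j, phi (xi j) = rho j * eta j)
  (etaE' : forall j, phi (xib j) = rho j * eta' j)
  (etaK : forall j, eta j * eta' j = 1).

Let ups : B := phi u.
Let ups' : B := phi ub.

Lemma phi_conj x : phi' x = phi (a5conj x).
Proof. by rewrite /= intrN; ring. Qed.

Lemma phi1 : phi 1 = 1. Proof. by rewrite /= mulr0 addr0. Qed.

Lemma phiX x n : phi (x ^+ n) = phi x ^+ n.
Proof.
by elim: n => [|n IH]; rewrite ?expr0 ?phi1 // exprS tevM // IH exprS.
Qed.

Lemma phi_prod (F : J -> A5) : phi (\prod_j F j) = \prod_j phi (F j).
Proof. by elim/big_rec2: _ => [|j a b _ <-]; rewrite ?phi1 // tevM. Qed.

Lemma upsK : ups * ups' = 1.
Proof. by rewrite /ups /ups' -tevM // uub phi1. Qed.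

(** Both embeddings enter: the sum of the two values is [2 a], their difference times the root of 5
    is [10 b]. So [p ^ G] divides both coordinates, which are too small for that. *)
Lemma a5_small (X : A5) G : (G <= M)%N -> dv p G (phi X) -> dv p G (phi' X) ->
  (a5size X < p ^ G)%N -> X = 0.
Proof.
case: X => a b GM h1 h2; rewrite /a5size /= => sz.
have [y1 e1] : dv p G (a%:~R + c * b%:~R) := h1.
have [y2 e2] : dv p G (a%:~R + - c * b%:~R) := h2.
have pG (z : int) k : (0 < k < p)%N -> (p ^ G %| absz (k%:Z * z)%R)%N -> (p ^ G %| absz z)%N.
  move=> /andP[k0 kp]; rewrite abszM /= Gauss_dvdr //.
  by apply: coprimeXl; rewrite prime_coprime // gtnNdvd.
have small (z : int) : (p ^ G %| absz z)%N -> (absz z < p ^ G)%N -> z = 0.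
  by move=> h3 h4; apply/eqP; rewrite -absz_eq0; apply: contraTT h3; rewrite -lt0n => z0; rewrite gtnNdvd.
have a0 : a = 0.
  apply: small; last by apply: leq_ltn_trans sz; rewrite leq_addr.
  apply: (pG _ 2%N); first by rewrite (leq_trans _ p5).
  apply: Bdvd => //; exists (y1 + y2); rewrite mulrDr -e1 -e2 intrM; ring.
have b0 : b = 0.
  apply: small; last by apply: leq_ltn_trans sz; lia.
  apply: (pG _ 2%N); first by rewrite (leq_trans _ p5).
  apply: (pG _ 5%N); first by rewrite p5.
  apply: Bdvd => //; exists (c * (y1 - y2)).
  rewrite [RHS](_ : _ = c * (p%:R ^+ G * y1 - p%:R ^+ G * y2)); last by ring.
  rewrite -e1 -e2 !intrM.
  have -> : (5%:Z)%:~R = c ^+ 2 :> B by rewrite c2.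
  by ring.
by rewrite a0 b0.
Qed.

Section Weights.
Variables (W L sg su numax : nat) (w : I -> int) (lam : I -> J -> nat) (nu : I -> nat).
Hypotheses (wW : forall i, (absz (w i) <= W)%N) (lamL : forall i j, (lam i j <= L)%N)
  (Ksg : forall j, (K j <= sg)%N) (usu : (a5size u <= su)%N)
  (nuM : forall i, (nu i <= numax)%N) (sg0 : (0 < sg)%N) (su0 : (0 < su)%N).
Variables (l : J -> B) (c0 c0' : B).
Hypothesis (c0K : c0 * c0' = 1).
Let Lam i : B := \sum_j (lam i j)%:R * l j.
(** All terms with nonzero weight have the common constant factor [c0], and [nu i] is absent from
    [Lam i] because [u] has logarithm zero. This is where the powers of [u] come free of charge. *)
Hypothesis (hE : forall i, w i != 0 ->
  \prod_j eta j ^+ lam i j * ups ^+ nu i = c0 * expp p M f (Lam i)).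

(* The exponents of [xi j] and of its conjugate add up to [L s], so that conjugation amounts to
   replacing [s] by [- s] up to a factor independent of the exponents. *)
Definition Pt (L : nat) (mu : nat) (la : J -> nat) (s : nat) : A5 :=
  u ^+ (mu * s) * \prod_j (xi j ^+ (la j * s) * xib j ^+ ((L - la j) * s)).

Let P i s := Pt L (2 * nu i) (lam i) s.

Lemma hE' i : w i != 0 ->
  \prod_j eta' j ^+ lam i j * ups' ^+ nu i = c0' * expp p M f (- Lam i).
Proof.
move=> /hE e; set X := LHS; set Y := \prod_j _ * _ in e.
have XY : X * Y = 1.
  rewrite /X /Y mulrACA -big_split /= [X in _ * X](_ : _ = 1); last first.
    by rewrite mulrC -exprMn upsK expr1n.
  by rewrite mulr1 big1 // => j _; rewrite mulrC -exprMn etaK expr1n.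
have e2 : expp p M f (Lam i) * expp p M f (- Lam i) = 1.
  by rewrite -exppD // subrr expp0.
rewrite -[LHS]mulr1 -c0K -[LHS]mulr1 -e2.
transitivity (X * (c0 * expp p M f (Lam i)) * (c0' * expp p M f (- Lam i))); first by ring.
by rewrite -e XY mul1r.
Qed.

Let D : B := \prod_j (rho j * eta' j) ^+ L * c0 ^+ 2.
Let D' : B := \prod_j (rho j * eta j) ^+ L * c0' ^+ 2.

Let unitM (x y : B) : (exists x', x * x' = 1) -> (exists y', y * y' = 1) ->
  exists z', (x * y) * z' = 1.
Proof. by move=> [x' ex] [y' ey]; exists (x' * y'); rewrite mulrACA ex ey mulr1. Qed.
Let unitX (x : B) n : (exists x', x * x' = 1) -> exists z', (x ^+ n) * z' = 1.
Proof. by move=> [x' ex]; exists (x' ^+ n); rewrite -exprMn ex expr1n. Qed.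
Let unit_prod (F : J -> B) : (forall j, exists x', F j * x' = 1) ->
  exists z', (\prod_j F j) * z' = 1.
Proof.
move=> h; elim/big_rec: _ => [|j x _]; first by exists 1; rewrite mulr1.
by move=> hx; apply: unitM.
Qed.

Lemma DU : exists y, D * y = 1.
Proof.
apply: unitM; last by apply: unitX; exists c0'.
by apply: unit_prod => j; apply: unitX; apply: unitM => //; exists (eta j); rewrite mulrC.
Qed.

Lemma DU' : exists y, D' * y = 1.
Proof.
apply: unitM; last by apply: unitX; exists c0; rewrite mulrC.
by apply: unit_prod => j; apply: unitX; apply: unitM => //; exists (eta' j).
Qed.

(** As [et'] is inverse to [et], [et' ^ ((L - lam) s)] equals [et' ^ (L s)] times [et ^ (lam s)].
    Hence each term is a factor common to all [i] times the [2 s]-th power of the left side of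
    [hE]. *)
Lemma phiP_aux (et et' : J -> B) (up : B) i s : (forall j, et j * et' j = 1) ->
  up ^+ (2 * nu i * s) * \prod_j ((rho j * et j) ^+ (lam i j * s) * (rho j * et' j) ^+ ((L - lam i j) * s)) =
  (\prod_j (rho j * et' j) ^+ L) ^+ s * (\prod_j et j ^+ lam i j * up ^+ nu i) ^+ (2 * s).
Proof.
move=> eK; rewrite [in RHS]exprMn -[X in _ = X * _]prodrXl -[X in _ = _ * (X * _)]prodrXl.
rewrite [RHS]mulrA -big_split [RHS]mulrC /= -exprM; congr (_ * _).
  by congr (_ ^+ _); rewrite mulnCA mulnA.
apply: eq_bigr => j _.
have e1 : ((L - lam i j) * s + lam i j * s = L * s)%N by rewrite -mulnDl subnK.
rewrite -!exprM -e1 !exprMn !exprD mul2n -addnn mulnDr exprD.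
have e2 : et j ^+ (lam i j * s) * et' j ^+ (lam i j * s) = 1 by rewrite -exprMn eK expr1n.
transitivity (rho j ^+ ((L - lam i j) * s) * rho j ^+ (lam i j * s) *
  (et j ^+ (lam i j * s) * et' j ^+ ((L - lam i j) * s)) *
  (et j ^+ (lam i j * s) * et' j ^+ (lam i j * s))); last by ring.
by rewrite e2; ring.
Qed.

(** The point [s] sits at [2 s] in the analytic variable, so half-integral points correspond to odd
    integers there. *)
Lemma phiP i s : w i != 0 -> phi (P i s) = D ^+ s * expp p M f (Lam i * (2 * s%:Z)%:~R).
Proof.
move=> wi; rewrite /P /Pt tevM // phiX -/ups phi_prod.
under eq_bigr do rewrite tevM // !phiX etaE etaE'.
rewrite (phiP_aux ups i s etaK) hE //.
have -> : Lam i * (2 * s%:Z)%:~R = Lam i *+ (2 * s) by rewrite -PoszM -pmulrn mulr_natr.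
by rewrite exppMn // exprMn /D [in RHS]exprMn -exprM mulrA.
Qed.

Lemma phiP' i s : w i != 0 -> phi' (P i s) = D' ^+ s * expp p M f (Lam i * (- (2 * s%:Z))%:~R).
Proof.
have cP : a5conj (P i s) = ub ^+ (2 * nu i * s) *
    \prod_j (xib j ^+ (lam i j * s) * xi j ^+ ((L - lam i j) * s)).
  have cX (x : A5) n : a5conj (x ^+ n) = a5conj x ^+ n.
    by elim: n => [|n IH]; rewrite ?expr0 // !exprS a5conjM IH.
  have cc x : a5conj (a5conj x) = x by case: x => a b; rewrite /a5conj /= opprK.
  rewrite /P /Pt a5conjM cX (big_morph a5conj a5conjM (_ : a5conj 1 = 1)) //; congr (_ * _).
  by apply: eq_bigr => j _; rewrite a5conjM !cX cc.
move=> wi; rewrite phi_conj cP tevM // phiX -/ups' phi_prod.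
under eq_bigr do rewrite tevM // !phiX etaE etaE'.
rewrite (@phiP_aux eta' eta) => [|j]; last by rewrite mulrC.
rewrite hE' //.
have -> : Lam i * (- (2 * s%:Z))%:~R = (- Lam i) *+ (2 * s).
  by rewrite mulrNz -PoszM -pmulrn mulrN mulr_natr mulNrn.
by rewrite exppMn // exprMn /D' [in RHS]exprMn -exprM mulrA.
Qed.

Lemma van_phi (v : I -> A5) T' (ph : A5 -> B) : (forall x y, ph (x + y) = ph x + ph y) ->
  (forall x y, ph (x * y) = ph x * ph y) -> (forall z : int, ph z%:~R = z%:~R) ->
  van v lam T' -> van (fun i => ph (v i)) lam T'.
Proof.
move=> hD hM hZ h s sz; have h0 : ph 0 = 0 by rewrite -[0]/(0%:~R) hZ.
rewrite -[RHS]h0 -[in RHS](h s sz) (big_morph ph hD h0); apply: eq_bigr => i _.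
by rewrite hM hZ.
Qed.

Lemma van_scale (v v' : I -> B) a T' : (exists y, a * y = 1) ->
  (forall i, v i = a * v' i) -> van v lam T' -> van v' lam T'.
Proof.
move=> [y ay] hv h s sz; rewrite -[RHS](mulr0 y) -[in RHS](h s sz) mulr_sumr.
by apply: eq_bigr => i _; rewrite hv !mulrA (mulrC y) ay mul1r.
Qed.

Let phiD x y : phi (x + y) = phi x + phi y. Proof. exact: (@tevD _ N _ c rho [::]). Qed.
Let phiM x y : phi (x * y) = phi x * phi y. Proof. exact: (@tevM _ N _ c rho c2 rho2 [::]). Qed.
Let phiZ z : phi z%:~R = z%:~R. Proof. exact: (@tev_int _ N _ c rho [::]). Qed.
Let phiD' x y : phi' (x + y) = phi' x + phi' y. Proof. exact: (@tevD _ N _ _ rho [::]). Qed.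
Let phiM' x y : phi' (x * y) = phi' x * phi' y. Proof. exact: (@tevM _ N _ _ rho c2' rho2 [::]). Qed.
Let phiZ' z : phi' z%:~R = z%:~R. Proof. exact: (@tev_int _ N _ _ rho [::]). Qed.

Section Extrapolate.
Variables (S : seq nat) (pts : seq int) (d T : nat).
Hypotheses (ptsS : forall z, z \in pts -> absz z \in S) (upts : uniq pts)
  (ptsp : forall z, z \in pts -> (4 * absz z < p)%N)
  (vanS : forall s, s \in S -> van (fun i => (w i)%:~R * P i s) lam T)
  (dM : (d * size pts <= M)%N).

(** Negative points are treated by the second embedding, where conjugation has turned [s] into
    [- s]. The condition [4 |z| < p] makes the differences [2 (z - z')] units. *)
Lemma extrapolated t (y : B) : (\sum_j t j + d <= T)%N ->
  dv p (d * size pts) (\sum_i (w i)%:~R * (binp t (lam i))%:R * expp p M f (Lam i * y)).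
Proof.
move=> tT; have small (z : int) : (0 < absz z < p)%N -> exists c' : B, z%:~R * c' = 1.
  case: z => n h; first exact: Binv.
  by have [y' hy] := Binv h; exists (- y'); rewrite NegzE mulrNz mulrN mulNr opprK.
have df (z z' : int) : z \in pts -> z' \in pts -> z != z' ->
    exists c', ((2 * z)%:~R - (2 * z')%:~R : B) * c' = 1.
  move=> zp z'p zz; rewrite -intrB; apply: small; have := ptsp zp; have := ptsp z'p; lia.
pose pts' : seq B := [seq (2 * z)%:~R | z <- pts].
have inj : {in pts &, injective (fun z => (2 * z)%:~R : B)}.
  move=> z z' zp z'p /= e; apply/eqP; apply: contraT => /(df _ _ zp z'p)[c'].
  by rewrite e subrr mul0r => /eqP; rewrite eq_sym oner_eq0.
rewrite -(size_map (fun z => (2 * z)%:~R : B)); apply: extrapolation => //.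
- by rewrite map_inj_in_uniq.
- move=> _ /mapP[z zp ->] m md; apply: (van_pow (lam := lam)) md.
  have tT' : (d <= T - \sum_j t j)%N by rewrite leq_subRL ?(leq_trans _ tT) ?leq_addr.
  have h0 := van_le tT' (van_bin (t := t) a5_no_tor (vanS (ptsS zp))).
  case: (leP 0 z) => z0.
    have := van_phi phiD phiM phiZ h0; apply: (van_scale (a := D ^+ absz z)).
      by apply: unitX; exact: DU.
    move=> i; rewrite 2!phiM phiZ -[(binp _ _)%:R]/((Posz (binp t (lam i)))%:~R) phiZ.
    have [->|wi] := eqVneq (w i) 0; first by rewrite !mul0r mulr0.
    by rewrite phiP // gez0_abs // -!pmulrn; ring.
  have := van_phi phiD' phiM' phiZ' h0; apply: (van_scale (a := D' ^+ absz z)).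
    by apply: unitX; exact: DU'.
  move=> i; rewrite 2!phiM' phiZ' -[(binp _ _)%:R]/((Posz (binp t (lam i)))%:~R) phiZ'.
  have [->|wi] := eqVneq (w i) 0; first by rewrite !mul0r mulr0.
  by rewrite phiP' // ltz0_abs // mulrN opprK -!pmulrn; ring.
- move=> _ _ /mapP[z zp ->] /mapP[z' z'p ->] zz; apply: df => //.
  by apply: contraNneq zz => ->.
Qed.

End Extrapolate.

Lemma binp_le t i : (binp t (lam i) <= 2 ^ (#|J| * L))%N.
Proof.
have -> : (2 ^ (#|J| * L) = \prod_(j : J) 2 ^ L)%N.
  by rewrite prod_nat_const -expnM mulnC.
rewrite /binp; apply: leq_prod => j _; apply: leq_trans (leq_bin_exp _ _) _.
by rewrite leq_exp2l.
Qed.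

Let Cb : nat := (#|I| * W * 2 ^ (#|J| * L))%N.
Let Yb : nat := (su ^ (2 * numax) * sg ^ (#|J| * L))%N.

Let CbE y : (#|I| * (W * 2 ^ (#|J| * L) * y) = Cb * y)%N.
Proof. by rewrite /Cb !mulnA. Qed.

Lemma coef_size t i : (absz ((w i) * (Posz (binp t (lam i))))%R <= W * 2 ^ (#|J| * L))%N.
Proof. by rewrite abszM; apply: leq_mul => //; exact: binp_le. Qed.

Lemma P_size i s : (a5size (P i s) <= Yb ^ s)%N.
Proof.
rewrite /P /Pt expnMn; apply: leq_trans (a5sizeM _ _) _; apply: leq_mul.
  apply: leq_trans (a5sizeX _ _) _; apply: leq_trans (leq_expl _ usu) _.
  by rewrite -expnM leq_pexp2l //; apply: leq_mul => //; apply: leq_mul.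
rewrite -expnM; have -> : (sg ^ (#|J| * L * s) = \prod_(j : J) sg ^ (L * s))%N.
  by rewrite prod_nat_const -expnM; congr (_ ^ _)%N; rewrite -mulnA mulnC.
apply: a5size_prod => j; apply: leq_trans (a5sizeM _ _) _.
have e1 : (L * s = lam i j * s + (L - lam i j) * s)%N by rewrite -mulnDl subnKC.
rewrite e1 expnD; apply: leq_mul; apply: leq_trans (a5sizeX _ _) _; apply: leq_expl;
  rewrite ?/xib ?a5size_conj; exact: Ksg.
Qed.

Section Steps.
Variables (S : seq nat) (pts : seq int) (d T : nat).
Hypotheses (ptsS : forall z, z \in pts -> absz z \in S) (upts : uniq pts)
  (ptsp : forall z, z \in pts -> (4 * absz z < p)%N)
  (vanS : forall s, s \in S -> van (fun i => (w i)%:~R * P i s) lam T)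
  (dM : (d * size pts <= M)%N) (dT : (d <= T)%N).

(** The value at [s] is divisible by [p ^ (d * size pts)] in both embeddings and smaller than this
    power, hence zero. Binomials of degree below [T - d] may be inserted beforehand, since zeros of
    order [d] then remain at the points of [pts]. *)
Lemma integer_step s : (Cb * Yb ^ s < p ^ (d * size pts))%N ->
  van (fun i => (w i)%:~R * P i s) lam (T - d).
Proof.
move=> hs; apply: bvan_van => t tT.
have tT' : (\sum_j t j + d <= T)%N by move: tT; lia.
have hE2 i : ((w i)%:~R * P i s * (binp t (lam i))%:R : A5) =
    (w i * Posz (binp t (lam i)))%:~R * P i s.
  by rewrite intrM -pmulrn mulrAC.
under eq_bigr do rewrite hE2.
have phE (z : int) (b : nat) x : phi ((z * Posz b)%:~R * x) = z%:~R * b%:R * phi x.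
  by rewrite phiM phiZ intrM -pmulrn.
have phE' (z : int) (b : nat) x : phi' ((z * Posz b)%:~R * x) = z%:~R * b%:R * phi' x.
  by rewrite phiM' phiZ' intrM -pmulrn.
apply: (a5_small dM).
- rewrite (big_morph _ phiD (phiZ 0)).
  rewrite (eq_bigr (fun i => D ^+ s * ((w i)%:~R * (binp t (lam i))%:R *
     expp p M f (Lam i * (2 * s%:Z)%:~R)))).
    by rewrite -mulr_sumr; apply: dvMl; exact: (extrapolated ptsS upts ptsp vanS dM).
  move=> i _; rewrite phE; have [->|wi] := eqVneq (w i) 0; first by rewrite !mul0r mulr0.
  by rewrite phiP //; ring.
- rewrite (big_morph _ phiD' (phiZ' 0)).
  rewrite (eq_bigr (fun i => D' ^+ s * ((w i)%:~R * (binp t (lam i))%:R *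
     expp p M f (Lam i * (- (2 * s%:Z))%:~R)))).
    by rewrite -mulr_sumr; apply: dvMl; exact: (extrapolated ptsS upts ptsp vanS dM).
  move=> i _; rewrite phE'; have [->|wi] := eqVneq (w i) 0; first by rewrite !mul0r mulr0.
  by rewrite phiP' //; ring.
apply: leq_ltn_trans hs.
apply: (@leq_trans (\sum_i W * 2 ^ (#|J| * L) * Yb ^ s)%N).
  apply: leq_trans (a5size_sum _) _; apply: leq_sum => i _.
  apply: leq_trans (a5sizeZ _ _) _; apply: leq_mul; first exact: coef_size.
  exact: P_size.
by rewrite sum_nat_const /Cb !mulnA.
Qed.

Let js := index_enum J.
(** The sum at [s = 1/2], cleared by the common [xi j ^ (L/2)]: the term becomes [u ^ nu i] times
    the product of the [xi j ^ lam i j * sqrt (N j) ^ (L - lam i j)], whose only new irrationalities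
    are square roots of norms. *)
Let Yt t : tower N js := \sum_i mono N js
  ((w i * Posz (binp t (lam i)))%:~R * (u ^+ nu i * \prod_j xi j ^+ lam i j))
  (fun j => L - lam i j)%N.

Lemma size_js : size js = #|J|.
Proof. by rewrite -sum1_size sum1_card. Qed.

Lemma tnorm_eq0 ks (x : tower N ks) : uniq ks -> tnorm x = 0 -> x = 0.
Proof.
elim: ks x => // j ks IH x uk h; have uks : uniq ks by case/andP: uk.
by apply: (tnorm_layer_eq0 q_pr q5 qN qN' uk); apply: IH.
Qed.

(** The norm to [A5] raises the size bound [Cb * Yb] to the power [2 ^ #|J|], while divisibility by
    [p ^ (d * size pts)] persists; with at least [2 ^ #|J|] points the latter wins. *)
Lemma tower_vanish t : (\sum_j t j + d <= T)%N -> (2 ^ #|J| <= size pts)%N ->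
  (Cb * Yb < p ^ d)%N -> Yt t = 0.
Proof.
move=> tT szp hs; apply: (tnorm_eq0 (index_enum_uniq J)).
apply: (a5_small dM).
- have [y ->] := tev_tnorm c2 rho2 (Yt t); apply: dvMr.
  rewrite tev_sum (eq_bigr (fun i => (\prod_j rho j ^+ L * c0) * ((w i)%:~R * (binp t (lam i))%:R *
     expp p M f (Lam i * 1)))).
    by rewrite -mulr_sumr; apply: dvMl; exact: (extrapolated ptsS upts ptsp vanS dM).
  move=> i _; rewrite tev_mono // phiM phiZ intrM -pmulrn mulr1.
  have [->|wi] := eqVneq (w i) 0; first by rewrite !mul0r mulr0.
  rewrite phiM phiX phi_prod; under eq_bigr do rewrite phiX etaE exprMn.
  rewrite [in X in _ * (_ * X) * _]big_split /=.
  have -> : \prod_j rho j ^+ L = \prod_j rho j ^+ lam i j * \prod_(j <- js) rho j ^+ (L - lam i j).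
    by rewrite -big_split /=; apply: eq_bigr => j _; rewrite -exprD subnKC.
  transitivity ((w i)%:~R * (binp t (lam i))%:R * (\prod_j eta j ^+ lam i j * ups ^+ nu i) *
    (\prod_j rho j ^+ lam i j * \prod_(j <- js) rho j ^+ (L - lam i j))); first by rewrite /ups; ring.
  by rewrite hE //; ring.
- have [y ->] := tev_tnorm c2' rho2 (Yt t); apply: dvMr.
  rewrite tev_sum (eq_bigr (fun i => (\prod_j rho j ^+ L * c0') * ((w i)%:~R * (binp t (lam i))%:R *
     expp p M f (Lam i * -1)))).
    by rewrite -mulr_sumr; apply: dvMl; exact: (extrapolated ptsS upts ptsp vanS dM).
  move=> i _; rewrite tev_mono // phiM' phiZ' intrM -pmulrn mulrN1.
  have [->|wi] := eqVneq (w i) 0; first by rewrite !mul0r mulr0.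
  have cX (x : A5) n : a5conj (x ^+ n) = a5conj x ^+ n.
    by elim: n => [|n IH]; rewrite ?expr0 // !exprS a5conjM IH.
  rewrite phi_conj a5conjM cX (big_morph a5conj a5conjM (_ : a5conj 1 = 1)) //.
  rewrite phiM phiX phi_prod; under eq_bigr do rewrite cX phiX etaE' exprMn.
  rewrite [in X in _ * (_ * X) * _]big_split /=.
  have -> : \prod_j rho j ^+ L = \prod_j rho j ^+ lam i j * \prod_(j <- js) rho j ^+ (L - lam i j).
    by rewrite -big_split /=; apply: eq_bigr => j _; rewrite -exprD subnKC.
  transitivity ((w i)%:~R * (binp t (lam i))%:R * (\prod_j eta' j ^+ lam i j * ups' ^+ nu i) *
    (\prod_j rho j ^+ lam i j * \prod_(j <- js) rho j ^+ (L - lam i j))); first by rewrite /ups'; ring.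
  by rewrite hE' //; ring.
have := tsize_tnorm NK (Yt t); rewrite size_js => h; apply: leq_ltn_trans h _.
apply: (@leq_trans (p ^ (d * 2 ^ #|J|))%N); last by rewrite leq_pexp2l ?prime_gt0 // leq_mul2l szp orbT.
rewrite expnM ltn_exp2r ?expn_gt0 //; apply: leq_ltn_trans hs.
apply: leq_trans (tsize_sum _ _ _ _) _.
apply: (@leq_trans (\sum_i W * 2 ^ (#|J| * L) * Yb)%N).
  2: by rewrite sum_nat_const -CbE; exact: leqnn.
apply: leq_sum => i _; apply: leq_trans (tsize_mono NK _ _ _) _.
apply: (@leq_trans (W * 2 ^ (#|J| * L) * (su ^ (2 * numax) * (\prod_j K j ^ lam i j)) *
   \prod_(j <- js) K j ^ (L - lam i j))%N).
  rewrite leq_mul2r; apply/orP; right; apply: leq_trans (a5sizeZ _ _) _.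
  apply: leq_mul; first exact: coef_size.
  apply: leq_trans (a5sizeM _ _) _; apply: leq_mul.
    apply: leq_trans (a5sizeX _ _) _; apply: leq_trans (leq_expl _ usu) _.
    by rewrite leq_pexp2l //; apply: leq_trans (nuM i) _; rewrite leq_pmull.
  by apply: a5size_prod => j; exact: a5sizeX.
rewrite -!mulnA !leq_mul2l -big_split /=; apply/orP; right; apply/orP; right; apply/orP; right.
have -> : (sg ^ (#|J| * L) = \prod_(j : J) sg ^ L)%N.
  by rewrite prod_nat_const -expnM mulnC.
by apply: leq_prod => j _; rewrite -expnD subnKC //; apply: leq_expl.
Qed.

(* At half-integral points the auxiliary function lives in the tower of square roots. Its
   norm down to [A5] is small and divisible by a high power of [p], so it vanishes, and each parity
   class of exponents can then be separated and divided by 2. *)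
Lemma half_step (eps : J -> bool) : odd L -> (2 ^ #|J| <= size pts)%N ->
  (Cb * Yb < p ^ d)%N ->
  let cls i := [forall j, odd (lam i j) == eps j] in
  let lam' i j := ((lam i j)./2)%N in
  van (fun i => (if cls i then w i else 0)%:~R * Pt L./2 (nu i) (lam' i) 1) lam' (T - d).
Proof.
move=> oL szp hs cls lam'.
pose v i : A5 := (if cls i then w i else 0)%:~R * Pt L./2 (nu i) (lam' i) 1.
have clsE i : v i != 0 -> cls i.
  by rewrite /v; case: (cls i) => //; rewrite mul0r eqxx.
apply: (van_half (lam := lam) (eps := eps) a5_no_tor).
  move=> i /clsE /forallP h j; rewrite -(eqP (h j)) mul2n; exact/esym/odd_double_half.
apply: bvan_van => t tT.
have tT' : (\sum_j t j + d <= T)%N by move: tT; lia.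
have h := mono_parity (fun j => ~~ eps j) (tower_vanish tT' szp hs).
(* The part of the terms that depends only on the parity class; it is nonzero and cancels. *)
pose Z : A5 := \prod_j xi j ^+ (eps j + L./2).
have Z0 : Z <> 0.
  apply/eqP; rewrite /Z; elim/big_rec: _ => [|j x _ hx]; first exact: oner_neq0.
  apply/eqP => /a5_dom[h0|]; last exact/eqP.
  elim: (_ + _)%N h0 => [|n IH]; first by rewrite expr0 => /eqP; rewrite oner_eq0.
  by rewrite exprS => /a5_dom[|//]; exact: xi_neq0.
suff : Z * \sum_i v i * (binp t (lam i))%:R = 0 by case/a5_dom.
rewrite -[RHS]h [in RHS]big_mkcond mulr_sumr; apply: eq_bigr => i _.
(* As [L] is odd, the exponents [L - lam i j] of the square roots have the opposite parities. *)
have -> : all (fun j => odd (L - lam i j) == ~~ eps j) (index_enum J) = cls i.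
  apply/allP/forallP => [ha j|ha j _].
    have := ha j (mem_index_enum j); rewrite oddB // oL /=.
    by case: (odd _); case: (eps j).
  by rewrite oddB // oL /= (eqP (ha j)); case: (eps j).
rewrite /v; case: ifP => ci; last by rewrite !mul0r mulr0.
transitivity ((w i)%:~R * (binp t (lam i))%:R * u ^+ nu i *
   (Z * \prod_j (xi j ^+ (lam' i j * 1) * xib j ^+ ((L./2 - lam' i j) * 1)))).
  rewrite /Pt (muln1 (nu i)); ring.
transitivity ((w i)%:~R * (binp t (lam i))%:R * u ^+ nu i *
   (\prod_j ((N j)%:~R ^+ (L - lam i j)./2) * \prod_j xi j ^+ lam i j)); last first.
  have -> : (\prod_(j <- index_enum J) N j ^+ (L - lam i j)./2)%:~R =
      \prod_j ((N j)%:~R ^+ (L - lam i j)./2) :> A5.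
    by rewrite rmorph_prod; apply: eq_bigr => j _; rewrite rmorphXn.
  by rewrite intrM -pmulrn; ring.
congr (_ * _); rewrite /Z -!big_split /=; apply: eq_bigr => j _; rewrite !muln1.
have ej : odd (lam i j) = eps j by apply/eqP; move/forallP: ci.
have e1 : ((L - lam i j)./2 = L./2 - lam' i j)%N.
  rewrite /lam' -{1}(odd_double_half L) -{1}(odd_double_half (lam i j)) oL.
  by have := lamL i j; case: (odd _) => /=; lia.
have e2 : lam i j = (eps j + lam' i j + lam' i j)%N.
  by rewrite -ej -addnA addnn odd_double_half.
have le : (lam' i j <= L./2)%N by apply: half_leq.
rewrite e1 -xiN exprMn e2 !exprD -{1}(subnK le) exprD; ring.
Qed.

End Steps.

Section Full.
Variables (d T s0 : nat).
Hypotheses (hs0 : (s0 <= 1)%N) (J0 : (0 < #|J|)%N)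
  (van0 : van (fun i => (w i)%:~R * P i s0) lam T)
  (dM : (d * (2 ^ #|J|).+1 <= M)%N) (dT : (#|J|.+1 * d <= T)%N)
  (rp : (4 * 2 ^ #|J| < p)%N) (I0 : (0 < #|I|)%N) (W0 : (0 < W)%N)
  (hC : (Cb * Yb < p ^ d)%N).

Let CbYb s n : (s <= n)%N -> (0 < n)%N -> (Cb * Yb ^ s < p ^ (d * n))%N.
Proof.
move=> sn n0; rewrite expnM; apply: (@leq_ltn_trans ((Cb * Yb) ^ n)); last by rewrite ltn_exp2r.
have C0 : (0 < Cb)%N by rewrite /Cb !muln_gt0 I0 W0 expn_gt0.
have Y0 : (0 < Yb)%N by rewrite /Yb muln_gt0 !expn_gt0 su0 sg0.
rewrite expnMn; apply: leq_mul; last by rewrite leq_pexp2l.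
by rewrite -{1}(expn1 Cb) leq_pexp2l.
Qed.

Definition symints (n : nat) : seq int := [seq Posz k - Posz n | k <- iota 0 (2 * n).+1].

Lemma symints_uniq n : uniq (symints n).
Proof. by rewrite map_inj_uniq ?iota_uniq // => a b /= h; lia. Qed.

Lemma symints_abs n z : z \in symints n -> (absz z <= n)%N.
Proof. by move=> /mapP[k]; rewrite mem_iota => h ->; lia. Qed.

Lemma size_symints n : size (symints n) = (2 * n).+1.
Proof. by rewrite size_map size_iota. Qed.

(** From zeros at [- 2 ^ k, ..., 2 ^ k] one reaches twice that range, because the size at [s] grows
    like an [s]-th power and the divisibility with the number of points. Each doubling costs order
    [d]; the start is the single point [s0]. *)
Lemma grow k : (k < #|J|)%N -> forall s, (s <= 2 ^ k)%N ->
  van (fun i => (w i)%:~R * P i s) lam (T - k.+1 * d).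
Proof.
elim: k => [_ s s1|k IH kJ s sk].
  rewrite mul1n; apply: (@integer_step [:: s0] [:: Posz s0] d T) => //=.
  - by move=> z; rewrite !inE => /eqP ->.
  - move=> z; rewrite inE => /eqP -> /=; apply: leq_ltn_trans rp.
    by rewrite leq_mul2l /=; apply: leq_trans hs0 _; rewrite expn_gt0.
  - by move=> s'; rewrite inE => /eqP ->.
  - by rewrite muln1; apply: leq_trans dM; rewrite leq_pmulr.
  - by apply: leq_trans dT; rewrite leq_pmull.
  - by apply: CbYb.
have k2 : (2 ^ k.+1 <= 2 ^ #|J|)%N by rewrite leq_pexp2l // ltnW.
rewrite [(k.+2 * d)%N]mulSnr subnDA.
apply: (@integer_step (iota 0 (2 ^ k).+1) (symints (2 ^ k)) d (T - k.+1 * d)) => //.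
- by move=> z /symints_abs; rewrite mem_iota.
- exact: symints_uniq.
- move=> z /symints_abs h; apply: leq_ltn_trans rp.
  by rewrite leq_mul2l (leq_trans h) //; apply: leq_trans k2; rewrite leq_pexp2l.
- move=> s'; rewrite mem_iota => h; apply: IH; [exact: ltnW | by lia].
- rewrite size_symints -expnS; apply: leq_trans dM; rewrite leq_mul2l; lia.
- rewrite leq_subRL; last first.
    by apply: leq_trans dT; rewrite leq_mul2r; apply/orP; right; move: kJ; lia.
  by rewrite -mulSnr; apply: leq_trans dT; rewrite leq_mul2r; apply/orP; right; lia.
- by apply: CbYb; rewrite size_symints -expnS // (leq_trans sk).
Qed.

(** After [#|J|] integral extrapolations there are [2 ^ #|J| + 1] points, enough for the
    half-integral one; together the steps cost [#|J| + 1] times [d]. *)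
Lemma full_step (eps : J -> bool) : odd L ->
  let cls i := [forall j, odd (lam i j) == eps j] in
  let lam' i j := ((lam i j)./2)%N in
  van (fun i => (if cls i then w i else 0)%:~R * Pt L./2 (nu i) (lam' i) 1) lam'
      (T - #|J|.+1 * d).
Proof.
move=> oL cls lam'; have Jk : (#|J|.-1 < #|J|)%N by rewrite prednK.
have := grow Jk; rewrite prednK // => hg.
rewrite mulSnr subnDA.
have e2 : (2 * 2 ^ #|J|.-1 = 2 ^ #|J|)%N by rewrite -expnS prednK.
apply: (@half_step (iota 0 (2 ^ #|J|.-1).+1) (symints (2 ^ #|J|.-1)) d (T - #|J| * d)) => //.
- by move=> z /symints_abs; rewrite mem_iota.
- exact: symints_uniq.
- move=> z /symints_abs h; apply: leq_ltn_trans rp.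
  by rewrite leq_mul2l (leq_trans h) // leq_pexp2l // leq_pred.
- by move=> s'; rewrite mem_iota => h; apply: hg; lia.
- by rewrite size_symints e2.
- by rewrite leq_subRL -?mulSnr //; apply: leq_trans dT; rewrite leq_mul2r leqnSn orbT.
- by rewrite size_symints e2.
Qed.

End Full.

End Weights.

(** * Descent through the halvings *)

Section Levels.
Variables (Q g : nat) (E : J -> nat) (E0 : nat) (l : J -> B).
(** [eta' j ^ Q] is the inverse of the Teichmüller part of [eta j], so [p * l j] is the logarithm of
    the remaining factor, which is 1 modulo [p]; for [u] that factor is trivial. [E] and [E0] are
    discrete logarithms of the residues, read modulo [2 g]. *)
Hypotheses (lE : forall j, eta j * eta' j ^+ Q = expp p M f (l j)) (upsQ : ups * ups' ^+ Q = 1).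
Hypothesis clsQ : forall (a a' : J -> nat) b b',
  \sum_j E j * a j + E0 * b = \sum_j E j * a' j + E0 * b' %[mod 2 * g] ->
  (\prod_j eta j ^+ a j * ups ^+ b) ^+ Q = (\prod_j eta j ^+ a' j * ups ^+ b') ^+ Q.
Variables (W sg su Lam0 H0 : nat) (dl Tm : nat -> nat) (kap : I -> nat).
Hypotheses (Lam0_gt0 : (0 < Lam0)%N) (kapH : forall i, (kap i <= H0)%N) (W0 : (0 < W)%N)
  (Ksg : forall j, (K j <= sg)%N) (usu : (a5size u <= su)%N) (sg0 : (0 < sg)%N) (su0 : (0 < su)%N)
  (J0 : (0 < #|J|)%N) (rp : (4 * 2 ^ #|J| < p)%N)
  (TmS : forall m, (Tm m.+1 = Tm m + #|J|.+1 * dl m.+1)%N) (Tm0 : (#|J| * Lam0.-1 < Tm 0)%N).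

(* What remains after the exponents have been halved, [k - m] times: the exponents [lam] of the [xi j]
   are below [2 ^ m * Lam0], and [2 ^ m * kap] is that of [u]. *)
Record level (m : nat) (w : I -> int) (lam : I -> J -> nat) : Prop := Level {
  level_lam : forall i j, (lam i j < 2 ^ m * Lam0)%N;
  level_w : forall i, (absz (w i) <= W)%N;
  level_ex : exists i, w i != 0;
  level_cls : forall i i', w i != 0 -> w i' != 0 ->
    2 * (\sum_j E j * lam i j) + E0 * (2 ^ m * kap i) =
    2 * (\sum_j E j * lam i' j) + E0 * (2 ^ m * kap i') %[mod 2 ^ m.+1 * g];
  level_inj : forall i i', w i != 0 -> w i' != 0 -> lam i =1 lam i' -> i = i';
  level_van : exists2 s0, (s0 <= 1)%N &
    van (fun i => (w i)%:~R * Pt (2 ^ m * Lam0).-1 (2 ^ m * kap i) (lam i) s0) lam (Tm m)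
}.

(** [full_step] applies with the constant [h i0 ^ Q], the Teichmüller part common to all surviving
    terms. The class kept is that of a surviving [i0], so some weight stays nonzero. The congruence
    [level_cls] loses a factor 2 of its modulus at each level, which is why the modulus carries
    powers of 2. *)
Lemma levelS m w lam : (dl m.+1 * (2 ^ #|J|).+1 <= M)%N ->
  (#|I| * W * 2 ^ (#|J| * (2 ^ m.+1 * Lam0).-1) *
     (su ^ (2 * (2 ^ m * H0)) * sg ^ (#|J| * (2 ^ m.+1 * Lam0).-1)) < p ^ dl m.+1)%N ->
  level m.+1 w lam -> exists w' lam', level m w' lam'.
Proof.
move=> dM hC [hl hw [i0 wi0] hc hi [s0 s01 hv]].
pose L := (2 ^ m.+1 * Lam0).-1.
have X0 : (0 < 2 ^ m * Lam0)%N by rewrite muln_gt0 expn_gt0.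
have LE : L = (2 * (2 ^ m * Lam0)).-1 by rewrite /L expnS mulnA.
have oL : odd L by rewrite LE; case: (2 ^ m * Lam0)%N X0 => // n _; rewrite mulnS /= oddM.
have L2 : L./2 = (2 ^ m * Lam0).-1.
  by rewrite LE; case: (2 ^ m * Lam0)%N X0 => // n _; rewrite mulnS /= mul2n uphalf_double.
pose h i := \prod_j eta j ^+ lam i j * ups ^+ (2 ^ m * kap i).
pose h' i := \prod_j eta' j ^+ lam i j * ups' ^+ (2 ^ m * kap i).
have hh i : h i * h' i = 1.
  rewrite /h /h' mulrACA -exprMn upsK expr1n mulr1 -big_split /=.
  by rewrite big1 // => j _; rewrite -exprMn etaK expr1n.
have hQ i : w i != 0 -> h i ^+ Q = h i0 ^+ Q.
  move=> wi; apply: clsQ; have /eqP := hc _ _ wi wi0.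
  rewrite !expnS -!mulnA ![(E0 * (2 * _))%N]mulnCA -!mulnDr.
  rewrite -!muln_modr // eqn_pmul2l // => /eqP e.
  have d2 : (2 * g %| 2 * (2 ^ m * g))%N by rewrite dvdn_mul // dvdn_mull.
  by rewrite -(modn_dvdm _ d2) e modn_dvdm.
have hE i : w i != 0 -> \prod_j eta j ^+ lam i j * ups ^+ (2 ^ m * kap i) =
    h i0 ^+ Q * expp p M f (\sum_j (lam i j)%:R * l j).
  move=> wi; rewrite -(hQ i wi) expp_sum //.
  have -> : \prod_j expp p M f ((lam i j)%:R * l j) = h i * h' i ^+ Q.
    rewrite /h /h' exprMn mulrACA -prodrXl -big_split /=.
    rewrite -!exprM [(_ * Q)%N]mulnC [X in _ = _ * (_ * X)]exprM -exprMn upsQ expr1n mulr1.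
    apply: eq_bigr => j _; rewrite mulr_natl exppMn // -lE exprMn -!exprM.
    by rewrite [(Q * _)%N]mulnC.
  by rewrite mulrCA -exprMn hh expr1n mulr1.
have c0K : h i0 ^+ Q * h' i0 ^+ Q = 1 by rewrite -exprMn hh expr1n.
pose eps j := odd (lam i0 j).
have hv' : van (fun i => (w i)%:~R * Pt L (2 * (2 ^ m * kap i)) (lam i) s0) lam (Tm m.+1).
  by apply: van_ext hv => // i; rewrite mulnA -expnS.
have I0 : (0 < #|I|)%N by apply/card_gt0P; exists i0.
have lamL i j : (lam i j <= L)%N by rewrite /L -ltnS prednK ?hl // muln_gt0 expn_gt0.
have nuM i : (2 ^ m * kap i <= 2 ^ m * H0)%N by rewrite leq_mul2l kapH orbT.
have dT : (#|J|.+1 * dl m.+1 <= Tm m.+1)%N by rewrite TmS leq_addl.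
have := full_step hw lamL Ksg usu nuM sg0 su0 c0K hE s01 J0 hv' dM dT rp I0 W0 hC eps oL.
move=> /= hF.
pose cls i := [forall j, odd (lam i j) == eps j].
exists (fun i => if cls i then w i else 0), (fun i j => (lam i j)./2); split.
- move=> i j; have := hl i j; rewrite expnS -mulnA; lia.
- by move=> i; case: ifP.
- by exists i0; rewrite ifT //; apply/forallP => j.
- move=> i i'; case: ifP => // ci wi; case: ifP => // ci' wi'.
  have e k : cls k -> (2 * (\sum_j E j * lam k j) + E0 * (2 ^ m.+1 * kap k) =
     2 * (2 * (\sum_j E j * (lam k j)./2) + E0 * (2 ^ m * kap k)) + 2 * \sum_j E j * eps j)%N.
    move=> /forallP ck; have -> : (\sum_j E j * lam k j =
        2 * (\sum_j E j * (lam k j)./2) + \sum_j E j * eps j)%N.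
      rewrite big_distrr /= -big_split /=; apply: eq_bigr => j _.
      by rewrite -{1}(odd_double_half (lam k j)) (eqP (ck j)) -mul2n; lia.
    by rewrite expnS; lia.
  have /eqP := hc _ _ wi wi'; rewrite !e // eqn_modDr expnS -mulnA -!muln_modr //.
  by rewrite eqn_pmul2l // => /eqP.
- move=> i i'; case: ifP => // /forallP ci wi; case: ifP => // /forallP ci' wi' e.
  apply: hi => // j; rewrite -(odd_double_half (lam i j)) -(odd_double_half (lam i' j)).
  by rewrite (eqP (ci j)) (eqP (ci' j)) e.
exists 1%N => //; rewrite -L2.
by move: hF; rewrite TmS addnK.
Qed.

(** Among the terms of nonzero weight take one, [im], of maximal total exponent. The product of the
    binomials ['C(lam i j, lam im j)] vanishes at all the others and has degree at most
    [#|J| * (Lam0 - 1)], below [Tm 0]. So a single nonzero term would have to be zero. *)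
Lemma level0 w lam : ~ level 0 w lam.
Proof.
case=> hl hw [i0 wi0] hc hi [s0 s01 hv].
have [im wim hmax] : exists2 im, w im != 0 & forall i, w i != 0 ->
    (\sum_j lam i j <= \sum_j lam im j)%N.
  by case: (@arg_maxnP _ i0 (fun i => w i != 0) (fun i => \sum_j lam i j)%N wi0) => im; exists im.
have sT : (0 < Tm 0 - \sum_j lam im j)%N.
  rewrite subn_gt0; apply: leq_ltn_trans Tm0; rewrite -sum_nat_const; apply: leq_sum => j _.
  by have := hl im j; rewrite mul1n; case: (Lam0).
have := van_bin a5_no_tor hv (t := lam im) (s := [::]) sT.
rewrite (bigD1 im) //= [X in _ + X]big1 => [|i iim]; last first.
  have [->|wi] := eqVneq (w i) 0; first by rewrite !mul0r.
  suff -> : binp (lam im) (lam i) = 0%N by rewrite mulr0 mul0r.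
  case: (boolP [forall j, lam im j <= lam i j]%N) => [/forallP hj|/forallPn[j]]; last first.
    by rewrite -ltnNge => hj; rewrite /binp (bigD1 j) //= bin_small.
  case/negP: iim; apply/eqP; apply: hi => // j; apply/eqP; rewrite eqn_leq hj andbT leqNgt.
  apply/negP => lt; have := hmax i wi; rewrite leqNgt => /negP[].
  rewrite (bigD1 j) //= [X in (_ < X)%N](bigD1 j) //= -addSn leq_add // leq_sum //.
rewrite addr0 /lprod big_nil mulr1 => e.
have {}e : (w im)%:~R * Pt (2 ^ 0 * Lam0).-1 (2 ^ 0 * kap im) (lam im) s0 = 0.
  by rewrite -[RHS]e /binp big1 ?mulr1 // => j _; rewrite binn.
have neqX (x : A5) n : x <> 0 -> x ^+ n <> 0.
  by move=> x0; elim: n => [|n IH]; [apply/eqP; exact: oner_neq0 | rewrite exprS => /a5_dom[]].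
case/a5_dom: e => [|/a5_dom[]].
- by rewrite qintE intz => -[] /eqP; rewrite (negbTE wim).
- by apply: neqX => u0; move: uub; rewrite u0 mul0r => /eqP; rewrite eq_sym oner_eq0.
apply/eqP; elim/big_rec: _ => [|j x _ hx]; first exact: oner_neq0.
apply/eqP => /a5_dom[/a5_dom[]|]; [apply: neqX; exact: xi_neq0 | apply: neqX | exact/eqP].
move=> /(congr1 a5conj); rewrite /xib /a5conj /= !oppr0 opprK => e.
by apply: (@xi_neq0 j); rewrite -[RHS]e; case: (xi j).
Qed.

Lemma level_false k : (forall m, (m < k)%N -> (dl m.+1 * (2 ^ #|J|).+1 <= M)%N /\
    (#|I| * W * 2 ^ (#|J| * (2 ^ m.+1 * Lam0).-1) *
     (su ^ (2 * (2 ^ m * H0)) * sg ^ (#|J| * (2 ^ m.+1 * Lam0).-1)) < p ^ dl m.+1)%N) ->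
  forall w lam, ~ level k w lam.
Proof.
elim: k => [|k IH] hk w lam; first exact: level0.
move=> hl; have [dM hC] := hk k (ltnSn k).
have [w' [lam' hl']] := levelS dM hC hl.
by apply: IH hl' => m mk; apply: hk; apply: leqW.
Qed.

End Levels.
End Step.

(** * The field with [p ^ 2] elements and its lift modulo [p ^ M] *)

Definition qfield (F : fieldType) (d : F) (dF : sq_indep d) : Type := qext d.

Section QField.
Variables (F : fieldType) (d : F) (dF : sq_indep d).
Local Notation K := (qfield dF).
HB.instance Definition _ := GRing.ComNzRing.on K.

Lemma field_dom : is_dom F.
Proof. by move=> a b /eqP; rewrite mulf_eq0 => /orP[] /eqP; [left | right]. Qed.

Definition qinv (x : K) : K := let n := qnorm (x : qext d) in (x.1 / n, - x.2 / n).

Fact qmulVf (x : K) : x != 0 -> qinv x * x = 1.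
Proof.
move=> x0; have n0 : qnorm (x : qext d) != 0.
  by apply: contraNneq x0 => /(qnorm_eq0 field_dom dF) ->.
rewrite /qinv; move: n0; rewrite /qnorm; case: x {x0} => a b /= n0.
by apply: injective_projections; rewrite /=; field.
Qed.

Fact qinv0 : qinv 0 = 0.
Proof. by rewrite /qinv /= oppr0 !mul0r. Qed.

HB.instance Definition _ := GRing.ComNzRing_isField.Build K qmulVf qinv0.
End QField.

Lemma prim_root_ex (F : fieldType) (rs : seq F) : uniq rs -> (0 < size rs)%N ->
  (forall x, x \in rs -> x ^+ size rs = 1) -> exists z : F, (size rs).-primitive_root z.
Proof.
move=> ur s0 h; have : all (size rs).-unity_root rs.
  by apply/allP => x /h; rewrite unity_rootE => ->.
by move=> ar; have /hasP[z _ hz] := has_prim_root s0 ar ur (leqnn _); exists z.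
Qed.

Section PrimeField.
Variables (p : nat) (p_pr : prime p) (p_gt2 : (2 < p)%N).

Lemma Fp_fermat (x : 'F_p) : x ^+ p = x.
Proof. by have := expf_card x; rewrite card_Fp. Qed.

Lemma Fp_prim : exists z : 'F_p, p.-1.-primitive_root z.
Proof.
have c : size (rem (0 : 'F_p) (enum 'F_p)) = p.-1.
  by rewrite size_rem ?mem_enum // -cardE card_Fp.
rewrite -c; apply: prim_root_ex; first by rewrite rem_uniq ?enum_uniq.
  by rewrite c -subn1 subn_gt0 prime_gt1.
move=> x; rewrite mem_rem_uniq ?enum_uniq // inE => /andP[x0 _].
rewrite c; apply: (mulfI x0); rewrite -exprS prednK ?prime_gt0 // Fp_fermat mulr1 //.
Qed.

Variables (z : 'F_p) (z_prim : p.-1.-primitive_root z).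

Let p1 : p.-1 = (2 * (p.-1)./2)%N.
Proof.
have : odd p by case: (even_prime p_pr) => // p2; move: p_gt2; rewrite p2.
by move=> op; rewrite -{1}(odd_double_half p) op mul2n /= -divn2; lia.
Qed.

Lemma prim_half : z ^+ (p.-1)./2 = -1.
Proof.
have : (z ^+ (p.-1)./2) ^+ 2 = 1 by rewrite -exprM mulnC -p1 prim_expr_order.
move/eqP; rewrite sqrf_eq1 => /orP[/eqP e|/eqP //].
have : (p.-1 %| (p.-1)./2)%N by rewrite (prim_order_dvd z_prim) e.
have h0 : (0 < (p.-1)./2)%N by move: p1 p_gt2; lia.
by move/(dvdn_leq h0); move: p1 h0; lia.
Qed.

Lemma prim_neq0 : z != 0.
Proof.
apply/eqP => z0; have := prim_expr_order z_prim; rewrite z0 expr0n.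
have -> : (p.-1 == 0)%N = false by move: p_gt2; lia.
by move/eqP; rewrite eq_sym oner_eq0.
Qed.

Lemma prim_nonsquare : sq_indep z.
Proof.
move=> a b e; apply/eqP; apply: contraT => b0.
have zE : z = (a / b) ^+ 2 by rewrite expr_div_n e mulfK // expf_neq0.
have ab0 : a / b != 0 by apply: contraTneq prim_neq0; rewrite zE => ->; rewrite expr0n.
have : z ^+ (p.-1)./2 = 1.
  rewrite zE -exprM -p1; apply: (mulfI ab0); rewrite -exprS prednK ?prime_gt0 // Fp_fermat mulr1 //.
rewrite prim_half => /eqP; rewrite eq_sym -addr_eq0 -(natrD _ 1 1) => /eqP h.
have := dvdn_pcharf (pchar_Fp p_pr) 2; rewrite h eqxx => /dvdn_leq; lia.
Qed.

Lemma Fp_square (y : 'F_p) : y != 0 -> exists w : 'F_p, y = w ^+ 2 \/ y = z * w ^+ 2.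
Proof.
move=> y0; have y1 : y ^+ p.-1 = 1.
  by apply: (mulfI y0); rewrite -exprS prednK ?prime_gt0 // Fp_fermat mulr1.
have [i ->] := prim_rootP z_prim y1.
exists (z ^+ (i./2)); rewrite -exprM -exprS muln2 -{1 3}(odd_double_half i).
by case: (odd i); [right | left].
Qed.

Local Notation K := (qfield prim_nonsquare).

Definition qbar (x : K) : K := (x.1, - x.2).

Lemma K_pchar : p \in [pchar K].
Proof.
rewrite inE p_pr /=; apply/eqP.
have natE n : (n%:R : K) = (n%:R, 0).
  by elim: n => // n IH; rewrite -!natr1 IH; congr pair; rewrite /= addr0.
by rewrite natE pchar_Fp_0.
Qed.

Lemma K_frob (x : K) : x ^+ p = qbar x.
Proof.
pose t : K := (0, 1).
have fE (a : 'F_p) n : (((a, 0) : K) ^+ n) = (a ^+ n, 0).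
  elim: n => [|n IH]; first by rewrite !expr0.
  by rewrite !exprS IH; apply: injective_projections; rewrite /= ?(mulr0, mul0r, addr0, add0r, mulr1, mul1r, mulrN1).
have xE : x = ((x.1, 0) : K) + ((x.2, 0) : K) * t.
  by apply: injective_projections; rewrite /= ?(mulr0, mul0r, addr0, add0r, mulr1, mul1r, mulrN1).
have t2 : t ^+ 2 = ((z, 0) : K).
  by rewrite expr2; apply: injective_projections; rewrite /= ?(mulr0, mul0r, addr0, add0r, mulr1, mul1r, mulrN1).
have tp : t ^+ p = ((0, -1) : K).
  have -> : t ^+ p = t * t ^+ p.-1 by rewrite -exprS prednK ?prime_gt0.
  have -> : t ^+ p.-1 = (t ^+ 2) ^+ (p.-1)./2 by rewrite -exprM -p1.
  rewrite t2 fE prim_half.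
  by apply: injective_projections; rewrite /= ?(mulr0, mul0r, addr0, add0r, mulr1, mul1r, mulrN1).
rewrite {1}xE exprDn_pchar ?(pnatE _ p_pr) ?K_pchar // exprMn !fE !Fp_fermat tp.
by apply: injective_projections; rewrite /= ?(mulr0, mul0r, addr0, add0r, mulr1, mul1r, mulrN1).
Qed.

Lemma K_frob2 (x : K) : x ^+ (p ^ 2) = x.
Proof. by rewrite expnS expn1 exprM !K_frob /qbar /= opprK; case: x. Qed.

Lemma K_frobX (x : K) m : x ^+ ((p ^ 2) ^ m) = x.
Proof. by elim: m => [|m IH]; rewrite ?expn0 ?expr1 // expnS exprM K_frob2. Qed.

Lemma K_prim : exists y : K, (p ^ 2).-1.-primitive_root y.
Proof.
pose rs : seq K := rem (0 : 'F_p * 'F_p) (enum {: 'F_p * 'F_p}).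
have c : size rs = (p ^ 2).-1.
  by rewrite size_rem ?mem_enum // -cardE card_prod card_Fp // expnS expn1.
have p2 : (1 < p ^ 2)%N by rewrite -(expn0 p) ltn_exp2l ?prime_gt1.
rewrite -c; apply: prim_root_ex; first by rewrite rem_uniq ?enum_uniq.
  by rewrite c -subn1 subn_gt0.
move=> x; rewrite /rs mem_rem_uniq ?enum_uniq // inE => /andP[x0 _].
rewrite c; apply: (@mulfI _ (x : K)) => //.
by rewrite -exprS prednK ?(ltnW p2) // K_frob2 mulr1.
Qed.

End PrimeField.

(** The intermediate binomial coefficients are divisible by [p] and the last term by
    [p ^ ((i + 1) p)], so a [p]-th power improves a congruence by one power of [p]. *)
Lemma dv_frob (A : comNzRingType) p i (b s : A) : prime p ->
  dv p i.+2 ((b + p%:R ^+ i.+1 * s) ^+ p - b ^+ p).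
Proof.
case: p => [|[|p']] //; set p := p'.+2 => p_pr; rewrite exprDn.
rewrite big_ord_recl /= expr0 mulr1 subn0 bin0 mulr1n addrC addKr.
rewrite big_ord_recr /=; apply: dvD.
  apply: dv_sum => j _; rewrite /bump /= add1n.
  have /dvdnP[k ->] : (p %| 'C(p, j.+1))%N by apply: prime_dvd_bin => //=; rewrite ltnS ltn_ord.
  rewrite exprMn -[(p%:R ^+ i.+1) ^+ _]exprM.
  exists (b ^+ (p - j.+1) * (p%:R ^+ (i.+1 * j) * s ^+ j.+1) * k%:R).
  rewrite (mulnS i.+1 j) exprD (exprS _ i.+1) -[in LHS]mulr_natr natrM; ring.
rewrite /bump /= add1n subnn expr0 mul1r binn mulr1n exprMn -exprM.
apply: dvMr; exists (p%:R ^+ (i.+1 * p - i.+2)); rewrite -exprD subnKC //.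
by rewrite /p; nia.
Qed.

Section LocalRing.
Variables (p M : nat) (p_pr : prime p) (p_gt5 : (5 < p)%N) (M_gt1 : (1 < M)%N).
Variables (z : 'F_p) (z_prim : p.-1.-primitive_root z).
Let p_gt2 : (2 < p)%N. Proof. by apply: leq_trans p_gt5. Qed.
Local Notation P := (p ^ M)%N.
Let P_gt1 : (1 < P)%N.
Proof. by rewrite -(expn0 p) ltn_exp2l ?prime_gt1 // ltnW. Qed.
Local Notation Z := 'Z_(p ^ M).
Local Notation B := (qext ((nat_of_ord z)%:R : Z)).
Local Notation K := (qfield (prim_nonsquare p_pr p_gt2 z_prim)).

Definition zred (a : Z) : 'F_p := (nat_of_ord a)%:R.

Lemma zred_modP n : ((n %% P)%N)%:R = n%:R :> 'F_p.
Proof.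
rewrite {2}(divn_eq n P) natrD natrM natrX pchar_Fp_0 // expr0n.
by rewrite (gtn_eqF (ltnW M_gt1)) mulr0 add0r.
Qed.

Lemma zred_nat n : zred n%:R = n%:R.
Proof. by rewrite /zred val_Zp_nat // zred_modP. Qed.

Lemma Z_natE (a : Z) : a = (nat_of_ord a)%:R. Proof. by rewrite natr_Zp. Qed.

Lemma zredD a b : zred (a + b) = zred a + zred b.
Proof. by rewrite (Z_natE a) (Z_natE b) -natrD !zred_nat natrD. Qed.

Lemma zredM a b : zred (a * b) = zred a * zred b.
Proof. by rewrite (Z_natE a) (Z_natE b) -natrM !zred_nat natrM. Qed.

Lemma zred_ker a : zred a = 0 -> exists b, a = p%:R * b.
Proof.
move/eqP; rewrite -(dvdn_pcharf (pchar_Fp p_pr)) => /dvdnP[k e].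
by exists k%:R; rewrite (Z_natE a) e natrM mulrC.
Qed.

Lemma zred_unit a : zred a != 0 -> exists b, a * b = 1.
Proof.
rewrite -(dvdn_pcharf (pchar_Fp p_pr)) => h; exists a^-1; apply: mulrV.
by rewrite (Z_natE a) unitZpE // coprime_sym coprimeXr // coprime_sym prime_coprime.
Qed.

Definition red (x : B) : K := (zred x.1, zred x.2).

Lemma redD x y : red (x + y) = red x + red y.
Proof. by apply: injective_projections; rewrite /= zredD. Qed.

Lemma redM x y : red (x * y) = red x * red y.
Proof.
apply: injective_projections; rewrite /= ?zredD !zredM //; congr (_ + _ * _).
by rewrite zred_nat natr_Zp.
Qed.

Lemma B_natE n : (n%:R : B) = (n%:R, 0).
Proof. by elim: n => // n IH; rewrite -!natr1 IH; congr pair; rewrite /= addr0. Qed.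

Lemma K_natE n : (n%:R : K) = (n%:R, 0).
Proof. by elim: n => // n IH; rewrite -!natr1 IH; congr pair; rewrite /= addr0. Qed.

Lemma red_nat n : red n%:R = n%:R.
Proof. by rewrite B_natE K_natE /red /= zred_nat (zred_nat 0). Qed.

Lemma redN x : red (- x) = - red x.
Proof. by apply/eqP; rewrite -addr_eq0 -redD addNr (red_nat 0). Qed.

Lemma red_int (n : int) : red n%:~R = n%:~R.
Proof. by case: n => n; rewrite ?NegzE ?mulrNz ?redN -pmulrn red_nat. Qed.

Lemma redX x n : red (x ^+ n) = red x ^+ n.
Proof. by elim: n => [|n IH]; rewrite ?expr0 ?(red_nat 1) // !exprS redM IH. Qed.

Lemma red_prod (J : finType) (F : J -> B) : red (\prod_j F j) = \prod_j red (F j).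
Proof. by elim/big_rec2: _ => [|j x y _ <-]; rewrite ?(red_nat 1) // redM. Qed.

Lemma red_ker x : red x = 0 -> exists y, x = p%:R * y.
Proof.
case: x => a b [/zred_ker[a' ->] /zred_ker[b' ->]]; exists (a', b').
by rewrite B_natE; apply: injective_projections; rewrite /= ?mul0r ?mulr0 addr0.
Qed.

Lemma red_eq x y : red x = red y -> exists t, x = y + p%:R * t.
Proof.
move=> e; have /red_ker[t ht] : red (x - y) = 0 by rewrite redD redN e subrr.
by exists t; rewrite -ht addrC subrK.
Qed.

Lemma B_pM : p%:R ^+ M = 0 :> B.
Proof. by rewrite -natrX B_natE pchar_Zp. Qed.

Lemma red_unit x : red x != 0 -> exists y, x * y = 1.
Proof.
move=> h; have n0 : zred (qnorm x) != 0.
  apply: contraNneq h => n0; apply/eqP.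
  apply: (@qnorm_eq0 _ _ (@field_dom _) (prim_nonsquare p_pr p_gt2 z_prim)).
  apply: etrans n0; rewrite /qnorm /= -!mulNr zredD !expr2 !zredM; congr (_ + _ * _).
  apply/eqP; rewrite eq_sym -addr_eq0 -{2}(natr_Zp z) -(zred_nat z) -zredD addNr.
  by rewrite (zred_nat 0).
have [b hb] := zred_unit n0; exists ((x.1 * b, - x.2 * b) : B); exact: qnorm_inv.
Qed.

Lemma B_inv k : (0 < k < p)%N -> exists y : B, k%:R * y = 1.
Proof.
move=> /andP[k0 kp]; apply: red_unit; rewrite red_nat K_natE; apply/eqP => -[] /eqP.
by rewrite -(dvdn_pcharf (pchar_Fp p_pr)) gtnNdvd.
Qed.

Lemma B_dvd G (n : int) : (G <= M)%N -> dv p G (n%:~R : B) -> (p ^ G %| absz n)%N.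
Proof.
move=> GM; wlog: n / exists m : nat, n = m.
  move=> h; case: n => n h1; first by apply: h => //; exists n.
  rewrite NegzE abszN; apply: h; first by exists n.+1.
  by rewrite -[_%:~R]opprK -mulrNz -NegzE; apply: dvN.
move=> [m ->] [y /(congr1 fst)] /=; rewrite -pmulrn -natrX !B_natE /= mul0r mulr0 addr0.
rewrite [y.1]Z_natE -natrM => /(congr1 (@nat_of_ord _)); rewrite /= !val_Zp_nat // => e.
have d : (p ^ G %| P)%N by rewrite dvdn_exp2l.
by rewrite /dvdn -(modn_dvdm _ d) e (modn_dvdm _ d) modnMr.
Qed.

(** A [P]-th power depends only on the residue, which makes Teichmüller representatives available as
    plain powers. *)
Lemma pow_congr (x t : B) : (x + p%:R * t) ^+ P = x ^+ P.
Proof.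
suff h i (y : B) : dv p i.+1 ((x + p%:R * t) ^+ (p ^ i) - x ^+ (p ^ i)).
  apply/eqP; rewrite -subr_eq0; apply/eqP; apply: (dvM0 B_pM).
  by apply: dvW (h M 0).
elim: i {y} => [|i [s hs]]; first by exists t; rewrite expn0 !expr1 addrC addKr.
rewrite expnSr !exprM; move: hs; set a := _ ^+ _; set b := x ^+ _ => hs.
have -> : a = b + p%:R ^+ i.+1 * s by rewrite -hs addrC subrK.
exact: dv_frob.
Qed.

Lemma pow1 (x : B) : red x = 1 -> x ^+ P = 1.
Proof.
move=> h; have /red_eq[t ->] : red x = red 1 by rewrite h (red_nat 1).
by rewrite pow_congr expr1n.
Qed.

(** The residue field with [p ^ 2] elements contains a square root [s0] of every element of the
    prime field. It lifts by an explicit power: [n / s0 ^ 2] is 1 modulo [p], so its [P]-th power is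
    1, and as [P] is odd its power [(P + 1) / 2] is a square root of it. *)
Lemma sqrt_ex (n : int) : red n%:~R != 0 -> exists2 s : B, s ^+ 2 = n%:~R & exists y, s * y = 1.
Proof.
move=> n0; have op : odd p by case: (even_prime p_pr) => // p2; move: p_gt5; rewrite p2.
have oP : odd P by rewrite oddX op orbT.
have [s0 hs0] : exists s0 : B, red (s0 ^+ 2) = red n%:~R.
  move: n0; rewrite red_int -(red_int n).
  have -> : (n%:~R : B) = (n%:~R, 0) by rewrite qintE.
  rewrite /red /= (zred_nat 0) => n0.
  have y0 : zred n%:~R != 0 by apply: contraNneq n0 => ->.
  have [w [->|->]] := Fp_square p_pr z_prim y0.
    exists ((nat_of_ord w)%:R, 0); rewrite /= !mulr0 mul0r !addr0 -natrM zred_nat.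
    by rewrite natrM natr_Zp expr2 (zred_nat 0).
  exists (0, (nat_of_ord w)%:R); rewrite /= !mulr0 !mul0r !add0r -!natrM zred_nat.
  by rewrite !natrM !natr_Zp expr2 (zred_nat 0).
have s00 : red s0 != 0.
  by apply: contraNneq n0 => e; rewrite -hs0 redX e expr0n.
have [t0 ht0] := red_unit s00.
have /red_eq[x hx] : red (n%:~R * t0 ^+ 2) = red 1.
  by rewrite redM -hs0 -redM -exprMn ht0 expr1n.
have hP : (n%:~R * t0 ^+ 2) ^+ P = 1 by rewrite hx pow_congr expr1n.
pose s := s0 * (n%:~R * t0 ^+ 2) ^+ (P.+1)./2.
have s2 : s ^+ 2 = n%:~R.
  rewrite /s exprMn -exprM muln2.
  have -> : ((P.+1)./2.*2 = P.+1)%N by rewrite -[RHS]odd_double_half /= oP.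
  by rewrite [X in _ * X]exprSr hP mul1r mulrCA -exprMn ht0 expr1n mulr1.
exists s => //; apply: red_unit; apply: contraNneq n0 => e.
by rewrite -s2 redX e expr0n.
Qed.

End LocalRing.

(** * The p-adic argument *)

Section Core.
Variables (J : finType) (xi : J -> A5) (u : A5) (q : J -> nat).
Let N j : int := qnorm (xi j).
Hypotheses (q_pr : forall j, prime (q j)) (q5 : forall j, q j != 5%N)
  (qN : forall j, logn (q j) (absz (N j)) = 1%N)
  (qN' : forall j j', j != j' -> ~~ (q j %| absz (N j'))%N).
Hypothesis (uub : u * a5conj u = 1).
Variables (p M n : nat).
Hypotheses (p_pr : prime p) (p_gt5 : (5 < p)%N) (M_gt1 : (1 < M)%N) (Mp : (M <= p)%N)
  (pN : forall j, ~~ (p %| absz (N j))%N) (pn : ~~ (p %| n)%N)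
  (un : (p ^ M %| absz (u ^+ n).2)%N).

Let p_gt2 : (2 < p)%N. Proof. exact: leq_trans p_gt5. Qed.
Let p_gt1 : (1 < p)%N. Proof. exact: leq_trans p_gt5. Qed.
Let M_gt0 : (0 < M)%N. Proof. exact: ltnW. Qed.

Section WithRoot.
Variables (z : 'F_p) (z_prim : p.-1.-primitive_root z).
Local Notation P := (p ^ M)%N.
Local Notation B := (qext ((nat_of_ord z)%:R : 'Z_(p ^ M))).
Local Notation K := (qfield (prim_nonsquare p_pr p_gt2 z_prim)).
Let red (x : B) : K := red p_pr p_gt5 z_prim x.

Let redM' x y : red (x * y) = red x * red y. Proof. exact: redM. Qed.
Let redD' x y : red (x + y) = red x + red y. Proof. exact: redD. Qed.
Let redX' x k : red (x ^+ k) = red x ^+ k. Proof. exact: redX. Qed.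
Let red1 : red 1 = 1. Proof. exact: (red_nat _ _ _ _ 1). Qed.
Let red_int' (k : int) : red k%:~R = k%:~R. Proof. exact: red_int. Qed.

Lemma K_int0 (k : int) : ((k%:~R : K) == 0) = (p %| absz k)%N.
Proof.
rewrite (dvdn_pcharf (K_pchar p_pr p_gt2 z_prim)); case: k => k //.
by rewrite NegzE mulrNz oppr_eq0.
Qed.

Lemma K_int_frob (k : int) : (k%:~R : K) ^+ p = k%:~R.
Proof. by rewrite K_frob /qbar qintE /= oppr0. Qed.

Variables (c : B) (rho rinv : J -> B).
Hypotheses (c2 : c ^+ 2 = 5) (rho2 : forall j, rho j ^+ 2 = (N j)%:~R)
  (rhoK : forall j, rho j * rinv j = 1).
Local Notation phi := (@tev J N B c rho [::]).
Let eta j := phi (xi j) * rinv j.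
Let eta' j := phi (a5conj (xi j)) * rinv j.
Let ups := phi u.
Let ups' := phi (a5conj u).

Let phiM x y : phi (x * y) = phi x * phi y. Proof. exact: (@tevM _ N _ c rho c2 rho2 [::]). Qed.
Let phiZ k : phi k%:~R = k%:~R. Proof. exact: (@tev_int _ N _ c rho [::]). Qed.
Let phiE x : phi x = x.1%:~R + c * x.2%:~R. Proof. by []. Qed.
Let phi1 : phi 1 = 1. Proof. exact: (phiZ 1). Qed.
Let phiX x k : phi (x ^+ k) = phi x ^+ k.
Proof. by elim: k => [|k IH]; rewrite ?expr0 ?phi1 // exprS phiM IH exprS. Qed.

Lemma etaK j : eta j * eta' j = 1.
Proof.
rewrite /eta /eta' mulrACA -phiM xiN phiZ -rho2 -expr2 -exprMn rhoK expr1n //.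
Qed.

Lemma upsK8 : ups * ups' = 1. Proof. by rewrite /ups /ups' -phiM uub phi1. Qed.

Let s := red c.
Lemma s2 : s ^+ 2 = 5. Proof. by rewrite /s -redX' c2 (red_int' 5). Qed.

Lemma s_frob : {b : bool | s ^+ p = if b then s else - s}.
Proof.
have /eqP : (s ^+ p) ^+ 2 = s ^+ 2 by rewrite -exprM mulnC exprM s2 (K_int_frob 5).
by rewrite eqf_sqr; case: eqP => [e _|_ /= /eqP e]; [exists true | exists false].
Qed.

Lemma red_phi x : red (phi x) = x.1%:~R + s * x.2%:~R.
Proof. by rewrite phiE redD' redM' !red_int'. Qed.

Lemma red_phi_frob x (b : bool) : s ^+ p = (if b then s else - s) ->
  red (phi x) ^+ p = red (phi (if b then x else a5conj x)).
Proof.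
move=> sp; rewrite red_phi exprDn_pchar ?(pnatE _ p_pr) ?K_pchar // exprMn !K_int_frob sp.
by case: b {sp}; rewrite red_phi //= mulrNz mulrN mulNr.
Qed.

(** [b] tells whether Frobenius fixes the root of 5, that is, whether [p] splits; residues of
    norm-one elements have order dividing [g b]. *)
Let g (b : bool) : nat := if b then p.-1 else p.+1.

Lemma unit_pow (x : A5) b : s ^+ p = (if b then s else - s) -> x * a5conj x = 1 ->
  red (phi x) ^+ (2 * g b) = 1.
Proof.
move=> sp xx.
have X1 : red (phi x) * red (phi (a5conj x)) = 1 by rewrite -redM' -phiM xx phi1 red1.
have X0 : red (phi x) != 0 by apply: contra_eq_neq X1 => ->; rewrite mul0r eq_sym oner_neq0.
rewrite mulnC exprM (_ : _ ^+ g b = 1) ?expr1n //; rewrite /g.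
have := red_phi_frob x sp; case: b sp => _ e.
  by apply: (mulfI X0); rewrite -exprS prednK ?prime_gt0 // e mulr1.
by rewrite exprS e.
Qed.

(** The square of [eta j] is the quotient of [xi j] by its conjugate, an element of norm 1 killed by
    the exponent [g b]; the extra 2 is due to the square root of the norm. *)
Lemma eta_pow j b : s ^+ p = (if b then s else - s) -> red (eta j) ^+ (2 * g b) = 1.
Proof.
move=> sp; rewrite /eta redM' exprMn.
have N0 : ((N j)%:~R : K) != 0 by rewrite K_int0.
have rN : red (rinv j) ^+ 2 * (N j)%:~R = 1.
  by rewrite -redX' -red_int' -rho2 -redM' -exprMn mulrC rhoK expr1n red1.
have YY : red (phi (xi j)) * red (phi (a5conj (xi j))) = (N j)%:~R.
  by rewrite -redM' -phiM xiN phiZ red_int'.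
have Y0 : red (phi (xi j)) != 0 by apply: contraNneq N0 => e; rewrite -YY e mul0r.
have := red_phi_frob (xi j) sp; move: YY Y0; set Y := red (phi (xi j)).
set Y' := red (phi (a5conj _)) => YY Y0.
rewrite [X in _ * X]exprM; have -> : red (rinv j) ^+ 2 = ((N j)%:~R : K)^-1.
  by apply: (mulIf N0); rewrite rN mulVf.
rewrite exprM -exprMn /g; case: b sp => _ e.
  have Yp : Y ^+ p.-1 = 1 by apply: (mulfI Y0); rewrite -exprS prednK ?prime_gt0 // e mulr1.
  have Np : ((N j)%:~R : K) ^+ p.-1 = 1.
    by apply: (mulfI N0); rewrite -exprS prednK ?prime_gt0 // K_int_frob mulr1.
  by rewrite exprMn -exprM mulnC exprM Yp expr1n mul1r exprVn Np invr1.
have e1 : Y' = Y ^+ p by rewrite e.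
rewrite -YY e1 -exprS.
have Yp2 : Y ^+ (p * p) = Y by rewrite -[RHS](K_frob2 Y) expnS expn1.
have e2 : (Y ^+ p.+1) ^+ p.+1 = (Y ^+ 2) ^+ p.+1.
  rewrite -!exprM (_ : p.+1 * p.+1 = p * p + (2 * p).+1)%N; last by lia.
  by rewrite exprD Yp2 -exprS; congr (_ ^+ _); lia.
by rewrite exprMn exprVn e2 mulfV // !expf_neq0.
Qed.

(** [x ^ Q] is the Teichmüller representative of the residue of [x]: on the residue field this power
    is the identity, and it depends only on the residue because [P] divides [Q]. *)
Let Q := ((p ^ 2) ^ M)%N.
Let QE : Q = (P * P)%N. Proof. by rewrite /Q -expnM -expnD mul2n addnn. Qed.

Lemma red_powQ (x y : B) : red x = red y -> x ^+ Q = y ^+ Q.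
Proof.
move=> h; have [t ->] := @red_eq p M p_pr p_gt5 M_gt1 z z_prim x y h; by rewrite QE !exprM pow_congr.
Qed.

(** Discrete logarithms to a base of order [2 g] in the residue field. The last clause turns a
    coincidence among powers of [u] into divisibility of a second coordinate by [p], the form in
    which primitivity forbids it. *)
Lemma logs : exists (g : nat) (E : J -> nat) (E0 : nat), [/\ g = p.-1 \/ g = p.+1,
  forall (a a' : J -> nat) b b',
    (\sum_j E j * a j + E0 * b = \sum_j E j * a' j + E0 * b' %[mod 2 * g])%N ->
    (\prod_j eta j ^+ a j * ups ^+ b) ^+ Q = (\prod_j eta j ^+ a' j * ups ^+ b') ^+ Q &
  forall b b', (b < b')%N -> (E0 * b = E0 * b' %[mod 2 * g])%N ->
    (p %| absz (u ^+ (b' - b)).2)%N].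
Proof.
have [b sp] := s_frob.
have [y yp] := K_prim p_pr p_gt2 z_prim.
have d2 : (2 * g b %| (p ^ 2).-1)%N.
  have op : odd p by case: (even_prime p_pr) => // p2; move: p_gt5; rewrite p2.
  have e : ((p ^ 2).-1 = p.-1 * p.+1)%N.
    by case: (p) p_gt1 => // k _; rewrite expnS expn1 /=; lia.
  have e1 : (2 %| p.-1)%N by rewrite dvdn2; case: (p) op p_gt1 => //= k.
  have e2 : (2 %| p.+1)%N by rewrite dvdn2 /= op.
  by rewrite e /g; case: b {sp}; [rewrite mulnC | idtac]; apply: dvdn_mul.
have zp := dvdn_prim_root yp d2; set zt := y ^+ _ in zp.
have [E hE] : exists E : J -> nat, forall j, red (eta j) = zt ^+ E j.
  apply: (@fin_all_exists J (fun=> nat) (fun j e => red (eta j) = zt ^+ e)) => j; have [i e] := prim_rootP zp (eta_pow j sp).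
  by exists i.
have [E0 hE0] : exists E0 : nat, red ups = zt ^+ E0.
  by have [i e] := prim_rootP zp (unit_pow sp uub); exists i.
exists (g b), E, E0; split.
- by rewrite /g; case: (b); [left | right].
- move=> a a' k k' h; apply: red_powQ.
  have rX (e : J -> nat) m : red (\prod_j eta j ^+ e j * ups ^+ m) =
      zt ^+ (\sum_j E j * e j + E0 * m)%N.
    rewrite redM' redX' hE0 -exprM exprD; congr (_ * _).
    rewrite (big_morph (fun k => zt ^+ k) (exprD zt) (expr0 zt)).
    by rewrite /red (red_prod p_pr p_gt5 M_gt1 z_prim); apply: eq_bigr => j _; rewrite -/(red _) redX' hE exprM.
  by rewrite !rX -(prim_expr_mod zp) h (prim_expr_mod zp).
move=> k k' kk h.
have e : red ups ^+ k = red ups ^+ k'.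
  by rewrite hE0 -exprM -[RHS]exprM -(prim_expr_mod zp) h (prim_expr_mod zp).
have u0 : red ups * red ups' = 1 by rewrite -redM' upsK8 red1.
have un0 : red ups != 0 by apply: contra_eq_neq u0 => ->; rewrite mul0r eq_sym oner_neq0.
have {}e : red ups ^+ (k' - k) = 1.
  by apply: (mulIf (expf_neq0 k un0)); rewrite mul1r -exprD subnK // ltnW.
have e' : red ups' ^+ (k' - k) = 1 by rewrite -[LHS]mul1r -e -exprMn u0 expr1n.
have cX (x : A5) m : a5conj (x ^+ m) = a5conj x ^+ m.
  by elim: m => [|m IH]; rewrite ?expr0 // !exprS a5conjM IH.
move: e e'; rewrite -!redX' -!phiX -cX !red_phi /=; set X := u ^+ _ => e e'.
have s0 : s != 0.
  apply: contra_eq_neq s2 => ->; rewrite expr0n eq_sym -[5]/((5%:Z)%:~R) K_int0 /=.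
  by rewrite gtnNdvd.
rewrite -K_int0; have : 2 * s * X.2%:~R = 0 :> K.
  have -> : 2 * s * X.2%:~R = (X.1%:~R + s * X.2%:~R) - (X.1%:~R + s * (- X.2)%:~R) :> K.
    by rewrite mulrNz; ring.
  by rewrite e e' subrr.
move/eqP; rewrite !mulf_eq0 (negbTE s0) orbF => /orP[|//].
have : ((2%:Z)%:~R : K) != 0 by rewrite K_int0 gtnNdvd.
by move/negbTE => ->.
Qed.

Lemma log_eta (f : nat -> B) : (forall k, (k < M)%N -> (k`!)%:R * f k = 1) ->
  exists l : J -> B, forall j, eta j * eta' j ^+ Q = expp p M f (l j).
Proof.
move=> fK; apply: (@fin_all_exists J (fun=> B) (fun j l => eta j * eta' j ^+ Q = expp p M f l)) => j.
have : red (eta j * eta' j ^+ Q) = red 1.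
  by rewrite redM' redX' /Q K_frobX // -redM' etaK.
move=> h; have [t ->] := @red_eq p M p_pr p_gt5 M_gt1 z z_prim _ _ h.
by have [l hl] := expp_log (B_pM p_pr M_gt1 z) fK t M_gt1; exists l.
Qed.

(** The divisibility by [p ^ M] enters here: it makes [u ^ n] equal to its conjugate, so
    [u ^ (2 n) = 1]. The order of [x = u ^ (p ^ 2 - 1)] then divides both [2 n] and [p ^ M], which
    are coprime; so [x = 1] and [u] is its own Teichmüller representative. *)
Lemma upsQ : ups * ups' ^+ Q = 1.
Proof.
have u0 : red ups * red ups' = 1 by rewrite -redM' upsK8 red1.
have un0 : red ups != 0 by apply: contra_eq_neq u0 => ->; rewrite mul0r eq_sym oner_neq0.
pose x := ups ^+ (p ^ 2).-1.
have p2 : (0 < p ^ 2)%N by rewrite expn_gt0 prime_gt0.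
have xP : x ^+ P = 1.
  apply: (@pow1 p M p_pr p_gt5 M_gt1 z z_prim).
  rewrite -/(red _) redX'; apply: (mulfI un0).
  by rewrite -exprS prednK // K_frob2 // mulr1.
have xn : x ^+ (2 * n) = 1.
  rewrite /x -exprM mulnC exprM [X in X ^+ _](_ : _ = 1) ?expr1n //.
  have bz : (((u ^+ n).2)%:~R : B) = 0.
    have /dvdnP[k hk] := un.
    have e : ((absz (u ^+ n).2)%:R : B) = 0.
      by rewrite hk natrM natrX (B_pM p_pr M_gt1) mulr0.
    case: ((u ^+ n).2) e => m //= e.
    by rewrite NegzE mulrNz -pmulrn e oppr0.
  have cX (v : A5) m : a5conj (v ^+ m) = a5conj v ^+ m.
    by elim: m => [|m IH]; rewrite ?expr0 // !exprS a5conjM IH.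
  have h1 : phi (u ^+ n) = ups ^+ n by rewrite phiX.
  have h2 : phi (a5conj (u ^+ n)) = ups' ^+ n by rewrite cX phiX.
  have h3 : ups ^+ n = ups' ^+ n by rewrite -h1 -h2 !phiE /= mulrNz bz oppr0.
  by rewrite mul2n -addnn exprD {2}h3 -exprMn upsK8 expr1n.
have co : coprime P (2 * n).
  rewrite coprimeXl // coprimeMr !prime_coprime // pn andbT gtnNdvd //.
have x1 : x = 1.
  have P0 : (0 < P)%N by rewrite expn_gt0 prime_gt0.
  have [a b' e _] := egcdnP (2 * n) P0; rewrite (eqP co) in e.
  have : x ^+ (a * P) = 1 by rewrite mulnC exprM xP expr1n.
  by rewrite e exprD expr1 mulnC exprM xn expr1n mul1r.
have uQ m : ups ^+ ((p ^ 2) ^ m) = ups.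
  elim: m => [|m IH]; first by rewrite expn0.
  by rewrite expnS exprM -{1}(prednK p2) exprS -/x x1 mulr1.
by rewrite -{1}(uQ M) -exprMn upsK8 expr1n.
Qed.

Lemma inv_fact : exists f : nat -> B, forall k, (k < M)%N -> (k`!)%:R * f k = 1.
Proof.
suff : forall m, (m <= p)%N -> exists f : nat -> B, forall k, (k < m)%N -> (k`!)%:R * f k = 1.
  by move=> /(_ M Mp).
elim=> [_|m IH mp]; first by exists (fun=> 0).
have [f hf] := IH (ltnW mp).
have [y hy] : exists y : B, (m`!)%:R * y = 1.
  case: m mp {IH} hf => [|m] mp hf; first by exists 1; rewrite mulr1.
  have [y hy] := @B_inv p M p_pr p_gt5 M_gt1 z z_prim m.+1 mp.
  exists (f m * y); rewrite factS natrM.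
  transitivity ((m.+1%:R * y) * ((m`!)%:R * f m)); last by rewrite hy hf ?mul1r.
  by rewrite (mulrC (f m)) mulrACA.
exists (fun k => if k == m then y else f k) => k; rewrite ltnS leq_eqVlt.
by case: eqP => [->|_ /=]; [rewrite hy | exact: hf].
Qed.

End WithRoot.
Lemma padic_core : exists (g : nat) (E : J -> nat) (E0 : nat), [/\ g = p.-1 \/ g = p.+1,
  forall b b', (b < b')%N -> (E0 * b = E0 * b' %[mod 2 * g])%N ->
    (p %| absz (u ^+ (b' - b)).2)%N &
  forall (I : finType) (W sg su Lam0 H0 : nat) (dl Tm : nat -> nat) (kap : I -> nat),
  (0 < Lam0)%N -> (forall i, kap i <= H0)%N -> (0 < W)%N ->
  (forall j, a5size (xi j) <= sg)%N -> (a5size u <= su)%N -> (0 < sg)%N -> (0 < su)%N ->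
  (0 < #|J|)%N -> (4 * 2 ^ #|J| < p)%N ->
  (forall m, Tm m.+1 = Tm m + #|J|.+1 * dl m.+1)%N -> (#|J| * Lam0.-1 < Tm 0)%N ->
  forall k, (forall m, (m < k)%N -> (dl m.+1 * (2 ^ #|J|).+1 <= M)%N /\
    (#|I| * W * 2 ^ (#|J| * (2 ^ m.+1 * Lam0).-1) *
     (su ^ (2 * (2 ^ m * H0)) * sg ^ (#|J| * (2 ^ m.+1 * Lam0).-1)) < p ^ dl m.+1)%N) ->
  forall w lam, ~ level xi u g E E0 W Lam0 Tm kap k w lam].
Proof.
have [z z_prim] := Fp_prim p_pr.
pose B : comNzRingType := qext ((nat_of_ord z)%:R : 'Z_(p ^ M)).
have red_n0 (k : int) : ~~ (p %| absz k)%N -> red p_pr p_gt5 z_prim (k%:~R : B) != 0.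
  move=> h; rewrite red_int //; have := K_int0 z_prim k; rewrite (negbTE h) => /negbT; exact.
have [c c2 _] : exists2 s : B, s ^+ 2 = (5%:Z)%:~R & exists y, s * y = 1.
  by apply: (@sqrt_ex p M p_pr p_gt5 M_gt1 z z_prim); apply: red_n0; rewrite gtnNdvd.
have [rho hrho] : exists rho : J -> B, forall j, rho j ^+ 2 = (N j)%:~R /\ exists y, rho j * y = 1.
  apply: (@fin_all_exists J (fun=> B) (fun j r => r ^+ 2 = (N j)%:~R /\ exists y, r * y = 1)) => j.
  have [s h1 h2] := @sqrt_ex p M p_pr p_gt5 M_gt1 z z_prim (N j) (red_n0 _ (pN j)).
  by exists s.
have rho2 j : rho j ^+ 2 = (N j)%:~R by case: (hrho j).
have [rinv rhoK] : exists rinv : J -> B, forall j, rho j * rinv j = 1.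
  apply: (@fin_all_exists J (fun=> B) (fun j y => rho j * y = 1)) => j.
  by case: (hrho j).
have [g [E [E0 [hg hcls hinj]]]] := logs z_prim c2 rho2 rhoK.
exists g, E, E0; split=> //.
have [f fK] := inv_fact z_prim.
have [l lE] := log_eta z_prim c2 rho2 rhoK fK.
move=> I W sg su Lam0 H0 dl Tm kap *.
apply: (@level_false I J xi u q q_pr q5 qN qN' uub p M B f c rho
  (fun j => @tev J N B c rho [::] (xi j) * rinv j)
  (fun j => @tev J N B c rho [::] (a5conj (xi j)) * rinv j) _ _ _ _ _ _ _ _ _ _ _ _ _
  ((p ^ 2) ^ M) g E E0 l _ _ _ W sg su Lam0 H0 dl Tm kap) => //.
- exact: B_pM.
- by move=> k hk; apply: (@B_inv p M p_pr p_gt5 M_gt1 z z_prim).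
- by move=> G k GM h; apply: (@B_dvd p M p_pr M_gt1 z) h.
- by move=> j; exists (rinv j).
- by move=> j; rewrite mulrCA rhoK mulr1.
- by move=> j; rewrite mulrCA rhoK mulr1.
- by move=> j; apply: (etaK (c := c)).
- exact: (upsQ z_prim c2 rho2).
Qed.

End Core.

(** * Siegel's lemma and the valuation bound *)

(** Pigeonhole on vectors with entries in [[0, W]] supported on [R]; two with equal images differ by
    a solution. The images are bounded through all of [I], so the bound is independent of [R]. *)
Lemma siegel (I TT : finType) (R : {set I}) (c : TT -> I -> nat) (W C : nat) :
  (forall t i, (c t i <= C)%N) ->
  ((#|I| * W * C).+1 ^ #|TT| < W.+1 ^ #|R|)%N ->
  exists w : I -> int, [/\ forall i, i \notin R -> w i = 0, forall i, (absz (w i) <= W)%N,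
    exists i, w i != 0 & forall t, \sum_i w i * (c t i)%:Z = 0].
Proof.
move=> cC h; pose S := {i : I | i \in R}; pose X := {ffun S -> 'I_W.+1}.
pose V := {ffun TT -> 'I_(#|I| * W * C).+1}.
have bnd (x : X) t : (\sum_(s : S) x s * c t (val s) < (#|I| * W * C).+1)%N.
  rewrite ltnS; apply: (@leq_trans (\sum_(s : S) W * C)%N).
    by apply: leq_sum => s _; apply: leq_mul => //; rewrite -ltnS.
  by rewrite sum_nat_const -mulnA leq_mul2r card_sig max_card orbT.
pose f (x : X) : V := [ffun t => Ordinal (bnd x t)].
have : ~~ injectiveb f.
  have e : #|{: S}| = #|R| by rewrite card_sig; apply: eq_card.
  apply/negP => /injectiveP /leq_card; rewrite !card_ffun !card_ord e => /(leq_trans h).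
  by rewrite ltnn.
move=> /injectivePn[x [y xy fxy]].
have [s0 hs0] : exists s, x s != y s.
  apply/existsP; apply: contraNT xy; rewrite negb_exists => /forallP hh.
  by apply/eqP/ffunP => s; apply/eqP; have := hh s; rewrite negbK.
pose w i : int := if insub i is Some s then (x s)%:Z - (y s)%:Z else 0.
exists w; split.
- by move=> i iR; rewrite /w insubN.
- move=> i; rewrite /w; case: insub => //= s.
  have := ltn_ord (x s); have := ltn_ord (y s).
  move: (nat_of_ord (x s)) (nat_of_ord (y s)) => a b; rewrite !ltnS => ha hb.
  by rewrite -[X in (X <= _)%N]/(absz (a%:Z - b%:Z)); lia.
- exists (val s0); rewrite /w valK subr_eq0; apply: contra hs0 => /eqP[e].
  exact/eqP/val_inj.
move=> t; have e1 : \sum_i w i * (c t i)%:Z = \sum_(i in R) w i * (c t i)%:Z.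
  by rewrite [RHS]big_mkcond; apply: eq_bigr => i _; case: ifP => // /negbT iR; rewrite /w insubN ?mul0r.
rewrite e1 (reindex_omap (val : S -> I) insub) /=; last by move=> i iR; rewrite insubT.
rewrite (eq_bigl xpredT) => [|s]; last by rewrite (valP s) valK eqxx.
rewrite (eq_bigr (fun s : S => (x s * c t (val s))%N%:Z - (y s * c t (val s))%N%:Z)) => [|s _]; last first.
  by rewrite /w valK mulrBl !PoszM.
rewrite sumrB -!(big_morph Posz PoszD (erefl _)); apply/eqP; rewrite subr_eq0; apply/eqP; congr Posz.
by have := congr1 (fun v : V => val (v t)) fxy; rewrite !ffunE.
Qed.

(** Rankin's trick: a coordinate of value [i] gets the weight [N ^ i * (N + 1) ^ (D - 1 - i)]. These
    weights telescope to a sum of at most [(N + 1) ^ D], and their product is bounded below on the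
    simplex. For [D = (r + 1) N] the count is about [e ^ (r + 1) * N ^ r]. *)
Lemma simplex_count (J : finType) (D N : nat) :
  (#|[set t : {ffun J -> 'I_D} | (\sum_j t j < D)%N]| * N ^ D <= N.+1 ^ (#|J| + D))%N.
Proof.
case: D => [|D]; first by rewrite (_ : [set _ | _] = set0) ?cards0 //; apply/setP => t; rewrite !inE ltn0.
pose F (i : 'I_D.+1) := (N ^ i * N.+1 ^ (D - i))%N.
have sF m : (\sum_(i < m) N ^ i * N.+1 ^ (m.-1 - i) + N ^ m = N.+1 ^ m)%N.
  elim: m => [|m IH]; first by rewrite big_ord0.
  rewrite big_ord_recr /= subnn muln1 (expnS N.+1) -IH.
  case: m IH => [|m] IH; first by rewrite !big_ord0 !expn0 expn1 muln1 add0n add1n.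
  rewrite (eq_bigr (fun i : 'I_m.+1 => N.+1 * (N ^ i * N.+1 ^ (m - i)))%N); last first.
    move=> i _.
    have im : (i <= m)%N by rewrite -ltnS.
    by rewrite /= subSn // expnS mulnCA.
  by rewrite -big_distrr /= mulnDr -addnA; congr (_ + _)%N.
have key : (\sum_(t : {ffun J -> 'I_D.+1}) \prod_j F (t j) <= N.+1 ^ (D.+1 * #|J|))%N.
  rewrite -(bigA_distr_bigA (fun (_ : J) i => F i)) prod_nat_const expnM; apply: leq_expl.
  by rewrite -(sF D.+1) leq_addr.
have X0 : (0 < N.+1 ^ (D * #|J|))%N by rewrite expn_gt0.
rewrite -(leq_pmul2r X0); apply: (@leq_trans (N.+1 ^ (D.+1 * #|J|) * N.+1 ^ D.+1)%N); last first.
  by rewrite -!expnD mulSn addnAC.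
apply: leq_trans (leq_mul key (leqnn _)).
rewrite -mulnA -sum_nat_const big_distrl /= [leqRHS](bigID (fun t : {ffun J -> 'I_D.+1} => \sum_j t j < D.+1)%N) /=.
apply: leq_trans (leq_addr _ _); rewrite (eq_bigl (fun t : {ffun J -> 'I_D.+1} => \sum_j t j < D.+1)%N).
  apply: leq_sum => t ht; rewrite /F big_split /= -!expn_sum.
  have e2 : (\sum_j (D - t j) + \sum_j t j = D * #|J|)%N.
    rewrite -big_split /= (eq_bigr (fun=> D)) ?sum_nat_const 1?mulnC // => j _.
    by rewrite subnK // -ltnS.
  rewrite -e2; set A := (\sum_j (D - _))%N; set s := (\sum_j _)%N in ht *.
  rewrite -{1}(subnK (ltnW ht)) !expnD -!mulnA mulnCA leq_mul2l; apply/orP; right.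
  rewrite mulnCA leq_mul2l; apply/orP; right.
  rewrite -{2}(subnK (ltnW ht)) expnD leq_mul2r; apply/orP; right; exact: leq_expl.
by move=> t; rewrite inE.
Qed.

Lemma pigeonhole (I : finType) (m : nat) (cl : I -> 'I_m) : (0 < m)%N ->
  exists c, (#|I| <= m * #|[set i | cl i == c]|)%N.
Proof.
move=> m0; apply/existsP; apply: contraT; rewrite negb_exists => /forallP h.
have e : (#|I| = \sum_(c < m) #|[set i | cl i == c]|)%N.
  rewrite -sum1_card (partition_big cl xpredT) //=; apply: eq_bigr => c _.
  by rewrite -sum1_card; apply: eq_bigl => i; rewrite inE.
have : (m * #|I| < m * #|I|)%N.
  rewrite {1}e big_distrr /=; apply: (@leq_trans (\sum_(c < m) #|I|)%N); last by rewrite sum_nat_const card_ord.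
  case: m m0 cl h {e} => // m _ cl h; rewrite !big_ord_recl /= -addSn.
  apply: leq_add; first by rewrite ltnNge.
  by apply: leq_sum => c _; apply: ltnW; rewrite ltnNge.
by rewrite ltnn.
Qed.

Section ValuationBound.
Variables (J : finType) (xi : J -> A5) (u : A5) (q : J -> nat).
Let N j : int := qnorm (xi j).
Hypotheses (q_pr : forall j, prime (q j)) (q5 : forall j, q j != 5%N)
  (qN : forall j, logn (q j) (absz (N j)) = 1%N)
  (qN' : forall j j', j != j' -> ~~ (q j %| absz (N j'))%N).
Hypothesis (uub : u * a5conj u = 1).
Variables (p M n : nat).
Hypotheses (p_pr : prime p) (p_gt5 : (5 < p)%N) (M_gt1 : (1 < M)%N) (Mp : (M <= p)%N)
  (pN : forall j, ~~ (p %| absz (N j))%N) (pn : ~~ (p %| n)%N).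
Variables (k N0 W sg su Lam0 H0 : nat) (dl Tm : nat -> nat).
Hypothesis uinj : forall D, (0 < D <= 2 ^ k * H0)%N -> ~~ (p %| absz (u ^+ D).2)%N.
Hypotheses (Lam0_gt0 : (0 < Lam0)%N) (H0_gt0 : (0 < H0)%N) (W0 : (0 < W)%N)
  (xisg : forall j, (a5size (xi j) <= sg)%N) (usu : (a5size u <= su)%N)
  (sg0 : (0 < sg)%N) (su0 : (0 < su)%N)
  (J0 : (0 < #|J|)%N) (rp : (4 * 2 ^ #|J| < p)%N)
  (TmS : forall m, (Tm m.+1 = Tm m + #|J|.+1 * dl m.+1)%N) (Tm0 : (#|J| * Lam0.-1 < Tm 0)%N).
Let cI := ((2 ^ k.+1 * Lam0) ^ #|J| * H0)%N.
Hypothesis (dlM : forall m, (m <= k)%N -> (dl m.+1 * (2 ^ #|J|).+1 <= M)%N).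
Hypothesis (dlC : forall m, (m <= k)%N ->
    (cI * W * 2 ^ (#|J| * (2 ^ m.+1 * Lam0).-1) *
     (su ^ (2 * (2 ^ m * H0)) * sg ^ (#|J| * (2 ^ m.+1 * Lam0).-1)) < p ^ dl m.+1)%N).
(** The condition of Siegel's lemma for [eq] equations in the [R] unknowns of one residue class;
    both numbers are known only through [simplex_count] and [pigeonhole]. *)
Hypothesis count : forall eq R, (eq * N0 ^ Tm k.+1 <= N0.+1 ^ (#|J| + Tm k.+1))%N ->
  (cI <= 2 ^ k.+1 * p.+1 * R)%N ->
  ((cI * W * 2 ^ (#|J| * (2 ^ k.+1 * Lam0))).+1 ^ eq < W.+1 ^ R)%N.

Lemma valuation_bound : ~~ (p ^ M %| absz (u ^+ n).2)%N.
Proof.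
apply/negP => un.
have [g [E [E0 [hg hinj hlev]]]] :=
  padic_core q_pr q5 qN qN' uub p_pr p_gt5 M_gt1 Mp pN pn un.
have g0 : (0 < g)%N by case: hg => ->; move: p_gt5; lia.
have gp : (g <= p.+1)%N by case: hg => ->; lia.
pose Lk := (2 ^ k.+1 * Lam0)%N.
pose I : finType := ({ffun J -> 'I_Lk} * 'I_H0)%type.
have cardI : #|I| = cI by rewrite card_prod card_ffun !card_ord.
pose lam (i : I) j : nat := i.1 j.
pose kap (i : I) : nat := i.2.
(* The modulus [2 ^ (k + 1) * g] is large enough to leave a congruence modulo [2 g] at the last
   halving. *)
pose C i := (\sum_j E j * lam i j + E0 * (2 ^ k * kap i))%N.
have m0 : (0 < 2 ^ k.+1 * g)%N by rewrite muln_gt0 expn_gt0.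
pose cl (i : I) := Ordinal (ltn_pmod (C i) m0).
have [c hc] := pigeonhole cl m0.
set R := [set i | cl i == c] in hc.
pose D := Tm k.+1.
pose TT := {t : {ffun J -> 'I_D} | t \in [set t : {ffun J -> 'I_D} | (\sum_j t j < D)%N]}.
have hTT : (#|{: TT}| * N0 ^ D <= N0.+1 ^ (#|J| + D))%N.
  have -> : #|{: TT}| = #|[set t : {ffun J -> 'I_D} | (\sum_j t j < D)%N]|.
    by rewrite card_sig; apply: eq_card.
  exact: simplex_count.
have hR : (cI <= 2 ^ k.+1 * p.+1 * #|R|)%N.
  rewrite -cardI; apply: leq_trans hc _; rewrite leq_mul2r leq_mul2l gp !orbT //.
have := count hTT hR; rewrite -cardI => hcount.
have bC (t : TT) i : (binp (fun j => val t j) (lam i) <= 2 ^ (#|J| * Lk))%N.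
  have -> : (2 ^ (#|J| * Lk) = \prod_(j : J) 2 ^ Lk)%N by rewrite prod_nat_const -expnM mulnC.
  rewrite /binp; apply: leq_prod => j _; apply: leq_trans (leq_bin_exp _ _) _.
  by rewrite leq_exp2l //; apply: ltnW; exact: ltn_ord.
have [w [wR wW wex wz]] := siegel bC hcount.
apply: (hlev I W sg su Lam0 H0 dl Tm kap _ _ _ _ _ _ _ _ _ _ _ k.+1 _ w lam) => //.
- by move=> i; apply: ltnW; exact: ltn_ord.
- by move=> m; rewrite ltnS => mk; split; [exact: dlM | rewrite cardI; exact: dlC].
have inR i : w i != 0 -> C i = c %[mod 2 ^ k.+1 * g].
  move=> wi; have : i \in R by apply: contraNT wi => /wR ->.
  by rewrite inE => /eqP <-; rewrite /= modn_mod.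
have ECi i i' : w i != 0 -> w i' != 0 -> C i = C i' %[mod 2 ^ k.+1 * g].
  by move=> /inR -> /inR ->.
split.
- by move=> i j; exact: ltn_ord.
- exact: wW.
- exact: wex.
- move=> i i' wi wi'; have /eqP e := ECi _ _ wi wi'.
  have CE j : (2 * (\sum_j0 E j0 * lam j j0) + E0 * (2 ^ k.+1 * kap j) = 2 * C j)%N.
    by rewrite /C mulnDr expnS; congr (_ + _)%N; lia.
  by rewrite !CE [(2 ^ k.+2)%N]expnS -mulnA -!muln_modr // (eqP e).
- move=> i i' wi wi' e; have := ECi _ _ wi wi'.
  rewrite /C (eq_bigr (fun j => E j * lam i' j)%N) => [|j _]; last by rewrite e.
  move=> /eqP; rewrite eqn_modDl => /eqP {}e1.
  have d2 : (2 * g %| 2 ^ k.+1 * g)%N by rewrite expnS -mulnA dvdn_mul // dvdn_mull.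
  have e2 : (E0 * (2 ^ k * kap i) = E0 * (2 ^ k * kap i') %[mod 2 * g])%N.
    by rewrite -(modn_dvdm _ d2) e1 modn_dvdm.
  (* Equal [lam] forces equal [kap]: otherwise some [u ^ D] with [0 < D <= 2 ^ k * H0] has its
     second coordinate divisible by [p], against [uinj]. *)
  have no (a b : 'I_H0) : (a < b)%N -> (E0 * (2 ^ k * a) = E0 * (2 ^ k * b) %[mod 2 * g])%N -> False.
    move=> ab h; have lt : (2 ^ k * a < 2 ^ k * b)%N by rewrite ltn_pmul2l ?expn_gt0.
    have := hinj _ _ lt h; apply/negP; apply: uinj; rewrite subn_gt0 lt /=.
    apply: leq_trans (leq_subr _ _) _; rewrite leq_mul2l; apply/orP; right; exact: ltnW.
  have e3 : i.2 = i'.2.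
    apply/val_inj => /=; case: (ltngtP i.2 i'.2) => // lt; first by case: (no _ _ lt).
    by case: (no _ _ lt); rewrite e2.
  have e4 : i.1 = i'.1 by apply/ffunP => j; apply/val_inj; exact: e.
  by rewrite [i]surjective_pairing [i']surjective_pairing e3 e4.
(* At [s = 0] every [Pt] is 1, so the equations to be solved have integer coefficients independent
   of the [xi j] and [u]. *)
exists 0%N => //; apply: bvan_van => t tT.
have ht j : (t j < D)%N by apply: leq_ltn_trans tT; rewrite (bigD1 j) //= leq_addr.
pose t' : {ffun J -> 'I_D} := [ffun j => Ordinal (ht j)].
have ht' : t' \in [set t : {ffun J -> 'I_D} | (\sum_j t j < D)%N].
  by rewrite inE; under eq_bigr do rewrite ffunE.
have := wz (exist _ t' ht') => /(congr1 (fun z : int => z%:~R : A5)).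
rewrite rmorph_sum /= => e; rewrite -[RHS]e; apply: eq_bigr => i _.
rewrite /Pt !muln0 expr0 mul1r big1 ?mulr1; last by move=> j _; rewrite !muln0 !expr0 mulr1.
rewrite intrM -pmulrn; congr (_ * _%:R); apply: eq_bigr => j _.
by rewrite ffunE.
Qed.

End ValuationBound.

Local Close Scope ring_scope.

(** * Fibonacci numbers and primitive divisors *)

Lemma fibSS n : fib n.+2 = fib n.+1 + fib n. Proof. by []. Qed.

Lemma fib_add m n : fib (m + n.+1) = fib m.+1 * fib n.+1 + fib m * fib n.
Proof.
elim: m n => [|m IH] n; first by rewrite mul1n mul0n addn0.
by rewrite addSnnS IH !fibSS; ring.
Qed.

Lemma fib_gt0 n : 0 < n -> 0 < fib n.
Proof.
case: n => // n _; elim: n {-2}n (leqnn n) => [|m IH] [|[|n]] // h.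
by rewrite fibSS ltn_addr // IH.
Qed.

Lemma coprime_fibS n : coprime (fib n) (fib n.+1).
Proof. by elim: n => // n IH; rewrite fibSS /coprime gcdnDl gcdnC. Qed.

Lemma gcd_fib_add m n : gcdn (fib m) (fib (m + n)) = gcdn (fib m) (fib n).
Proof.
case: n => [|n]; first by rewrite addn0 gcdnn /= gcdn0.
rewrite fib_add (addnC (_ * _)) (mulnC (fib m) (fib n)) gcdnMDl Gauss_gcdr //; exact: coprime_fibS.
Qed.

Lemma gcd_fib m n : gcdn (fib m) (fib n) = fib (gcdn m n).
Proof.
have [k] := ubnP (m + n); elim: k m n => // k IH m n.
wlog mn : m n / m <= n => [h|] mnk.
  case: (leqP m n) => le; first exact: h.
  by rewrite gcdnC (gcdnC m); apply: h; [exact: ltnW | rewrite addnC].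
case: (posnP m) => [->|m0]; first by rewrite /= !gcd0n.
by rewrite -(subnKC mn) gcd_fib_add IH ?gcdnDl //; lia.
Qed.

Lemma dvd_fib p m n : p %| fib m -> p %| fib n -> p %| fib (gcdn m n).
Proof. by rewrite -gcd_fib dvdn_gcd => -> ->. Qed.

Lemma fib_dvd m n : m %| n -> fib m %| fib n.
Proof. by move=> h; rewrite -(gcdn_idPl h) -gcd_fib dvdn_gcdr. Qed.

Lemma primitive_notin p n k : primitive_divisor p n -> 0 < k < n -> ~~ (p %| fib k).
Proof.
case/and3P => _ _ h /andP[k0 kn]; apply: contra h => h; apply: dvdn_mull.
rewrite (big_cat_nat _ (n := k)) ?(ltnW kn) //=; apply: dvdn_mull.
by rewrite big_ltn // dvdn_mulr.
Qed.

(** If [p] divides an earlier [F_k], it divides [F_d] with [d] the gcd of [k] and [n], a proper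
    divisor of [n], hence also some [F_(n/q)]. The factor 5 in the definition is [F_5], an earlier
    term as [n > 5]. *)
Lemma nonprimitive_dvd p n : 5 < n -> prime p -> p %| fib n -> ~~ primitive_divisor p n ->
  exists2 m, p %| fib m & exists2 q, prime q & n = m * q.
Proof.
move=> n5 pp pn; rewrite /primitive_divisor pp pn /= negbK => h.
have [k /andP[k0 kn] pk] : exists2 k, 0 < k < n & p %| fib k.
  move: h; rewrite Euclid_dvdM // => /orP[h|]; first by exists 5.
  rewrite big_seq; elim/big_ind: _ => [|x y hx hy|i].
  - by rewrite dvdn1 => /eqP p1; move: pp; rewrite p1.
  - by rewrite Euclid_dvdM // => /orP[].
  by rewrite mem_index_iota => hi hp; exists i.
have n0 : 0 < n by apply: leq_trans n5.
pose d := gcdn k n.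
have dn : d %| n by exact: dvdn_gcdr.
have dk : d < n by apply: leq_ltn_trans kn; rewrite dvdn_leq ?dvdn_gcdl.
have nd : 1 < n %/ d.
  by rewrite ltn_divRL // mul1n.
pose q := pdiv (n %/ d); have qp : prime q by apply: pdiv_prime.
have /dvdnP[e he] : q %| n %/ d by exact: pdiv_dvd.
exists (e * d); last by exists q => //; rewrite -mulnA (mulnC d) mulnA -he divnK.
by apply: dvdn_trans (dvd_fib pk pn) _; apply: fib_dvd; apply: dvdn_mull.
Qed.

(* [F_(m q + a)] modulo [F_m ^ 3]. *)
Lemma fib_mul_mod m q a : exists k, fib (m.+1 * q.+2 + a) =
  fib m ^ q.+2 * fib a + q.+2 * fib m.+1 * fib m ^ q.+1 * fib a.+1
  + 'C(q.+2, 2) * fib m.+1 ^ 2 * fib m ^ q * fib a.+2 + fib m.+1 ^ 3 * k.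
Proof.
have step b : fib (m.+1 + b) = fib m.+1 * fib b.+1 + fib m * fib b.
  by rewrite addSnnS fib_add; ring.
elim: q a => [|q IH] a.
  exists 0; rewrite muln2 -addnn -addnA step -addnS !step (fibSS a) !expnS expn0 binn; ring.
have [k1 h1] := IH a; have [k2 h2] := IH a.+1.
exists (fib m * k1 + 'C(q.+2, 2) * fib m ^ q * fib a.+3 + fib m.+1 * k2).
rewrite mulnS -addnA step -addnS h1 h2 (binS q.+2) bin1 !expnS expn0; ring.
Qed.

Lemma gcdn_lcmr a b c : gcdn a (lcmn b c) = lcmn (gcdn a b) (gcdn a c).
Proof. exact: (@meetUr _ natdvd a b c). Qed.

Definition fib_lcm (qs : seq nat) (m : nat) : nat := \big[lcmn/1]_(q <- qs) fib (m %/ q).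

Lemma fib_lcm_dvd qs m q : q \in qs -> fib (m %/ q) %| fib_lcm qs m.
Proof.
rewrite /fib_lcm; elim: qs => // q' qs IH; rewrite inE big_cons => /orP[/eqP ->|/IH h].
  exact: dvdn_lcml.
by apply: dvdn_trans h _; exact: dvdn_lcmr.
Qed.

Lemma dvd_fib_lcm qs m : (forall q, q \in qs -> q %| m) -> fib_lcm qs m %| fib m.
Proof.
move=> h; rewrite /fib_lcm big_seq; elim/big_ind: _ => [|x y hx hy|q /h qm].
- exact: dvd1n.
- by rewrite dvdn_lcm hx hy.
by apply: fib_dvd; rewrite -{2}(divnK qm) dvdn_mulr.
Qed.

(** By [gcd_fib], what [F_(m/q0)] shares with the lcm at [m] is the lcm at [m / q0]; then lcm times
    gcd is the product. Iteration amounts to inclusion-exclusion over the primes. *)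
Lemma fib_lcm_cons q0 qs m : uniq (q0 :: qs) -> all prime (q0 :: qs) ->
  all (fun q => q %| m) (q0 :: qs) ->
  fib_lcm (q0 :: qs) m * fib_lcm qs (m %/ q0) = fib (m %/ q0) * fib_lcm qs m.
Proof.
move=> /= /andP[q0s uqs] /andP[pq0 pqs] /andP[q0m qsm].
have -> : fib_lcm qs (m %/ q0) = gcdn (fib (m %/ q0)) (fib_lcm qs m).
  rewrite /fib_lcm big_seq [in RHS]big_seq; apply: esym.
  elim/big_rec2: _ => [|q x y qqs <-]; first by rewrite gcdn1.
  rewrite gcdn_lcmr gcd_fib; congr (lcmn (fib _) _).
  have qm := allP qsm _ qqs; have pq := allP pqs _ qqs.
  have co : coprime q0 q.
    by rewrite prime_coprime // dvdn_prime2 //; apply: contraNneq q0s => ->.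
  have /dvdnP[k ->] : q0 * q %| m by rewrite Gauss_dvd // q0m qm.
  have q00 := prime_gt0 pq0; have q0' := prime_gt0 pq.
  have -> : k * (q0 * q) %/ q0 = k * q by rewrite mulnCA mulKn.
  have -> : k * (q0 * q) %/ q = k * q0 by rewrite mulnA mulnK.
  by rewrite -muln_gcdr gcdnC (eqP co) muln1 mulnK.
by rewrite /fib_lcm big_cons muln_lcm_gcd.
Qed.

Definition prim_part n := \prod_(p <- primes (fib n) | primitive_divisor p n) p ^ logn p (fib n).

Lemma prim_part_gt0 n : 0 < prim_part n.
Proof.
rewrite /prim_part big_seq_cond; apply: prodn_cond_gt0 => p /andP[+ _].
by rewrite mem_primes => /andP[pp _]; rewrite expn_gt0 prime_gt0.
Qed.

(** [2 F_(m-1) + F_m] is the Lucas number [L_m], the quotient of [F_(2m)] by [F_m]. The period of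
    the Fibonacci sequence modulo 8 is 12, so twelve cases decide. *)
Lemma lucas_mod8 m : 0 < m -> ~~ (8 %| 2 * fib m.-1 + fib m).
Proof.
have per k : fib (k + 12) = fib k %[mod 8].
  have -> : fib (k + 12) = (fib k.+1 * 18 + fib k * 11) * 8 + fib k.
    have f12 : fib 12 = 18 * 8 by [].
    have f11 : fib 11 = 11 * 8 + 1 by [].
    by rewrite -[12]/(11.+1) fib_add f12 f11; ring.
  by rewrite modnMDl.
have [k] := ubnP m; elim: k m => // k IH m mk m0.
case: (leqP m 12) => m12.
  by move: m m12 m0 {mk}; do 13 (case=> //).
have [l e] : exists l, m = l.+1 + 12 by exists (m - 13); lia.
have := IH l.+1; rewrite /dvdn => h; have -> : m.-1 = l + 12 by lia.
rewrite e -modnDm -modnMmr !per modnMmr modnDm.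
by apply: h => //; lia.
Qed.

Lemma fib_double m : fib (m.+1 * 2) = fib m.+1 * (2 * fib m + fib m.+1).
Proof. by rewrite muln2 -addnn fib_add fibSS; ring. Qed.

(** With [n = m q] and [p] dividing [F_m], the number [G] divides [F_n / F_m], which is
    [q * F_(m-1) ^ (q-1)] modulo [F_m]; since [p] does not divide [F_(m-1)], it equals [q]. For odd
    [p] the next terms of the expansion show that [p] occurs once; for [p = 2] the quotient is a
    Lucas number and 4 is possible, whence [2 * n]. *)
Lemma nonprimitive_val p n (G := fib n %/ fib_lcm (primes n) n) : 5 < n -> prime p ->
  p %| G -> ~~ primitive_divisor p n -> p ^ logn p G %| 2 * n.
Proof.
move=> n5 pp pG np; have n0 : 0 < n by apply: leq_trans n5.
have LF : fib_lcm (primes n) n %| fib n.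
  by apply: dvd_fib_lcm => q; rewrite mem_primes => /and3P[].
have FE : fib n = G * fib_lcm (primes n) n by rewrite /G divnK.
have pF : p %| fib n by rewrite FE dvdn_mulr.
have [m pm [q qp nE]] := nonprimitive_dvd n5 pp pF np.
have m0 : 0 < m by move: n0; rewrite nE; case: (m).
have q0 := prime_gt0 qp.
have qn : q \in primes n by rewrite mem_primes qp n0 nE dvdn_mull.
have /dvdnP[l hl] := fib_lcm_dvd n qn.
have hq : n %/ q = m by rewrite nE mulnK.
rewrite hq in hl.
have Fm0 := fib_gt0 m0.
have GH H : fib (m * q) = fib m * H -> G %| H.
  move=> e; have : G * (l * fib m) = fib m * H by rewrite -e -nE FE hl.
  by rewrite mulnA mulnC => /eqP; rewrite eqn_pmul2l // => /eqP <-; rewrite dvdn_mulr.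
have nop : ~~ (p %| fib m.-1).
  apply/negP => h; have := coprime_fibS m.-1; rewrite prednK // => co.
  have : p %| gcdn (fib m.-1) (fib m) by rewrite dvdn_gcd h.
  by rewrite (eqP co) dvdn1 => /eqP p1; move: pp; rewrite p1.
have [k hk] := fib_mul_mod m.-1 (q - 2) 0.
have q2 : (q - 2).+2 = q by rewrite -addn2 subnK // prime_gt1.
rewrite q2 (prednK m0) addn0 muln0 add0n !muln1 in hk.
pose H := q * fib m.-1 ^ (q - 2).+1 + 'C(q, 2) * fib m * fib m.-1 ^ (q - 2) + fib m ^ 2 * k.
have hH : fib (m * q) = fib m * H by rewrite hk /H !expnS expn0; ring.
have GdH := GH _ hH.
have pq : p = q.
  have : p %| H by apply: dvdn_trans pG GdH.
  rewrite /H -addnA dvdn_addl; last first.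
    by rewrite dvdn_add //; [rewrite mulnAC dvdn_mull | rewrite dvdn_mulr // expnS dvdn_mulr].
  rewrite Euclid_dvdM // Euclid_dvdX // (negbTE nop) orbF => pq.
  by apply/eqP; rewrite -dvdn_prime2.
have G0 : 0 < G by move: (fib_gt0 n0); rewrite FE muln_gt0 => /andP[].
have bound e H' : G %| H' -> ~~ (p ^ e.+1 %| H') -> logn p G <= e.
  move=> GdH' h; rewrite leqNgt; apply: contra h => h.
  apply: dvdn_trans (dvdn_trans _ GdH'); first exact: (dvdn_exp2l p h).
  exact: pfactor_dvdnn.
have [p2|op] := even_prime pp.
  have hb : logn p G <= 2.
    apply: (bound _ (2 * fib m.-1 + fib m)); last by rewrite p2; exact: lucas_mod8.
    by apply: GH; rewrite -pq p2; have := fib_double m.-1; rewrite prednK.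
  apply: dvdn_trans (dvdn_exp2l p hb) _.
  by rewrite nE -pq p2 -[2 ^ 2]/(2 * 2) dvdn_mul // dvdn_mull.
have hb : logn p G <= 1.
  apply: (bound _ _ GdH); rewrite /H -addnA dvdn_addl; last first.
    apply: dvdn_add; last by rewrite dvdn_mulr // dvdn_exp2r.
    apply: dvdn_mulr; rewrite expnS expn1 dvdn_mul // pq prime_dvd_bin //=.
    by rewrite -pq; have := prime_gt1 pp; case: (p) op => [|[|[|]]].
  rewrite -pq expnS expn1 dvdn_pmul2l ?prime_gt0 //.
  by rewrite Euclid_dvdX // (negbTE nop).
apply: dvdn_trans (dvdn_exp2l p hb) _; rewrite expn1 nE -pq.
by rewrite dvdn_mull // dvdn_mull.
Qed.

Lemma fib_part_dvd n : 5 < n -> (fib n %/ fib_lcm (primes n) n) %| prim_part n * (2 * n).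
Proof.
move=> n5; set G := fib n %/ _; have n0 : 0 < n by apply: leq_trans n5.
have LF : fib_lcm (primes n) n %| fib n.
  by apply: dvd_fib_lcm => q; rewrite mem_primes => /and3P[].
have FE : fib n = G * fib_lcm (primes n) n by rewrite /G divnK.
have F0 := fib_gt0 n0.
have G0 : 0 < G by move: F0; rewrite FE muln_gt0 => /andP[].
apply/dvdn_partP => // p; rewrite mem_primes G0 => /and3P[pp _ pG].
rewrite p_part; case: (boolP (primitive_divisor p n)) => hp; last first.
  by apply: dvdn_mull; apply: nonprimitive_val.
have pF : p %| fib n by rewrite FE dvdn_mulr.
apply: dvdn_mulr; rewrite /prim_part.
have pin : p \in primes (fib n) by rewrite mem_primes pp F0.
rewrite big_mkcond (bigD1_seq p) ?primes_uniq //= hp.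
rewrite dvdn_mulr //; apply: dvdn_exp2l; apply: dvdn_leq_log => //.
by rewrite FE dvdn_mulr.
Qed.

(** * Powers of the unit and the rank of apparition *)

Local Open Scope ring_scope.

(* The sixth power of the golden ratio, the first one to lie in [Z[sqrt 5]] with norm 1. *)
Definition fund : A5 := (9, 4).

Lemma fund_norm : fund * (fund.1, - fund.2) = 1. Proof. by []. Qed.

Lemma fund_pow n : 2 * (fund ^+ n).1 = 2 * (fib (6 * n).+1)%:Z - (fib (6 * n))%:Z /\
  2 * (fund ^+ n).2 = (fib (6 * n))%:Z.
Proof.
elim: n => [|n [IH1 IH2]]; first by rewrite muln0 expr0.
rewrite exprS [(6 * n.+1)%N]mulnS addnC; set m := (6 * n)%N in IH1 IH2 *.
have e1 : (fib (m + 6))%:Z = 8 * (fib m.+1)%:Z + 5 * (fib m)%:Z.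
  by rewrite -[6%N]/(5.+1) fib_add -[fib 6]/8%N -[fib 5]/5%N PoszD !PoszM; ring.
have e2 : (fib (m + 6).+1)%:Z = 13 * (fib m.+1)%:Z + 8 * (fib m)%:Z.
  by rewrite -addnS fib_add -[fib 7]/13%N -[fib 6]/8%N PoszD !PoszM; ring.
rewrite e1 e2; move: IH1 IH2; case: (fund ^+ n) => a b /= IH1 IH2; split; lia.
Qed.

Lemma fund_pow_dvd (d n : nat) : odd d -> (d %| fib (6 * n))%N = (d %| absz (fund ^+ n).2)%N.
Proof.
move=> od; have [_ e] := fund_pow n.
have -> : fib (6 * n) = (2 * absz (fund ^+ n).2)%N by rewrite -(abszM 2) e.
by rewrite Gauss_dvdr // coprimen2.
Qed.

Lemma binet (F : fieldType) (s : F) n : s ^+ 2 = 5 -> (2 : F) != 0 ->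
  s * (fib n)%:R = ((1 + s) / 2) ^+ n - ((1 - s) / 2) ^+ n.
Proof.
move=> s2 n2; have n4 : (4 : F) != 0 by rewrite (natrM _ 2 2) mulf_neq0.
set a := (1 + s) / 2; set b := (1 - s) / 2.
have qa : a ^+ 2 = a + 1.
  have -> : a ^+ 2 = a + 1 + (s ^+ 2 - 5) / 4 by rewrite /a; field; rewrite ?n2 ?n4.
  by rewrite s2 subrr mul0r addr0.
have qb : b ^+ 2 = b + 1.
  have -> : b ^+ 2 = b + 1 + (s ^+ 2 - 5) / 4 by rewrite /b; field; rewrite ?n2 ?n4.
  by rewrite s2 subrr mul0r addr0.
have step (x : F) m : x ^+ 2 = x + 1 -> x ^+ m.+2 = x ^+ m.+1 + x ^+ m.
  by move=> x2; rewrite -addn2 exprD x2 mulrDr mulr1 -exprSr.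
suff: s * (fib n)%:R = a ^+ n - b ^+ n /\ s * (fib n.+1)%:R = a ^+ n.+1 - b ^+ n.+1 by case.
elim: n => [|n [h0 h1]].
  rewrite mulr0 !expr0 subrr mulr1 !expr1; split=> //; rewrite /a /b; field.
  exact: n2.
split=> //; rewrite fibSS natrD mulrDr h1 h0 (step a) // (step b) //; ring.
Qed.

(** In the field with [p ^ 2] elements Frobenius fixes [sqrt 5] or changes its sign. In the first
    case both roots [a], [b] have [(p - 1)]-st power 1; in the second they are exchanged and both
    [(p + 1)]-st powers are [a b]. Binet's formula then gives a zero. *)
Lemma fib_rank p : prime p -> (5 < p)%N -> (p %| fib p.-1)%N \/ (p %| fib p.+1)%N.
Proof.
move=> pp p5; have p2 : (2 < p)%N by apply: leq_trans p5.
have [z zp] := Fp_prim pp.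
pose K := qfield (prim_nonsquare pp p2 zp).
have chK := K_pchar pp p2 zp.
have K0 m : ((m%:R : K) == 0) = (p %| m)%N by rewrite (dvdn_pcharf chK).
have n2 : (2 : K) != 0 by rewrite K0 gtnNdvd.
have n4 : (4 : K) != 0 by rewrite (natrM _ 2 2) mulf_neq0.
have [s s2] : exists s : K, s ^+ 2 = 5.
  have five : (5 : K) = ((5%:R : 'F_p), 0).
    have natE m : (m%:R : K) = (m%:R, 0).
      by elim: m => // m IH; rewrite -!natr1 IH; congr pair; rewrite /= addr0.
    exact: natE.
  have y0 : (5%:R : 'F_p) != 0 by rewrite -(dvdn_pcharf (pchar_Fp pp)) gtnNdvd.
  have [w hw] := Fp_square pp zp y0; rewrite five; case: hw => ->.
    exists (w, 0); rewrite expr2; apply: injective_projections => /=; ring.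
  exists (0, w); rewrite expr2; apply: injective_projections => /=; ring.
have s0 : s != 0 by apply: contra_eq_neq s2 => ->; rewrite expr0n eq_sym K0 gtnNdvd.
pose a := (1 + s) / 2; pose b := (1 - s) / 2.
have ab : a * b = -1.
  have -> : a * b = -1 + (5 - s ^+ 2) / 4 by rewrite /a /b; field; rewrite ?n2 ?n4.
  by rewrite s2 subrr mul0r addr0.
have ab0 : a * b != 0 by rewrite ab oppr_eq0 oner_neq0.
have [a0 b0] : a != 0 /\ b != 0 by move: ab0; rewrite mulf_eq0 negb_or => /andP.
have nat_frob m : (m%:R : K) ^+ p = m%:R.
  by rewrite -(pFrobenius_autE chK) rmorph_nat.
have pw (x : K) : ((1 + x) / 2) ^+ p = (1 + x ^+ p) / 2.
  by rewrite expr_div_n exprDn_pchar ?(pnatE _ pp) // expr1n nat_frob.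
have sp : s ^+ p = s \/ s ^+ p = - s.
  have /eqP : (s ^+ p) ^+ 2 = s ^+ 2 by rewrite -exprM mulnC exprM s2 nat_frob.
  by rewrite eqf_sqr => /orP[] /eqP; [left | right].
have Nsp : (- s) ^+ p = - s ^+ p.
  have op : odd p by case: (even_prime pp) => // pe; move: p5; rewrite pe.
  by rewrite -mulN1r exprMn -signr_odd op expr1 mulN1r.
have key m : a ^+ m = b ^+ m -> (p %| fib m)%N.
  move=> e; rewrite -K0; have := binet m s2 n2; rewrite -/a -/b e subrr => /eqP.
  by rewrite mulf_eq0 (negbTE s0).
have ap : a ^+ p = (1 + s ^+ p) / 2 by rewrite /a pw.
have bp : b ^+ p = (1 - s ^+ p) / 2 by rewrite /b pw Nsp.
case: sp => sp; [left | right]; apply: key.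
  have h (x : K) : x != 0 -> x ^+ p = x -> x ^+ p.-1 = 1.
    by move=> x0 e; apply: (mulfI x0); rewrite -exprS prednK ?prime_gt0 // e mulr1.
  by rewrite !h // ?ap ?bp sp.
by rewrite !exprS ap bp sp opprK -/a -/b mulrC.
Qed.

(** A primitive [p] has rank of apparition [n], so [n] divides [p - 1] or [p + 1]. The primes up to
    5 are ruled out as divisors of [F_3], [F_4], [F_5]. *)
Lemma primitive_congr p n : (5 < n)%N -> primitive_divisor p n ->
  exists2 j, (0 < j)%N & p = (j * n - 1)%N \/ p = (j * n + 1)%N.
Proof.
move=> n5 hp; have n0 : (0 < n)%N by apply: leq_trans n5.
case/and3P: (hp) => pp pF _.
have p5 : (5 < p)%N.
  have no k : (0 < k <= 5)%N -> ~~ (p %| fib k)%N.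
    by case/andP => k0 k5; apply: primitive_notin hp _; rewrite k0 (leq_ltn_trans k5).
  have := no 3%N isT; have := no 4%N isT; have := no 5%N isT.
  rewrite -[fib 3]/2%N -[fib 4]/3%N -[fib 5]/5%N => h5 h3 h2.
  rewrite ltnNge; apply/negP => le5.
  have := prime_gt1 pp; move: le5 pp h2 h3 h5 {hp pF no}.
  by do 6 (case: p => [|p]; first by []).
have full k : (0 < k)%N -> (p %| fib k)%N -> (n %| k)%N.
  move=> k0 pk; have d := dvd_fib pF pk.
  have g0 : (0 < gcdn n k)%N by rewrite gcdn_gt0 n0.
  have gn : (gcdn n k <= n)%N by rewrite dvdn_leq ?dvdn_gcdl.
  move: gn; rewrite leq_eqVlt => /orP[/eqP <-|lt]; first exact: dvdn_gcdr.
  by have := primitive_notin hp (k := gcdn n k); rewrite g0 lt d => /(_ isT).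
case: (fib_rank pp p5) => h.
  have p1 : (0 < p.-1)%N by move: p5; lia.
  have /dvdnP[j e] := full _ p1 h; exists j; last by right; move: e p5; lia.
  by case: j e => // e; move: p1; rewrite e.
have /dvdnP[j e] := full _ (ltn0Sn p) h; exists j; last by left; move: e; lia.
by case: j e.
Qed.

Local Close Scope ring_scope.

(** * A supply of split primes *)

(* Thue's lemma gives a small [x] whose norm is [q] times an integer of absolute value below 5. *)
Lemma thue (q m : nat) : prime q -> 5 < q -> 0 < m -> (Posz q %| (Posz m ^+ 2 - 5)%R)%Z ->
  exists x : A5, [/\ logn q (absz (qnorm x)) = 1,
    forall q', prime q' -> 5 < q' -> q' != q -> ~~ (q' %| absz (qnorm x)) &
    forall b, q <= b ^ 2 -> a5size x <= 4 * b].
Proof.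
move=> pq q5 m0 qm.
have [s [s1 s2]] : exists s, s ^ 2 < q /\ q < s.+1 ^ 2.
  have ex : exists s, s ^ 2 <= q by exists 0.
  have bd s : s ^ 2 <= q -> s <= q.
    by move=> h; apply: leq_trans h; case: s => // s; rewrite expnS expn1 leq_pmulr.
  case: (ex_maxnP ex bd) => s hs hmax; exists s; split.
    rewrite ltn_neqAle hs andbT; apply/eqP => e.
    have /primeP[_ /(_ s)] : prime (s * s) by rewrite mulnn e.
    rewrite dvdn_mulr // => /(_ isT) /orP[] /eqP e1; move: q5; rewrite -e expnS expn1; nia.
  have h : ~~ (s.+1 ^ 2 <= q) by apply/negP => /hmax; rewrite ltnn.
  by rewrite ltnNge.
pose X := ('I_s.+1 * 'I_s.+1)%type.
have q0 : 0 < q by apply: ltn_trans q5.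
(* [q - m %% q] plays the role of [- m] among the natural numbers. *)
pose f (ab : X) : 'I_q := Ordinal (ltn_pmod (ab.1 + (q - m %% q) * ab.2) q0).
have : ~~ injectiveb f.
  apply/negP => /injectiveP /leq_card; rewrite card_prod !card_ord.
  by rewrite leqNgt; move: s2; rewrite expnS expn1 => ->.
move=> /injectivePn[[a b] [[a' b'] ab fab]].
pose x : int := (Posz a - Posz a')%R; pose y : int := (Posz b - Posz b')%R.
have xy : (Posz q %| (x - Posz m * y)%R)%Z.
  have e0 := congr1 (@nat_of_ord q) fab.
  have mq : m %% q <= q by rewrite ltnW // ltn_pmod.
  have := divn_eq (a + (q - m %% q) * b) q; have := divn_eq (a' + (q - m %% q) * b') q.
  rewrite -[X in _ = _ + X]/(nat_of_ord (f (a', b'))) -e0 /=.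
  set A := a + _; set A' := a' + _; move: (A %% q) (A %/ q) (A' %/ q) => r k k' h' h.
  rewrite /A /A' {A A'} in h h'.
  have /(congr1 Posz) := h; have /(congr1 Posz) := h'.
  rewrite !PoszD !PoszM -(subzn mq) => {}h' {}h.
  have H : (x + (Posz q - Posz (m %% q)) * y = (Posz k - Posz k') * Posz q)%R.
    transitivity ((Posz a + (Posz q - Posz (m %% q)) * Posz b) -
      (Posz a' + (Posz q - Posz (m %% q)) * Posz b'))%R; first by rewrite /x /y; ring.
    by rewrite h h'; ring.
  apply/dvdzP; exists (Posz k - Posz k' - (1 + Posz (m %/ q)) * y)%R.
  transitivity ((x + (Posz q - Posz (m %% q)) * y) - Posz q * y - Posz (m %/ q) * Posz q * y)%R.
    by rewrite {1}(divn_eq m q) PoszD PoszM; ring.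
  by rewrite H; ring.
have x_le : absz x <= s by have := ltn_ord a; have := ltn_ord a'; rewrite /x; lia.
have y_le : absz y <= s by have := ltn_ord b; have := ltn_ord b'; rewrite /y; lia.
have nz : (x, y) != 0%R :> A5.
  apply: contra ab => /eqP[ex ey]; apply/eqP; congr pair; apply/val_inj => /=; move: ex ey; rewrite /x /y; lia.
exists (x, y); set N := qnorm _.
have NE : N = (x ^+ 2 - 5 * y ^+ 2)%R by [].
have N0 : N <> 0%R.
  by move/(qnorm_eq0 int_dom (@int_sq_indep 5 5%R isT isT)) => e; move: nz; rewrite e eqxx.
have qN : (Posz q %| N)%Z.
  have -> : N = ((x - Posz m * y) * (x + Posz m * y) + (Posz m ^+ 2 - 5) * y ^+ 2)%R by rewrite NE; ring.
  by apply: rpredD; apply: dvdz_mulr.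
have /dvdzP[c cN] := qN.
(* The norm lies between [- 5 s ^ 2] and [s ^ 2], and [s ^ 2 < q]; so the cofactor of [q] is at most
   4 in absolute value and has no prime factor above 5. *)
have Nle : absz N < 5 * q.
  have h1 : absz (x * x)%R <= s * s by rewrite abszM; apply: leq_mul.
  have h2 : absz (y * y)%R <= s * s by rewrite abszM; apply: leq_mul.
  have x0 : (0 <= x * x)%R by rewrite -expr2 sqr_ge0.
  have y0 : (0 <= y * y)%R by rewrite -expr2 sqr_ge0.
  rewrite NE !expr2; move: s1 h1 h2 x0 y0; rewrite expnS expn1.
  by move: (s * s) (x * x)%R (y * y)%R => S xx yy; clear; lia.
have c0 : 0 < absz c by rewrite absz_gt0; apply/eqP => c0; apply: N0; rewrite cN c0 mul0r.
have c5 : absz c < 5 by move: Nle; rewrite cN abszM /= ltn_pmul2r.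
split.
- rewrite cN abszM /= lognM // (@logn_prime q q pq) eqxx addn1; congr _.+1.
  by apply/eqP; rewrite -leqn0 leqNgt logn_gt0 mem_primes pq c0 /= gtnNdvd //; apply: leq_trans c5 _; exact: ltnW.
- move=> q' pq' q'5 q'q; rewrite cN abszM /= Euclid_dvdM // negb_or gtnNdvd //=; last by apply: leq_trans c5 _; exact: ltnW.
  by rewrite dvdn_prime2.
move=> B qB; have sB : s <= B.
  by rewrite -ltnS -(ltn_exp2r _ _ (isT : 0 < 2)); apply: leq_ltn_trans (ltnW s1) _; apply: leq_ltn_trans qB _; rewrite ltn_exp2r.
by move: x_le y_le sB; rewrite /a5size /=; clear; lia.
Qed.

Lemma central_bin_le m : 'C(m.*2.+1, m) <= 4 ^ m.
Proof.
have e : 2 ^ m.*2.+1 = \sum_(i < m.*2.+2) 'C(m.*2.+1, i).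
  by rewrite -[2]/(1 + 1) expnDn; apply: eq_bigr => i _; rewrite !exp1n !muln1.
have h1 : m < m.*2.+2 by rewrite -addnn; lia.
have h2 : m.+1 < m.*2.+2 by rewrite -addnn; lia.
have : 'C(m.*2.+1, m) + 'C(m.*2.+1, m.+1) <= 2 ^ m.*2.+1.
  rewrite e (bigD1 (Ordinal h1)) //= leq_add2l (bigD1 (Ordinal h2)) //= ?leq_addr //.
  by apply/eqP => -[]; lia.
have -> : 'C(m.*2.+1, m.+1) = 'C(m.*2.+1, m).
  by rewrite -bin_sub; [congr 'C(_, _); rewrite -addnn; lia | rewrite -addnn; lia].
by rewrite addnn -mul2n expnS leq_pmul2l // -muln2 mulnC expnM.
Qed.

Lemma prod_primes_dvd (s : seq nat) X : uniq s -> all prime s -> all (fun q => q %| X) s ->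
  \prod_(q <- s) q %| X.
Proof.
elim: s => [|q s IH] /=; first by rewrite big_nil dvd1n.
move=> /andP[qs us] /andP[pq ps] /andP[qX sX]; rewrite big_cons Gauss_dvd ?qX ?IH //.
rewrite prime_coprime //; apply: contra qs => h.
have : exists2 q', q' \in s & q %| q'.
  move: h; rewrite big_seq; elim/big_ind: _ => [|x y hx hy|i].
  - by rewrite dvdn1 => /eqP q1; move: pq; rewrite q1.
  - by rewrite Euclid_dvdM // => /orP[].
  by move=> iS h; exists i.
move=> [q' q's]; rewrite dvdn_prime2 //; first by move/eqP ->.
exact: (allP ps).
Qed.

Lemma prime_ndvd_fact q k : prime q -> k < q -> ~~ (q %| k`!).
Proof.
move=> pq; elim: k => [|k IH] kq; first by rewrite dvdn1 neq_ltn prime_gt1 ?orbT.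
by rewrite factS Euclid_dvdM // negb_or gtnNdvd // IH // ltnW.
Qed.

(** Erdős's induction: the primes from [m + 2] to [2 m + 1] divide the middle binomial coefficient
    ['C(2 m + 1, m)], which is at most [4 ^ m]; an even index above 2 adds no prime. *)
Lemma primorial n : \prod_(0 <= q < n.+1 | prime q) q <= 4 ^ n.
Proof.
have [k] := ubnP n; elim: k n => // k IH n; rewrite ltnS => nk.
case: n nk => [|[|[|n]]] nk.
- by rewrite big_mkcond /= big_nat1.
- by rewrite big_mkcond /= !big_nat_recr //= big_nil.
- by rewrite big_mkcond /= !big_nat_recr //= big_nil.
case: (boolP (odd n)) => on.
  rewrite big_mkcond big_nat_recr //= -big_mkcond /= ifN.
    by rewrite muln1; apply: leq_trans (IH n.+2 nk) _; rewrite leq_exp2l.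
  by apply/negP => /even_prime[//|]; rewrite /= on.
pose m := (n./2).+1.
have nE : n.+3 = m.*2.+1 by rewrite /m doubleS -[in LHS](odd_double_half n) (negbTE on).
rewrite nE (big_cat_nat _ (n := m.+2)) //=; last by rewrite -addnn; lia.
have mk : m.+1 < k by move: nk nE; rewrite -addnn; lia.
apply: (@leq_trans (4 ^ m.+1 * 4 ^ m)); last by rewrite -expnD leq_exp2l // -addnn; lia.
apply: leq_mul; first exact: IH.
apply: leq_trans (central_bin_le m); apply: dvdn_leq; first by rewrite bin_gt0 -addnn; lia.
rewrite -big_filter; apply: prod_primes_dvd.
- by rewrite filter_uniq // iota_uniq.
- exact: filter_all.
apply/allP => q; rewrite mem_filter mem_index_iota => /and3P[pq q1 q2].
have : q %| (m.*2.+1)`! by apply: dvdn_fact; rewrite prime_gt0.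
have le : m <= m.*2.+1 by rewrite -addnn; lia.
rewrite -(bin_fact le) Euclid_dvdM // => /orP[//|].
rewrite Euclid_dvdM // => /orP[] h; move: h; apply: contraTT => _; apply: prime_ndvd_fact => //.
  by apply: leq_trans q1; rewrite ltnS ltnW.
by apply: leq_trans q1; rewrite -addnn; lia.
Qed.

Lemma count_mod (Q r B : nat) : 0 < Q -> \sum_(0 <= m < B) (m %% Q == r) <= (B %/ Q).+1.
Proof.
move=> Q0; rewrite -big_mkcond /= sum1_count.
rewrite -size_filter; set s := filter _ _.
have us : uniq s by rewrite filter_uniq // iota_uniq.
have : {in s &, injective (fun m => m %/ Q)}.
  move=> a b; rewrite !mem_filter => /andP[/eqP ea _] /andP[/eqP eb _] e.
  by rewrite (divn_eq a Q) (divn_eq b Q) ea eb e.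
move/map_inj_in_uniq => inj; rewrite -(size_map (fun m => m %/ Q)) -(size_iota 0 (B %/ Q).+1).
apply: uniq_leq_size; first by rewrite inj.
move=> x /mapP[m]; rewrite mem_filter mem_index_iota => /andP[_ /andP[_ mB]] ->.
by rewrite mem_iota ltnS leq_div2r // ltnW.
Qed.

Lemma dvd_sq5 d m : 2 < m -> (d %| m ^ 2 - 5) = (m ^ 2 == 5 %[mod d]).
Proof.
move=> m3; rewrite eqn_mod_dvd //; apply: leq_trans (_ : 3 ^ 2 <= _) => //.
by rewrite leq_exp2r.
Qed.

(* A square root of 5 modulo a prime power is unique up to sign. *)
Lemma roots_mod (q i : nat) : prime q -> 0 < i -> exists r1 r2, forall m, 2 < m ->
  q ^ i %| m ^ 2 - 5 -> (m %% q ^ i == r1) || (m %% q ^ i == r2).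
Proof.
move=> pq i0; set Q := q ^ i; have Q0 : 0 < Q by rewrite expn_gt0 prime_gt0.
have [q2|q2] := eqVneq q 2.
  exists 1, 3 => m m3; rewrite dvd_sq5 // /Q q2.
  case: i i0 {Q Q0} => [|[|[|i]]] // _.
  - by rewrite expn1 !modn2 oddX /=; case: (odd m).
  - rewrite -[2 ^ 2]/4 -modnXm; have := ltn_pmod m (isT : 0 < 4).
    by move: (m %% 4); do 4 (case=> //).
  move=> /eqP e; have : m ^ 2 = 5 %[mod 8].
    have d8 : 8 %| 2 ^ i.+3 by rewrite -[8]/(2 ^ 3) dvdn_exp2l.
    by rewrite -(modn_dvdm _ d8) e modn_dvdm.
  rewrite -modnXm; have := ltn_pmod m (isT : 0 < 8).
  by move: (m %% 8); do 8 (case=> //).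
have [q5|q5] := eqVneq q 5.
  exists 0, 0 => m m3; rewrite dvd_sq5 // orbb /Q q5.
  case: i i0 {Q Q0} => [|[|i]] // _.
    rewrite expn1 -modnXm; have := ltn_pmod m (isT : 0 < 5).
    by move: (m %% 5); do 5 (case=> //).
  move=> /eqP e; have : m ^ 2 = 5 %[mod 25].
    have d8 : 25 %| 5 ^ i.+2 by rewrite -[25]/(5 ^ 2) dvdn_exp2l.
    by rewrite -(modn_dvdm _ d8) e modn_dvdm.
  rewrite -modnXm; have := ltn_pmod m (isT : 0 < 25).
  by move: (m %% 25); do 25 (case=> //).
case: (boolP [exists r : 'I_Q, r ^ 2 == 5 %[mod Q]]) => [/existsP[r hr]|/existsPn no]; last first.
  exists 0, 0 => m m3; rewrite dvd_sq5 // => h.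
  by have := no (Ordinal (ltn_pmod m Q0)); rewrite /= modnXm h.
exists (nat_of_ord r), (Q - r) => m m3; rewrite dvd_sq5 // => hm.
have rQ : r < Q := ltn_ord r.
have h : (Posz Q %| ((Posz m - Posz r) * (Posz m + Posz r))%R)%Z.
  have -> : ((Posz m - Posz r) * (Posz m + Posz r) = Posz (m ^ 2) - Posz (r ^ 2))%R.
    by rewrite -!mulnn !PoszM; ring.
  by rewrite -eqz_mod_dvd !modz_nat eqz_nat (eqP hm) (eqP hr).
have nr : ~~ (q %| r).
  apply/negP => qr; have dq : q %| Q by rewrite dvdn_exp.
  have : q %| 5.
    have := hr; rewrite -(eqn_modDl 0) !add0n => /eqP e.
    have : 5 %% q = 0 by rewrite -(modn_dvdm _ dq) -e (modn_dvdm _ dq); apply/eqP; rewrite -/(dvdn _ _) expnS dvdn_mulr.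
    by move/eqP.
  by rewrite dvdn_prime2 // (negbTE q5).
have [d1|d1] := boolP (q %| absz (Posz m - Posz r)%R).
  have d2 : ~~ (q %| absz (Posz m + Posz r)%R).
    apply/negP => d2; have : (Posz q %| (2 * Posz r)%R)%Z.
      have -> : (2 * Posz r = (Posz m + Posz r) - (Posz m - Posz r))%R by ring.
      by apply: rpredB.
    rewrite dvdzE abszM /= Euclid_dvdM // (negbTE nr) orbF dvdn_prime2 //.
    by rewrite (negbTE q2).
  have : (Posz Q %| (Posz m - Posz r)%R)%Z.
    move: h; rewrite !dvdzE abszM Gauss_dvdl //.
    by apply: coprimeXl; rewrite prime_coprime.
  rewrite -eqz_mod_dvd !modz_nat eqz_nat (modn_small rQ) => ->.
  by [].
have : (Posz Q %| (Posz m + Posz r)%R)%Z.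
  move: h; rewrite !dvdzE abszM Gauss_dvdr //.
  by apply: coprimeXl; rewrite prime_coprime.
rewrite -PoszD dvdzE /= => d.
have r0 : 0 < r by rewrite lt0n; apply: contraNneq nr => ->; rewrite dvdn0.
apply/orP; right; have e : m = Q - r %[mod Q].
  by apply/eqP; rewrite -(eqn_modDr r) subnK ?(ltnW rQ) // modnn; exact: d.
by rewrite e modn_small // ltn_subLR ?(ltnW rQ) // -[X in X < _]add0n ltn_add2r.
Qed.

Lemma root_count q i B : prime q -> 0 < i ->
  \sum_(3 <= m < B) (q ^ i %| m ^ 2 - 5) <= 2 * (B %/ q ^ i).+1.
Proof.
move=> pq i0; have [r1 [r2 h]] := roots_mod pq i0.
have Q0 : 0 < q ^ i by rewrite expn_gt0 prime_gt0.
rewrite mul2n -addnn; apply: leq_trans (leq_add (count_mod r1 B Q0) (count_mod r2 B Q0)).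
rewrite -big_split /=; case: (leqP B 3) => B3; first by rewrite big_geq.
rewrite [leqRHS](big_cat_nat _ (n := 3)) //=; last exact: ltnW.
apply: leq_trans (leq_addl _ _); rewrite !big_seq; apply: leq_sum => m.
rewrite mem_index_iota => /andP[m3 _].
by case: (boolP (_ %| _)) => // /(h _ m3) /orP[] ->; rewrite ?leq_addr ?leq_addl.
Qed.

Lemma logn_sum q N X : prime q -> 0 < N <= X ->
  logn q N = \sum_(1 <= i < (trunc_log q X).+1) (q ^ i %| N).
Proof.
move=> pq /andP[N0 NX]; have q1 := prime_gt1 pq.
have le : logn q N <= trunc_log q X.
  by apply: trunc_log_max => //; apply: leq_trans NX; rewrite dvdn_leq // pfactor_dvdnn.
rewrite (eq_bigr (fun i => (i <= logn q N : nat))) => [|i _]; last by rewrite pfactor_dvdn.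
rewrite (big_cat_nat _ (n := (logn q N).+1)) //= [X in _ + X]big_nat_cond [X in _ + X]big1 ?addn0.
  rewrite big_nat_cond (eq_bigr (fun=> 1)) => [|i]; last by rewrite andbT ltnS => /andP[_ ->].
  by rewrite -big_nat_cond sum_nat_const_nat muln1 subn1.
by move=> i; rewrite andbT => /andP[h _]; rewrite leqNgt h.
Qed.

Local Open Scope ring_scope.

(** * Sums of logarithms over primes *)

Section Logs.
Variable R : realType.
Definition natln (n : nat) : R := ln n%:R.
Local Notation lg := natln.

Lemma lg_ge0 n : 0 <= lg n.
Proof. by case: n => [|n]; [rewrite /natln ln0 | rewrite /natln ln_ge0 // ler1n]. Qed.

Lemma lgM m n : (0 < m)%N -> (0 < n)%N -> lg (m * n) = lg m + lg n.
Proof. by move=> m0 n0; rewrite /natln natrM lnM // posrE ltr0n. Qed.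

Lemma lg1 : lg 1 = 0. Proof. exact: ln1. Qed.

Lemma lgX m k : (0 < m)%N -> lg (m ^ k) = k%:R * lg m.
Proof. by move=> m0; rewrite /natln natrX lnXn ?ltr0n // mulr_natl. Qed.

Lemma lg_le m n : (0 < m)%N -> (m <= n)%N -> lg m <= lg n.
Proof. by move=> m0 mn; rewrite /natln ler_ln ?posrE ?ltr0n ?ler_nat // (leq_trans m0). Qed.

Lemma lg_prod (I : Type) (s : seq I) (P : pred I) (F : I -> nat) :
  (forall i, P i -> (0 < F i)%N) -> lg (\prod_(i <- s | P i) F i)%N = \sum_(i <- s | P i) lg (F i).
Proof.
move=> h; suff [] : (0 < \prod_(i <- s | P i) F i)%N /\
  lg (\prod_(i <- s | P i) F i)%N = \sum_(i <- s | P i) lg (F i) by [].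
elim/big_rec2: _ => [|i x y Pi [y0 e]]; first by rewrite lg1.
by split; [rewrite muln_gt0 h | rewrite lgM ?h // e].
Qed.

Lemma lg_primes N X : (0 < N < X)%N ->
  lg N = \sum_(0 <= q < X | prime q) (logn q N)%:R * lg q.
Proof.
move=> /andP[N0 NX].
have e : N = (\prod_(0 <= q < X | prime q) q ^ logn q N)%N.
  rewrite -{1}(partnT N0) /partn [RHS](big_cat_nat _ (n := N.+1)) //=.
  rewrite [X in (_ * X)%N]big_nat_cond [X in (_ * X)%N]big1 ?muln1; last first.
    move=> q /andP[/andP[h _] pq]; rewrite lognE; case: and3P => // -[_ _ /(dvdn_leq N0)].
    by rewrite leqNgt h.
  rewrite [LHS](bigID prime) /= [X in (_ * X)%N]big1 ?muln1 // => q /negbTE pq.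
  by rewrite lognE pq.
rewrite [in LHS]e lg_prod => [|q /prime_gt0 q0]; last by rewrite expn_gt0 q0.
by apply: eq_bigr => q /prime_gt0 q0; rewrite lgX.
Qed.

Lemma lg_fact_ge k : k%:R * lg k - k%:R <= lg k`!.
Proof.
elim: k => [|k IH]; first by rewrite mul0r subr0 lg1.
rewrite factS lgM ?fact_gt0 //.
have [->|k0] := posnP k; first by rewrite lg1 /=; lra.
have h : lg k.+1 - lg k <= k%:R^-1.
  have kp : 0 < k%:R :> R by rewrite ltr0n.
  rewrite /natln -ln_div ?posrE ?ltr0n // -natr1 mulrDl divff ?gt_eqF // div1r.
  by apply: le_ln1Dx; apply: lt_le_trans (_ : 0 <= _); rewrite ?invr_ge0 ?ltW //; lra.
have {}h : k%:R * lg k.+1 - k%:R * lg k <= 1.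
  rewrite -mulrBr; apply: le_trans (ler_wpM2l (ler0n _ _) h) _.
  by rewrite mulfV // pnatr_eq0 -lt0n.
by move: IH h; rewrite -natr1; nra.
Qed.

Lemma lg_fact_le k : lg k`! <= k%:R * lg k.
Proof.
elim: k => [|k IH]; first by rewrite mul0r lg1.
rewrite factS lgM ?fact_gt0 //; have [->|k0] := posnP k; first by rewrite lg1; lra.
have : k%:R * lg k <= k%:R * lg k.+1 by rewrite ler_wpM2l // lg_le.
by rewrite -natr1; lra.
Qed.

(* Mertens' first theorem, from Legendre's formula and the primorial bound. *)
Lemma mertens Z : (0 < Z)%N ->
  \sum_(0 <= q < Z.+1 | prime q) lg q / q%:R <= lg Z + lg 4.
Proof.
move=> Z0; have Zp : 0 < Z%:R :> R by rewrite ltr0n.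
rewrite -(ler_pM2l Zp) mulr_sumr mulrDr.
apply: (@le_trans _ _ (\sum_(0 <= q < Z.+1 | prime q) ((Z %/ q)%:R + 1) * lg q)).
  apply: ler_sum => q /prime_gt0 q0; rewrite mulrCA mulrC ler_wpM2r ?lg_ge0 //.
  rewrite ler_pdivrMr ?ltr0n // natr1 -natrM ler_nat ltnW //.
  by rewrite -ltn_divLR.
under eq_bigr do rewrite mulrDl mul1r; rewrite big_split /=; apply: lerD.
  apply: le_trans (lg_fact_le Z).
  rewrite (@lg_primes Z`! (maxn Z`!.+1 Z.+1)) ?fact_gt0 ?leq_maxl //.
  rewrite [leRHS](big_cat_nat _ (n := Z.+1)) ?leq_maxr //=.
  rewrite -[leLHS]addr0; apply: lerD; last first.
    by apply: sumr_ge0 => q _; rewrite mulr_ge0 // lg_ge0.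
  apply: ler_sum => q pq; rewrite ler_wpM2r ?lg_ge0 // ler_nat logn_fact //.
  by rewrite big_ltn // expn1 leq_addr.
rewrite -lgX // -lg_prod => [|q /prime_gt0 //]; apply: lg_le; last exact: primorial.
by apply: prodn_cond_gt0 => q /prime_gt0.
Qed.

(** Comparison with a telescoping sum: [g Y - g (Y + 1)] is at least the term at [Y], prime or not,
    and [g 2 = 1 + ln 2]. *)
Lemma lg_tail Z : \sum_(0 <= q < Z.+1 | prime q) lg q / (q%:R * (q%:R - 1)) <= 1 + lg 2.
Proof.
pose g (n : nat) : R := (1 + lg n) / (n%:R - 1).
have key Y : (2 <= Y)%N -> \sum_(0 <= q < Y | prime q) lg q / (q%:R * (q%:R - 1)) <= g 2 - g Y.
  elim: Y => // Y IH; rewrite leq_eqVlt => /orP[/eqP [<-]|Y2].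
    by rewrite subrr big_mkcond /= !big_nat_recr //= big_nil; lra.
  rewrite ltnS in Y2; rewrite big_mkcond big_nat_recr //= -big_mkcond /=.
  have {}IH := IH Y2.
  have Yp : 0 < Y%:R :> R by rewrite ltr0n; lia.
  have Y1 : 0 < Y%:R - 1 :> R by rewrite subr_gt0 ltr1n.
  suff : lg Y / (Y%:R * (Y%:R - 1)) <= g Y - g Y.+1.
    have : 0 <= lg Y / (Y%:R * (Y%:R - 1)) by rewrite divr_ge0 ?lg_ge0 // mulr_ge0 // ltW.
    by move: IH; case: ifP => _; lra.
  have h : lg Y.+1 <= lg Y + Y%:R^-1.
    have : lg Y.+1 - lg Y <= Y%:R^-1.
      rewrite /natln -ln_div ?posrE ?ltr0n //; last by lia.
      rewrite -natr1 mulrDl divff ?gt_eqF // div1r.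
      by apply: le_ln1Dx; apply: lt_le_trans (_ : 0 <= _); rewrite ?invr_ge0 ?ltW //; lra.
    lra.
  rewrite /g -natr1 addrK -subr_ge0.
  have -> : (1 + lg Y) / (Y%:R - 1) - (1 + lg Y.+1) / Y%:R - lg Y / (Y%:R * (Y%:R - 1)) =
     (1 + (Y%:R - 1) * (lg Y - lg Y.+1)) / (Y%:R * (Y%:R - 1)).
    by field; rewrite !gt_eqF.
  apply: divr_ge0; last by rewrite mulr_ge0 // ltW.
  have : (Y%:R - 1) * (lg Y.+1 - lg Y) <= (Y%:R - 1) * Y%:R^-1 by apply: ler_wpM2l; [exact: ltW | lra].
  have : (Y%:R - 1) * Y%:R^-1 <= 1 :> R by rewrite ler_pdivrMr // mul1r; lra.
  by nra.
case: (leqP 2 Z.+1) => h.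
  apply: le_trans (key _ h) _.
  have -> : g 2 = 1 + lg 2 by rewrite /g (_ : 2%:R - 1 = 1 :> R) ?divr1 //; ring.
  have : 0 <= g Z.+1 by apply: divr_ge0; [rewrite addr_ge0 ?lg_ge0 | rewrite subr_ge0 ler1n].
  by lra.
case: Z h => // _; rewrite big_mkcond /= big_nat1 /=.
by rewrite addr_ge0 // lg_ge0.
Qed.
End Logs.

Section Supply.
Variable R : realType.
Local Notation lg := (@natln R).

Lemma expR_dbl (x : R) : expR (2 * x) = expR x * expR x.
Proof. by rewrite -expRD; congr expR; lra. Qed.

Lemma expR_dbl_le (x c d : R) : expR x <= c -> c * c <= d -> expR (2 * x) <= d.
Proof. by move=> h; apply: le_trans; rewrite expR_dbl; have := expR_ge0 x; nra. Qed.

Lemma expR_dbl_ge (x c d : R) : 0 <= c -> c <= expR x -> d <= c * c -> d <= expR (2 * x).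
Proof. by move=> c0 h /le_trans; apply; rewrite expR_dbl; nra. Qed.

(** [exp (1/64) <= 64/63] follows from [exp (- x) >= 1 - x] and is squared six times, with
    rounding. *)
Lemma expR1_le : expR (1 : R) <= 2748 / 1000.
Proof.
have h : expR (1 / 64 : R) <= 64 / 63.
  have := expR_ge1Dx (- (1 / 64) : R); rewrite expRN => h.
  have e0 := expR_gt0 (1 / 64 : R); rewrite -[leLHS]invrK -[leRHS]invrK lef_pV2 ?posrE ?invr_gt0 //; lra.
have h1 : expR (2 * (1 / 64) : R) <= 4096 / 3969 by apply: (expR_dbl_le h); lra.
have h2 : expR (2 * (2 * (1 / 64)) : R) <= 4793 / 4500 by apply: (expR_dbl_le h1); lra.
have h3 : expR (2 * (2 * (2 * (1 / 64))) : R) <= 4538 / 4000 by apply: (expR_dbl_le h2); lra.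
have h4 : expR (2 * (2 * (2 * (2 * (1 / 64)))) : R) <= 4506 / 3500 by apply: (expR_dbl_le h3); lra.
have h5 : expR (2 * (2 * (2 * (2 * (2 * (1 / 64))))) : R) <= 4144 / 2500 by apply: (expR_dbl_le h4); lra.
have -> : (1 : R) = 2 * (2 * (2 * (2 * (2 * (2 * (1 / 64)))))) by lra.
by apply: (expR_dbl_le h5); lra.
Qed.

Lemma lg2_le : lg 2 <= 72 / 100.
Proof.
rewrite /natln -[leRHS]expRK ler_ln ?posrE ?expR_gt0 ?ltr0n //.
have h := expR_ge1Dx (72 / 100 / 16 : R).
have h1 : 1092 / 1000 <= expR (2 * (72 / 100 / 16) : R) by apply: (expR_dbl_ge _ h); lra.
have h2 : 1192 / 1000 <= expR (2 * (2 * (72 / 100 / 16)) : R) by apply: (expR_dbl_ge _ h1); lra.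
have h3 : 142 / 100 <= expR (2 * (2 * (2 * (72 / 100 / 16))) : R) by apply: (expR_dbl_ge _ h2); lra.
have -> : (72 / 100 : R) = 2 * (2 * (2 * (2 * (72 / 100 / 16)))) by lra.
by apply: (expR_dbl_ge _ h3); lra.
Qed.

Lemma lg297_ge y : (297 <= y)%N -> 11 / 2 <= lg y.
Proof.
move=> y1; apply: (@le_trans _ _ (lg 297)); last exact: lg_le.
have : 11 <= lg (297 ^ 2).
  have e0 := expR_ge0 (1 : R); have e1 := expR1_le.
  have e2 : expR (2 * 1 : R) <= 756 / 100 by apply: (expR_dbl_le e1); lra.
  have e4 : expR (2 * (2 * 1) : R) <= 572 / 10 by apply: (expR_dbl_le e2); lra.
  have e8 : expR (2 * (2 * (2 * 1)) : R) <= 3272 by apply: (expR_dbl_le e4); lra.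
  rewrite /natln -[leLHS]expRK ler_ln ?posrE ?expR_gt0 ?ltr0n ?expn_gt0 // natrX.
  have -> : (11 : R) = 2 * (2 * (2 * 1)) + (2 * 1 + 1) by lra.
  rewrite !expRD; have p2 := expR_ge0 (2 * 1 : R); have p8 := expR_ge0 (2 * (2 * (2 * 1)) : R).
  apply: (@le_trans _ _ (3272 * (756 / 100 * (2748 / 1000)))); last by rewrite expr2; lra.
  by apply: ler_pM => //; [rewrite mulr_ge0 | apply: ler_pM].
by rewrite lgX //; lra.
Qed.

Lemma geom_le (x : R) k : 1 < x -> \sum_(1 <= i < k.+1) (x ^+ i)^-1 <= (x - 1)^-1.
Proof.
move=> x1; have xp : 0 < x - 1 by rewrite subr_gt0.
have x0 : 0 < x by apply: lt_trans x1.
rewrite -(ler_pM2l xp) mulfV ?gt_eqF //.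
suff -> : (x - 1) * \sum_(1 <= i < k.+1) (x ^+ i)^-1 = 1 - (x ^+ k)^-1.
  by rewrite lerBlDr lerDl invr_ge0 exprn_ge0 // ltW.
elim: k => [|k IH]; first by rewrite big_geq // mulr0 expr0 invr1 subrr.
have xn : x != 0 by rewrite gt_eqF.
have xk : x ^+ k != 0 by rewrite expf_neq0.
by rewrite big_nat_recr //= mulrDr IH exprS; field; rewrite ?xn ?xk.
Qed.

(** * Prime factors of the values m^2 - 5 *)

Section Count.
Variables (B X : nat).
Hypotheses (B3 : (3 <= B)%N) (BX : (B ^ 2 <= X)%N).

Definition hsum q := (\sum_(3 <= m < B) logn q (m ^ 2 - 5))%N.

Lemma sq5_bd m : (2 < m < B)%N -> (0 < m ^ 2 - 5 < X)%N.
Proof.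
move=> /andP[m3 mB]; rewrite subn_gt0 (leq_trans (_ : 5 < 3 ^ 2)%N) ?leq_exp2r //=.
by apply: leq_ltn_trans (leq_subr _ _) _; apply: leq_trans BX; rewrite ltn_exp2r.
Qed.

Lemma sum_lg_sq5 : \sum_(3 <= m < B) lg (m ^ 2 - 5) =
  \sum_(0 <= q < X | prime q) (hsum q)%:R * lg q.
Proof.
rewrite big_nat_cond (eq_bigr (fun m => \sum_(0 <= q < X | prime q) (logn q (m ^ 2 - 5))%:R * lg q)).
  rewrite -big_nat_cond exchange_big /=; apply: eq_bigr => q _.
  by rewrite /hsum natr_sum mulr_suml.
by move=> m; rewrite andbT => /sq5_bd h; exact: lg_primes.
Qed.

Lemma hsum_le q : prime q ->
  (hsum q <= \sum_(1 <= i < (trunc_log q X).+1) 2 * (B %/ q ^ i).+1)%N.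
Proof.
move=> pq; rewrite /hsum big_nat_cond.
rewrite (eq_bigr (fun m => \sum_(1 <= i < (trunc_log q X).+1) (q ^ i %| m ^ 2 - 5))%N); last first.
  move=> m; rewrite andbT => /sq5_bd /andP[h1 h2]; apply: logn_sum => //.
  by rewrite h1 ltnW.
rewrite -big_nat_cond exchange_big /= !big_seq; apply: leq_sum => i.
by rewrite mem_index_iota => /andP[i0 _]; exact: root_count.
Qed.

Let X0 : (0 < X)%N. Proof. by apply: leq_trans BX; rewrite expn_gt0 (leq_trans _ B3). Qed.

Lemma trunc_lg q : prime q -> (trunc_log q X)%:R * lg q <= lg X.
Proof.
move=> pq; rewrite -lgX ?prime_gt0 //; apply: lg_le; first by rewrite expn_gt0 prime_gt0.
by apply: trunc_logP => //; exact: prime_gt1.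
Qed.

(** At most two roots modulo [q ^ i] give at most [2 (B / q ^ i + 1)] values divisible by [q ^ i].
    The geometric series yields the first term; the second collects the rounding over all [i] with
    [q ^ i <= X]. *)
Lemma hsum_small q : prime q ->
  (hsum q)%:R * lg q <= 2 * B%:R * (lg q / (q%:R - 1)) + 2 * lg X.
Proof.
move=> pq; have q1 : 1 < q%:R :> R by rewrite ltr1n prime_gt1.
have q0 : 0 < q%:R :> R by apply: lt_trans q1.
apply: (@le_trans _ _ ((2 * B%:R * (q%:R - 1)^-1 + 2 * (trunc_log q X)%:R) * lg q)); last first.
  have := trunc_lg pq; set t := _ * lg q; rewrite mulrDl -!mulrA -/t [_^-1 * _]mulrC; lra.
rewrite ler_wpM2r ?lg_ge0 //; have := hsum_le pq; rewrite -(ler_nat R) => /le_trans; apply.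
rewrite natr_sum; apply: (@le_trans _ _
    (\sum_(1 <= i < (trunc_log q X).+1) (2 * B%:R * (q%:R ^+ i)^-1 + 2))).
  apply: ler_sum => i _; rewrite natrM -[(_ %/ _).+1%:R]natr1 mulrDr mulr1 lerD2r -mulrA ler_wpM2l //.
  by rewrite ler_pdivlMr ?exprn_gt0 // -natrX -natrM ler_nat leq_trunc_div.
rewrite big_split /= -mulr_sumr; apply: lerD.
  by rewrite ler_wpM2l ?mulr_ge0 //; exact: geom_le.
by rewrite sumr_const_nat subn1 /= mulr_natr.
Qed.

Lemma hsum_large q y : prime q -> (B %/ q <= y)%N ->
  (hsum q)%:R * lg q <= 2 * (y.+1)%:R * lg X.
Proof.
move=> pq qy; apply: (@le_trans _ _ ((2 * (y.+1)%:R * (trunc_log q X)%:R) * lg q)); last first.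
  by rewrite -mulrA; apply: ler_wpM2l; [rewrite mulr_ge0 | exact: trunc_lg].
rewrite ler_wpM2r ?lg_ge0 // -!natrM ler_nat; apply: leq_trans (hsum_le pq) _.
apply: (@leq_trans (\sum_(1 <= i < (trunc_log q X).+1) 2 * y.+1)%N).
  rewrite !big_seq; apply: leq_sum => i; rewrite mem_index_iota => /andP[i0 _].
  rewrite leq_mul2l /= ltnS; apply: leq_trans qy; apply: leq_div2l; first exact: prime_gt0.
  by case: i i0 => // i _; rewrite expnS leq_pmulr // expn_gt0 prime_gt0.
by rewrite sum_nat_const_nat subn1 mulnC.
Qed.

(** For [m >= 3], [m ^ 2 - 5 >= (m - 1) ^ 2], so the product of the values is at least the square of
    a factorial. *)
Lemma sum_lg_ge : 2 * (B%:R * lg B - B%:R) - 4 * lg B <= \sum_(3 <= m < B) lg (m ^ 2 - 5).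
Proof.
have h k : 2 * lg (k.+1)`! <= \sum_(3 <= m < k.+3) lg (m ^ 2 - 5).
  elim: k => [|k IH]; first by rewrite big_geq // lg1 mulr0.
  rewrite big_nat_recr //= factS lgM ?fact_gt0 // mulrDr addrC lerD //.
  have -> : 2 * lg k.+2 = lg (k.+2 ^ 2) by rewrite lgX.
  apply: lg_le; first by rewrite expn_gt0.
  by rewrite leq_subRL; [rewrite !expnS !expn0; nia | rewrite !expnS !expn0; nia].
have [k e] : exists k, B = k.+3 by exists (B - 3)%N; rewrite -[LHS](subnKC B3).
have := lg_fact_ge R B; have := h k; rewrite -e; move: (\sum_(_ <= _ < _) _) => S hS.
have -> : lg B`! = lg B + lg k.+2 + lg k.+1`!.
  by rewrite e !factS !lgM ?muln_gt0 ?fact_gt0 // addrA.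
have : lg k.+2 <= lg B by rewrite e; exact: lg_le.
lra.
Qed.

End Count.
(** Chebyshev's comparison for [B = Y ^ 4]: to leading order the product of the values [m ^ 2 - 5]
    has logarithm [8 Y ^ 4 L], of which the primes up to [Y ^ 3] account for only [6 Y ^ 4 L]. The
    [W] larger primes give at most [16 (Y + 1) L] each, so [W] cannot be below [6 (Y + 1) ^ 2]. *)
Lemma supply_numeric (Y L W l2 l4 lZ : R) : 297 <= Y -> 11 / 2 <= L -> 0 <= W ->
  W < 6 * (Y + 1) ^+ 2 -> l2 <= 72 / 100 -> l4 = 2 * l2 -> lZ = 3 * L ->
  2 * (Y ^+ 4 * (4 * L) - Y ^+ 4) - 4 * (4 * L) <=
    2 * Y ^+ 4 * (lZ + l4 + (1 + l2)) + (Y ^+ 3 + 1) * (2 * (8 * L)) + W * (2 * (Y + 1) * (8 * L)) ->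
  False.
Proof.
move=> Y0 L0 W0 Wlt h2 -> -> h.
have Y3 : 0 <= Y ^+ 3 by rewrite exprn_ge0 //; lra.
have c1 : (Y + 1) ^+ 3 <= 102 / 100 * Y ^+ 3.
  apply: (@le_trans _ _ ((298 / 297 * Y) ^+ 3)); first by rewrite lerXn2r ?nnegrE; lra.
  rewrite exprMn ler_wpM2r //.
  have : (298 / 297) ^+ 2 <= 101 / 100 :> R by rewrite expr2; lra.
  by rewrite exprS; lra.
have y31 : Y <= Y ^+ 3.
  rewrite exprS -[leLHS]mulr1 ler_wpM2l //; first by lra.
  by rewrite exprn_ege1 //; lra.
have c2 : W * (Y + 1) <= 6 * (Y + 1) ^+ 3.
  have : W * (Y + 1) <= 6 * (Y + 1) ^+ 2 * (Y + 1) by rewrite ler_wpM2r //; lra.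
  by rewrite -mulrA -exprSr.
have e4 : Y ^+ 4 = Y * Y ^+ 3 by rewrite exprS.
have e5 : W * (2 * (Y + 1) * (8 * L)) = 16 * (L * (W * (Y + 1))) by ring.
rewrite e4 e5 in h; move: Y3 c1 c2 y31 h.
move: (Y ^+ 3) (W * (Y + 1)) ((Y + 1) ^+ 3) => y3 wy y13 y30 c1 c2 y31 h.
have P0 : 297 * y3 <= Y * y3 by rewrite ler_wpM2r.
move: h P0; move: (Y * y3) => P h P0.
have Lp : 0 < L by lra.
have P1 : 0 <= P by apply: le_trans P0; rewrite mulr_ge0 //; lra.
have Pl : P * l2 <= 72 / 100 * P by rewrite mulrC ler_wpM2r.
(* The terms without [L] add up to [(4 + 6 * 0.72) P = 2 * 4.16 P]; for [L >= 5.5] at least 24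
   percent of the surplus [2 P L] remains. *)
have PL : P * (24 / 100 * L) <= P * (L - 416 / 100) by rewrite ler_wpM2l //; lra.
have {}PL : 24 / 100 * (P * L) <= P * L - 416 / 100 * P by rewrite mulrCA mulrBr (mulrC P (416 / 100)) in PL.
have wyb : wy <= 612 / 100 * y3 by lra.
have Lwy : L * wy <= 612 / 100 * (L * y3) by rewrite mulrCA ler_wpM2l // ltW.
have LP : 297 * (L * y3) <= P * L by rewrite mulrCA mulrC ler_wpM2r // ltW.
have Ly : 297 * L <= L * y3 by rewrite mulrC; apply: ler_wpM2l; [exact: ltW | lra].
have E1 : 2 * (P * (4 * L) - P) - 4 * (4 * L) = 8 * (P * L) - 2 * P - 16 * L by ring.
have E2 : 2 * P * (3 * L + 2 * l2 + (1 + l2)) + (y3 + 1) * (2 * (8 * L)) + 16 * (L * wy) =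
  6 * (P * L) + 6 * (P * l2) + 2 * P + 16 * (L * y3) + 16 * L + 16 * (L * wy) by ring.
rewrite E1 E2 in h; move: h Pl PL Lwy LP Ly {E1 E2}.
move: (P * L) (P * l2) (L * y3) (L * wy) => a b c' e; lra.
Qed.

End Supply.

Section Supply.
Variable R : realType.
Local Notation lg := (@natln R).

Lemma split_primes y : (297 <= y)%N -> exists W : seq nat, [/\ uniq W,
  (6 * y.+1 ^ 2 <= size W)%N & forall q, q \in W -> [/\ prime q, (y ^ 3 < q)%N &
    exists2 m, (2 < m < y ^ 4)%N & (q %| m ^ 2 - 5)%N]].
Proof.
move=> y297; pose B := (y ^ 4)%N; pose X := (B ^ 2)%N; pose Z := (y ^ 3)%N.
have y0 : (0 < y)%N by apply: leq_trans y297.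
have B3 : (3 <= B)%N.
  by apply: (@leq_trans y); [apply: leq_trans y297 | rewrite /B -{1}(expn1 y) leq_pexp2l].
pose W := [seq q <- index_iota 0 X | prime q && (Z < q)%N && (0 < hsum B q)%N].
exists W; split.
- by rewrite filter_uniq // iota_uniq.
- rewrite leqNgt; apply/negP => Wsz.
  have L0 := lg297_ge R y297.
  have lgB : lg B = 4 * lg y by rewrite lgX.
  have lgXE : lg X = 8 * lg y by rewrite lgX ?expn_gt0 ?y0 // lgB; lra.
  have lgZ : lg Z = 3 * lg y by rewrite lgX.
  have l4 : lg 4 = 2 * lg 2 by rewrite -[4%N]/(2 ^ 2)%N lgX.
  apply: (@supply_numeric R y%:R (lg y) (size W)%:R (lg 2) (lg 4) (lg Z)) => //.
  + by rewrite ler_nat.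
  + by rewrite natr1 -natrX -natrM ltr_nat.
  + exact: (lg2_le R).
  have := sum_lg_ge R B3 (leqnn X); rewrite lgB -[B%:R]/((y ^ 4)%:R) natrX => /le_trans; apply.
  rewrite (sum_lg_sq5 R (leqnn X)).
  have ZX : (Z.+1 <= X)%N.
    rewrite /X /B /Z -expnM; apply: (@leq_trans (y ^ 4)); last by rewrite leq_pexp2l.
    by rewrite (expnS y 3) -[X in (X < _)%N]mul1n ltn_pmul2r ?expn_gt0 ?y0 // (leq_trans _ y297).
  rewrite (big_cat_nat _ (n := Z.+1)) //=; apply: lerD.
    apply: (@le_trans _ _ (\sum_(0 <= q < Z.+1 | prime q)
        (2 * B%:R * (lg q / q%:R + lg q / (q%:R * (q%:R - 1))) + 2 * lg X))).
      apply: ler_sum => q pq; apply: le_trans (hsum_small R B3 (leqnn X) pq) _.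
      rewrite lerD2r ler_wpM2l ?mulr_ge0 // le_eqVlt; apply/orP; left; apply/eqP.
      have q1 : q%:R - 1 != 0 :> R by rewrite subr_eq0 -[1]/(1%:R) eqr_nat neq_ltn prime_gt1 ?orbT.
      have q0 : q%:R != 0 :> R by rewrite pnatr_eq0 -lt0n prime_gt0.
      by field; rewrite ?q0 ?q1.
    rewrite big_split /= -mulr_sumr big_split /=; apply: lerD.
      rewrite /B natrX ler_wpM2l ?mulr_ge0 ?exprn_ge0 //; apply: lerD; last exact: lg_tail.
      by apply: mertens; rewrite expn_gt0 y0.
    rewrite big_const_seq iter_addr_0 -[leLHS]mulr_natl lgXE ler_wpM2r //; first by lra.
    rewrite /Z -natrX natr1 ler_nat; apply: leq_trans (count_size _ _) _.
    by rewrite size_iota subn0.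
  apply: (@le_trans _ _ (\sum_(q <- W) 2 * (y%:R + 1) * (8 * lg y))); last first.
    by rewrite big_const_seq iter_addr_0 count_predT [leRHS]mulr_natl.
  have tp : 0 <= 2 * (y%:R + 1) * (8 * lg y).
    by rewrite mulr_ge0 ?mulr_ge0 ?addr_ge0 ?lg_ge0.
  rewrite /W big_filter [leRHS](big_cat_nat _ (n := Z.+1)) //= -[leLHS]add0r; apply: lerD.
    exact: sumr_ge0.
  rewrite [leLHS]big_mkcond [leRHS]big_mkcond /= [leLHS]big_seq [leRHS]big_seq; apply: ler_sum => q; rewrite mem_index_iota => /andP[zq qX].
  rewrite zq andbT; case: ifP => pq //=.
  have [->|h0] := posnP (hsum B q); first by rewrite mul0r.
  rewrite -lgXE natr1; apply: (hsum_large R B3 (leqnn X)) => //.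
  apply: (@leq_trans (B %/ Z)); first by apply: leq_div2l; [rewrite expn_gt0 y0 | exact: ltnW].
  by rewrite /B /Z expnS mulnK // expn_gt0 y0.
move=> q; rewrite mem_filter => /andP[/andP[/andP[pq zq] h0] _]; split=> //.
have : has (fun m => 0 < logn q (m ^ 2 - 5))%N (index_iota 3 B).
  apply: contraTT h0 => /hasPn no; rewrite -leqNgt leqn0; apply/eqP.
  by rewrite /hsum big_seq big1 // => m /no; rewrite -leqNgt leqn0 => /eqP.
case/hasP => m; rewrite mem_index_iota => /andP[m1 m2]; rewrite logn_gt0 mem_primes.
by move=> /and3P[_ _ qm]; exists m => //; rewrite m1 m2.
Qed.

End Supply.

Local Close Scope ring_scope.

(** * Choice of parameters *)

Definition good_family (r sg : nat) (xi : 'I_r -> A5) (q : 'I_r -> nat) : Prop :=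
  [/\ forall j, prime (q j), forall j, q j != 5,
      forall j, logn (q j) (absz (qnorm (xi j))) = 1,
      forall j j', j != j' -> ~~ (q j %| absz (qnorm (xi j'))) &
      forall j, a5size (xi j) <= sg].

Lemma good_family_ex (R : realType) (y r : nat) : 297 <= y -> r <= 6 * y.+1 ^ 2 ->
  exists xi q, @good_family r (4 * y ^ 4) xi q.
Proof.
move=> y1 ry; have [W [uW sW hW]] := split_primes R y1.
have iW (j : 'I_r) : j < size W by apply: leq_trans sW; apply: leq_trans ry.
pose q (j : 'I_r) := nth 0 W j.
have qW j : q j \in W by exact: mem_nth.
have q5 j : 5 < q j.
  have [_ h _] := hW _ (qW j); apply: leq_trans h; apply: leq_trans (_ : 6 <= y) _.
    by apply: leq_trans y1.
  by apply: leqW; rewrite expnS leq_pmulr // expn_gt0 (leq_trans _ y1).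
have qp j : prime (q j) by have [] := hW _ (qW j).
have [xi hxi] : exists xi : 'I_r -> A5, forall j, [/\ logn (q j) (absz (qnorm (xi j))) = 1,
    forall q', prime q' -> 5 < q' -> q' != q j -> ~~ (q' %| absz (qnorm (xi j))) &
    a5size (xi j) <= 4 * y ^ 4].
  apply: (@fin_all_exists 'I_r (fun=> A5) (fun j x => [/\ logn (q j) (absz (qnorm x)) = 1,
    forall q', prime q' -> 5 < q' -> q' != q j -> ~~ (q' %| absz (qnorm x)) &
    a5size x <= 4 * y ^ 4])) => j.
  have [_ _ [m /andP[m3 my] qm]] := hW _ (qW j).
  have m5 : 5 < m ^ 2 by apply: (@leq_trans (3 ^ 2)) => //; rewrite leq_exp2r.
  have dq : (Posz (q j) %| (Posz m ^+ 2 - 5)%R)%Z.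
    have -> : (Posz m ^+ 2 - 5 = Posz (m ^ 2 - 5))%R.
      by rewrite -subzn ?(ltnW m5) // -mulnn PoszM expr2.
    exact: qm.
  have m0 : 0 < m by apply: ltn_trans m3.
  have [x [h1 h2 h3]] := thue (qp j) (q5 j) m0 dq; exists x; split=> //.
  apply: h3; apply: leq_trans (dvdn_leq _ qm) _; first by rewrite subn_gt0.
  by apply: leq_trans (leq_subr _ _) _; rewrite leq_exp2r // ltnW.
exists xi, q; split=> //.
- by move=> j; rewrite gtn_eqF.
- by move=> j; have [] := hxi j.
- move=> j j' jj; have [_ h _] := hxi j'; apply: h => //.
  by rewrite nth_uniq.
by move=> j; have [] := hxi j.
Qed.

Section CoreBound.
Variables (r sg k d n M : nat) (xi : 'I_r -> A5) (q : 'I_r -> nat).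
Hypothesis xiP : good_family sg xi q.
Hypotheses (r0 : 0 < r) (d0 : 0 < d) (sg0 : 0 < sg).
Let A := 17 ^ k.+1 * d.
Let cI := (34 ^ k.+1 * d) ^ r * A.
(** As [15 = 32 - 17], these increments give [Tm m = (r + 1) * 32 ^ m * 17 ^ (k + 1 - m) * d].
    Downwards the order is multiplied by 17/32 and the exponent range by 1/2, ending at
    [(r + 1) * A] against a total degree of at most [r * (A - 1)]. *)
Let dl m := 15 * 32 ^ m.-1 * 17 ^ (k.+1 - m) * d.
Hypothesis (ME : M = (2 ^ r).+1 * (15 * 32 ^ k * d)).
Variable p : nat.
Hypotheses (p_prim : primitive_divisor p n) (n6 : 6 < n) (Mp : M <= p)
  (sgp : sg ^ 2 < p) (pn : ~~ (p %| n)) (An : 6 * 2 ^ k * A < n) (rp : 4 * 2 ^ r < p).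
Hypothesis dlC : forall m, m <= k ->
  cI * 2 ^ (d * r) * 2 ^ (r * (2 ^ m.+1 * A)) * (21 ^ (2 * (2 ^ m * A)) * sg ^ (r * (2 ^ m.+1 * A)))
   < p ^ dl m.+1.
Hypothesis cI_le : cI.+1 <= 2 ^ (d * r).
Let N0 := 32 ^ k.+1 * d.
Hypothesis count : (34 ^ k.+1 + 2) * (2 ^ k.+1 * p.+1) * N0.+1 ^ (r + r.+1 * N0) <=
  cI * N0 ^ (r.+1 * N0).

Lemma prim_valuation : logn p (fib n) < M.
Proof.
have [q_pr q5 qN qN' xisg] := xiP.
have p_pr : prime p by case/and3P: p_prim.
have pF : p %| fib n by case/and3P: p_prim.
have A0 : 0 < A by rewrite muln_gt0 expn_gt0 d0.
have p5 : 5 < p.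
  by apply: leq_trans rp; apply: leqW; rewrite -[6]/(4 * 1 + 2) (leq_trans (_ : _ <= 4 * 2 ^ 1)) // leq_mul2l leq_exp2l.
have op : odd p by case: (even_prime p_pr) => // p2; move: p5; rewrite p2.
have M1 : 1 < M.
  rewrite ME; apply: (@leq_trans ((2 ^ r).+1 * 1)); first by rewrite muln1 ltnS expn_gt0.
  by rewrite leq_mul2l !muln_gt0 !expn_gt0 d0.
rewrite ltnNge; apply/negP => hM.
have pM : p ^ M %| absz (fund ^+ n)%R.2.
  rewrite -fund_pow_dvd ?oddX ?op ?orbT //.
  apply: dvdn_trans (fib_dvd (dvdn_mull 6 (dvdnn n))).
  by rewrite pfactor_dvdn ?fib_gt0 // (leq_trans _ n6).
pose Tm m := r.+1 * A + \sum_(1 <= i < m.+1) r.+1 * dl i.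
have TmE m : m <= k.+1 -> Tm m = r.+1 * (32 ^ m * 17 ^ (k.+1 - m) * d).
  elim: m => [_|m IH mk]; first by rewrite /Tm big_geq // addn0 subn0 mul1n.
  rewrite /Tm big_nat_recr //= addnA -/(Tm m) IH ?(ltnW mk) // -mulnDr /dl /=.
  rewrite subSn // expnS [in RHS]expnS; congr (_ * _).
  by rewrite subSS; ring.
have e2A : 2 ^ k.+1 * A = 34 ^ k.+1 * d by rewrite /A mulnA -expnMn.
have cIE : (2 ^ k.+1 * A) ^ r * A = cI by rewrite /cI e2A.
have LE m : (2 ^ m.+1 * A).-1 <= 2 ^ m.+1 * A by exact: leq_pred.
have pn' : p ^ M %| absz (fund ^+ n)%R.2 = false.
  (* [21 = 9 + 3 * 4] is the size of [fund], and [2 ^ (d * r)] bounds the weights. *)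
  apply/negbTE; apply: (@valuation_bound 'I_r xi fund q q_pr q5 qN qN' fund_norm p M n p_pr p5 M1 Mp
    _ pn k N0 (2 ^ (d * r)) sg 21 A A dl Tm) => //.
  - move=> j; have N0' : 0 < absz (qnorm (xi j)).
      by move: (qN j); case: (absz _) => //; rewrite logn0.
    rewrite gtnNdvd //; apply: leq_ltn_trans sgp; apply: leq_trans (NK xi j) _.
    exact: leq_expl.
  - move=> D /andP[D0 DA]; rewrite -fund_pow_dvd //; apply: primitive_notin p_prim _.
    rewrite muln_gt0 D0 /=; apply: leq_ltn_trans An; rewrite -mulnA leq_mul2l DA orbT //.
  - by rewrite expn_gt0.
  - by rewrite card_ord.
  - by rewrite card_ord.
  - by move=> m; rewrite card_ord /Tm [in LHS]big_nat_recr //= addnA.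
  - rewrite card_ord /Tm big_geq // addn0; apply: (@leq_ltn_trans (r * A)).
      by rewrite leq_mul2l leq_pred orbT.
    by rewrite ltn_pmul2r.
  - move=> m mk; rewrite card_ord ME mulnC leq_mul2l; apply/orP; right.
    rewrite /dl /= leq_mul2r -mulnA leq_mul2l /=; apply/orP; right; rewrite subSS.
    rewrite -{2}(subnKC mk) expnD leq_mul2l; apply/orP; right; exact: leq_expl.
  - move=> m mk; rewrite card_ord cIE; apply: leq_ltn_trans (dlC mk).
    apply: leq_mul; first by rewrite leq_mul2l leq_exp2l // leq_mul2l LE !orbT.
    by rewrite leq_mul2l leq_pexp2l ?orbT // leq_mul2l LE orbT.
  move=> eq R; rewrite TmE // subnn muln1 card_ord cIE -/N0 => heq hR.
  have N00 : 0 < N0 by rewrite muln_gt0 expn_gt0 d0.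
  have cI0 : 0 < cI by rewrite /cI muln_gt0 A0 expn_gt0 muln_gt0 expn_gt0 d0.
  have R0 : 0 < R by move: hR cI0; case: (R) => //; rewrite muln0 leqn0 => /eqP ->.
  have qR : eq * (34 ^ k.+1 + 2) <= R.
    have X0 : 0 < 2 ^ k.+1 * p.+1 * N0 ^ (r.+1 * N0) by rewrite !muln_gt0 !expn_gt0 N00.
    rewrite -(leq_pmul2r X0).
    apply: (@leq_trans ((34 ^ k.+1 + 2) * (2 ^ k.+1 * p.+1) * N0.+1 ^ (r + r.+1 * N0))).
      have -> : eq * (34 ^ k.+1 + 2) * (2 ^ k.+1 * p.+1 * N0 ^ (r.+1 * N0)) =
        ((34 ^ k.+1 + 2) * (2 ^ k.+1 * p.+1)) * (eq * N0 ^ (r.+1 * N0)) by ring.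
      by rewrite leq_mul2l heq orbT.
    apply: leq_trans count _; rewrite mulnA leq_mul2r; apply/orP; right.
    by rewrite mulnC.
  have e34 : r * (2 ^ k.+1 * A) = d * r * 34 ^ k.+1.
    by rewrite e2A; ring.
  (* The summand 2 pays for the weight bound and for [cI + 1], both at most [2 ^ (d r)]. *)
  apply: (@leq_ltn_trans ((2 ^ (d * r * (34 ^ k.+1 + 2))) ^ eq)).
    apply: leq_expl; rewrite mulnDr expnD e34.
    apply: (@leq_trans (cI.+1 * 2 ^ (d * r) * 2 ^ (d * r * 34 ^ k.+1))).
      have hh a b : 0 < b -> (a * b).+1 <= a.+1 * b.
        by move=> b0; rewrite mulSn -[(a * b).+1]add1n leq_add2r.
      have := hh cI (2 ^ (d * r) * 2 ^ (d * r * 34 ^ k.+1)).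
      by rewrite muln_gt0 !expn_gt0 !mulnA; apply.
    rewrite mulnC leq_mul2l muln2 -addnn expnD; apply/orP; right; rewrite leq_mul2r cI_le orbT //.
  apply: (@leq_ltn_trans ((2 ^ (d * r)) ^ R)); last by rewrite ltn_exp2r.
  rewrite -!expnM leq_exp2l //.
  by rewrite (_ : _ * eq = d * r * (eq * (34 ^ k.+1 + 2))) ?leq_mul2l ?qR ?orbT //; ring.
by rewrite pM in pn'.
Qed.

End CoreBound.

Local Open Scope ring_scope.

(** * Growth of the primitive part *)

Section Growth.
Variable R : realType.
Local Notation lg := (@natln R).

Definition golden : R := (1 + Num.sqrt 5) / 2.

Lemma golden_facts : [/\ golden ^+ 2 = golden + 1, 3 / 2 <= golden & golden <= 2].
Proof.
have s2 : Num.sqrt 5 ^+ 2 = 5 :> R by rewrite sqr_sqrtr ?ler0n.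
have s0 : 0 <= Num.sqrt 5 :> R by exact: sqrtr_ge0.
by rewrite /golden; split; nra.
Qed.

Lemma fib_golden m : (fib m.+1)%:R <= golden ^+ m /\ golden ^+ m <= (fib m.+2)%:R.
Proof.
have [g2 g1 g3] := golden_facts.
suff: ((fib m.+1)%:R <= golden ^+ m /\ golden ^+ m <= (fib m.+2)%:R) /\
  ((fib m.+2)%:R <= golden ^+ m.+1 /\ golden ^+ m.+1 <= (fib m.+3)%:R) by case.
elim: m => [|m [[h1 h2] [h3 h4]]].
  rewrite expr0 expr1 (_ : fib 1 = 1%N) // (_ : fib 2 = 1%N) // (_ : fib 3 = 2) //.
  by split; split; lra.
split=> //; have -> : golden ^+ m.+2 = golden ^+ m.+1 + golden ^+ m.
  by rewrite -addn2 exprD g2 mulrDr mulr1 -exprSr.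
have e1 : (fib m.+3)%:R = (fib m.+2)%:R + (fib m.+1)%:R :> R by rewrite -natrD.
have e2 : (fib m.+4)%:R = (fib m.+3)%:R + (fib m.+2)%:R :> R by rewrite -natrD.
move: h1 h2 h3 h4; rewrite e2 e1.
move: ((fib m.+1)%:R) ((fib m.+2)%:R) => a b; split; lra.
Qed.

Lemma ln_le_sub1 (x : R) : 0 < x -> ln x <= x - 1.
Proof. by move=> x0; rewrite -ler_expR lnK ?posrE // -[leLHS](addrNK 1) addrC expR_ge1Dx. Qed.

Lemma ln_golden : 1 / 3 <= ln golden <= 1.
Proof.
have [g2 g1 g3] := golden_facts; have g0 : 0 < golden by lra.
apply/andP; split; last by have := ln_le_sub1 g0; lra.
have g'0 : 0 < golden^-1 by rewrite invr_gt0.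
have := ln_le_sub1 g'0; rewrite lnV ?posrE //.
have : golden^-1 <= 2 / 3 by rewrite -[leRHS]invrK lef_pV2 ?posrE //; lra.
lra.
Qed.

Lemma lg_fib m : (0 < m)%N -> `|lg (fib m) - m%:R * ln golden| <= 2.
Proof.
have /andP[t1 t2] := ln_golden; have [g2 g1 g3] := golden_facts.
have g0 : 0 < golden by lra.
have lnX k : ln (golden ^+ k) = k%:R * ln golden by rewrite lnXn // mulr_natl.
case: m => // [[_|m _]]; first by rewrite lg1 ler_norml; lra.
have [_ h1] := fib_golden m; have [h2 _] := fib_golden m.+1.
have F0 : 0 < (fib m.+2)%:R :> R by rewrite ltr0n fib_gt0.
move: h1 h2; rewrite -(ler_ln (x := golden ^+ m)) ?posrE ?exprn_gt0 //.
rewrite -(ler_ln (y := golden ^+ m.+1)) ?posrE ?exprn_gt0 // !lnX -/(lg _).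
move: g1 t1 t2; rewrite -[m.+2]addn2 -[m.+1]addn1 (natrD _ m 2) (natrD _ m 1) ler_norml.
move: (lg _) => f _ t1 t2 h1 h2; nra.
Qed.

(** By [fib_lcm_cons] the quantity for [q0 :: qs] at [m] is the difference of those for [qs] at [m]
    and at [m / q0]: the main term acquires the factor [1 - 1 / q0], the error doubles. *)
Lemma lg_fib_lcm qs m : uniq qs -> all prime qs -> all (fun q => q %| m)%N qs -> (0 < m)%N ->
  `|lg (fib m) - lg (fib_lcm qs m) - m%:R * ln golden * \prod_(q <- qs) (1 - q%:R^-1)|
    <= 2 * 2 ^+ size qs.
Proof.
elim: qs m => [|q0 qs IH] m uq pq dq m0.
  by rewrite /fib_lcm !big_nil lg1 subr0 mulr1 expr0 mulr1 lg_fib.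
have e := fib_lcm_cons uq pq dq.
move: uq pq dq => /= /andP[q0s uqs] /andP[pq0 pqs] /andP[q0m qsm].
have q00 := prime_gt0 pq0.
have m'0 : (0 < m %/ q0)%N by rewrite divn_gt0 // dvdn_leq.
have qsm' : all (fun q => q %| m %/ q0)%N qs.
  apply/allP => q qq; have := allP qsm _ qq; rewrite -{1}(divnK q0m) Euclid_dvdM ?(allP pqs) //.
  case/orP => //; rewrite dvdn_prime2 ?pq0 ?(allP pqs q qq) // => /eqP qe; by rewrite -qe qq in q0s.
have h1 := IH _ uqs pqs qsm m0; have h2 := IH _ uqs pqs qsm' m'0.
have L0 s k : (0 < k)%N -> all (fun q => q %| k)%N s -> (0 < fib_lcm s k)%N.
  move=> k0 sk; have := fib_gt0 k0; rewrite -(divnK (@dvd_fib_lcm s k _)).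
    by rewrite muln_gt0 => /andP[].
  by move=> q; exact: (allP sk).
have := congr1 lg e; rewrite !lgM ?fib_gt0 ?L0 //=; last by rewrite q0m.
rewrite big_cons exprS.
move: h1 h2; have -> : (m %/ q0)%:R = m%:R / q0%:R :> R by rewrite -{2}(divnK q0m) natrM mulfK // pnatr_eq0 -lt0n.
move: (\prod_(_ <- _) _) (lg _) (lg _) (lg _) (lg _) (lg _) (ln _) (2 ^+ _) (m%:R) (q0%:R^-1).
move=> P a b c a' b' t E M Q; rewrite !ler_norml => h1 h2 h3.
have -> : M * t * ((1 - Q) * P) = M * t * P - M * Q * t * P by ring.
by lra.
Qed.

Lemma path_ltnS a x s : path ltn a (x :: s) -> path ltn a.+1 s.
Proof. by case: s => //= y s /andP[ax /andP[xy ->]]; rewrite (leq_ltn_trans ax xy). Qed.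

(** The [i]-th entry is at least [a + i], and the product over consecutive integers telescopes. *)
Lemma prod_sub_inv_ge (a : nat) s : (0 < a)%N -> path ltn a s ->
  a%:R / (a + size s)%:R <= \prod_(q <- s) (1 - q%:R^-1) :> R.
Proof.
elim: s a => [|x s IH] a a0 h.
  by rewrite big_nil addn0 divff // pnatr_eq0 -lt0n.
have h' := IH a.+1 isT (path_ltnS h); rewrite big_cons.
have ax : (a < x)%N by move: h => /= /andP[].
apply: (@le_trans _ _ ((a%:R / a.+1%:R) * (a.+1%:R / (a.+1 + size s)%:R))).
  by rewrite mulrA mulfVK ?pnatr_eq0 // addnS.
apply: ler_pM => //; try by rewrite divr_ge0.
have -> : a%:R / a.+1%:R = 1 - a.+1%:R^-1 :> R.
  by rewrite -[in LHS](addrK 1 a%:R) natr1 mulrBl divff ?pnatr_eq0 // mul1r.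
by rewrite lerD2l lerN2 lef_pV2 ?posrE ?ltr0n ?ler_nat // (leq_trans _ ax).
Qed.

Lemma fact_prod_le (a : nat) s : path ltn a s -> ((a + size s)`! <= a`! * \prod_(q <- s) q)%N.
Proof.
elim: s a => [|x s IH] a h; first by rewrite big_nil addn0 muln1.
have h' := IH a.+1 (path_ltnS h); rewrite big_cons /= addnS -addSn.
apply: leq_trans h' _; rewrite factS mulnA leq_mul2r mulnC leq_mul2l.
by move: h => /= /andP[-> _]; rewrite !orbT.
Qed.

(** With [t] the number of primes dividing [n], the product of the [1 - 1/q] is at least
    [1 / (t + 1)]. For [n >= 2 ^ 14], [(t + 1)! <= n] makes the error [2 * 2 ^ t] small against the
    main term and [t + 1] at most [3 ln n]. *)
Lemma lg_fib_part_ge n : (2 ^ 14 <= n)%N ->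
  n%:R <= 12 * lg n * lg (fib n %/ fib_lcm (primes n) n).
Proof.
move=> n14; have n0 : (0 < n)%N by apply: leq_trans n14; rewrite expn_gt0.
have dP q : q \in primes n -> (q %| n)%N by rewrite mem_primes => /and3P[].
have pP q : q \in primes n -> prime q by rewrite mem_primes => /and3P[].
have pr : all prime (primes n) by apply/allP.
have dv : all (fun q => q %| n)%N (primes n) by apply/allP.
have pth : path ltn 1 (primes n).
  have := sorted_primes n; move: pr; case: (primes n) => //= x s /andP[/prime_gt1 x1 _] ->.
  by rewrite x1.
have h1 := lg_fib_lcm (primes_uniq n) pr dv n0.
have h2 := prod_sub_inv_ge (ltn0Sn 0) pth.
have h3 : ((1 + size (primes n))`! <= n)%N.
  apply: leq_trans (fact_prod_le pth) _; rewrite mul1n dvdn_leq // prod_primes_dvd //.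
  exact: primes_uniq.
have L0 := dvd_fib_lcm dP.
have GE : lg (fib n %/ fib_lcm (primes n) n) = lg (fib n) - lg (fib_lcm (primes n) n).
  have F0 := fib_gt0 n0; have l0 := dvdn_gt0 F0 L0.
  by rewrite -{2}(divnK L0) lgM ?addrK // divn_gt0 // dvdn_leq.
rewrite {}GE; move: (lg (fib n) - _) h1 => G.
move: (\prod_(_ <- _) _) h2 h3 => P; move: (size _) => t h2 h3 h1.
have t24 : (24 * 2 ^ t * (t.+1) <= n)%N.
  case: (leqP 7 t) => t7.
    apply: leq_trans h3; rewrite add1n factS mulnC leq_mul2l /=.
    rewrite -(subnKC t7); elim: (t - 7)%N => // u IHu.
    rewrite addnS expnS factS mulnCA leq_mul //.
  apply: leq_trans n14; apply: (@leq_trans (24 * 2 ^ 6 * 7)); last by [].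
  by rewrite leq_mul // leq_mul2l leq_exp2l.
have t2 : (2 ^ t <= n)%N.
  by apply: leq_trans t24; rewrite -mulnA mulnCA leq_pmulr.
have l2 : 1 / 2 <= lg 2.
  have := @ln_le_sub1 2^-1; rewrite invr_gt0 ltr0n lnV ?posrE // /natln => /(_ isT); lra.
have lt : t%:R * lg 2 <= lg n by rewrite -lgX //; apply: lg_le => //; rewrite expn_gt0.
have l14 : 14 * lg 2 <= lg n by rewrite -(@lgX R 2 14) //; apply: lg_le.
have tL : t.+1%:R <= 3 * lg n.
  by rewrite -natr1; have := ler0n R t; nra.
have /andP[g1 g2] := ln_golden.
move: t24; rewrite -(ler_nat R) !natrM natrX => t24.
move: h1 h2; rewrite ler_norml add1n => /andP[h1 _] h2.
have T0 : 0 < t.+1%:R :> R by rewrite ltr0n.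
have h4 : 1 <= P * t.+1%:R by rewrite -ler_pdivrMr.
have N0 : 0 < n%:R :> R by rewrite ltr0n.
have h5 : n%:R <= 4 * (t.+1%:R * G).
  move: h1 h4 t24 T0; move: (2 ^+ t) (t.+1%:R) => E T h1 h4 t24 T0.
  have h6 : n%:R * ln golden <= n%:R * ln golden * (P * T).
    by rewrite ler_peMr // mulr_ge0 //; lra.
  have h7 : T * (n%:R * ln golden * P - 2 * E) <= T * G by rewrite ler_pM2l //; lra.
  have h8 : n%:R * (1 / 3) <= n%:R * ln golden by rewrite ler_pM2l.
  have e : T * (n%:R * ln golden * P - 2 * E) = n%:R * ln golden * (P * T) - (24 * E * T) / 12 by field.
  rewrite e in h7; lra.
have G0 : 0 <= G.
  by rewrite -(pmulr_rge0 _ T0); lra.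
by apply: le_trans h5 _; rewrite -mulrA mulrCA [12 * _](_ : _ = 4 * (3 * (lg n * G))) ?ler_pM2l //; [nra|ring].
Qed.

End Growth.

(** * Explicit bounds for logarithms *)

Section LogBounds.
Variable R : realType.
Local Notation lg := (@natln R).

Lemma lg2_le07 : lg 2 <= 7 / 10.
Proof.
rewrite /natln -[leRHS]expRK ler_ln ?posrE ?expR_gt0 ?ltr0n //.
have h := expR_ge1Dx (7 / 10 / 64 : R).
have h1 : 93 / 91 <= expR (2 * (7 / 10 / 64) : R) by apply: (expR_dbl_ge _ h); lra.
have h2 : 471 / 451 <= expR (2 * (2 * (7 / 10 / 64)) : R) by apply: (expR_dbl_ge _ h1); lra.
have h3 : 1204 / 1104 <= expR (2 * (2 * (2 * (7 / 10 / 64))) : R) by apply: (expR_dbl_ge _ h2); lra.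
have h4 : 842 / 708 <= expR (2 * (2 * (2 * (2 * (7 / 10 / 64)))) : R).
  by apply: (expR_dbl_ge _ h3); lra.
have h5 : 99 / 70 <= expR (2 * (2 * (2 * (2 * (2 * (7 / 10 / 64))))) : R).
  by apply: (expR_dbl_ge _ h4); lra.
have -> : (7 / 10 : R) = 2 * (2 * (2 * (2 * (2 * (2 * (7 / 10 / 64)))))) by lra.
by apply: (expR_dbl_ge _ h5); lra.
Qed.

Lemma lg2_ge : 1 / 2 <= lg 2.
Proof.
have := @ln_le_sub1 R 2^-1; rewrite invr_gt0 ltr0n lnV ?posrE // /natln => /(_ isT); lra.
Qed.

Lemma lg_incr k : (0 < k)%N -> (k.+1%:R)^-1 <= lg k.+1 - lg k.
Proof.
move=> k0; have kp : 0 < k%:R :> R by rewrite ltr0n.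
have sp : 0 < k.+1%:R :> R by rewrite ltr0n.
have := @ln_le_sub1 R (k%:R / k.+1%:R); rewrite divr_gt0 // => /(_ isT).
rewrite ln_div ?posrE // -/(lg k) -/(lg k.+1).
have -> : k%:R / k.+1%:R - 1 = - (k.+1%:R)^-1 :> R.
  by rewrite -natr1; field; rewrite natr1 pnatr_eq0.
by move: (k.+1%:R^-1) (lg _) (lg _) => a b c; lra.
Qed.

(** [ln (17/16) = ln 68 - ln 64] is at least [1/65 + 1/66 + 1/67 + 1/68]; the cruder [1/17] would
    give only 2.647 after multiplication by 45. *)
Lemma lg17_ge : 1353 / 500 <= 45 * (lg 17 - 4 * lg 2).
Proof.
have e64 : lg 64 = 6 * lg 2 by rewrite -(@lgX R 2 6).
have e68 : lg 68 = 2 * lg 2 + lg 17 by rewrite -(@lgX R 2 2) // -lgM.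
have := @lg_incr 64 isT; have := @lg_incr 65 isT; have := @lg_incr 66 isT; have := @lg_incr 67 isT.
have : 68 * 68^-1 = 1 :> R by rewrite divff // pnatr_eq0.
have : 67 * 67^-1 = 1 :> R by rewrite divff // pnatr_eq0.
have : 66 * 66^-1 = 1 :> R by rewrite divff // pnatr_eq0.
have : 65 * 65^-1 = 1 :> R by rewrite divff // pnatr_eq0.
move: e64 e68; move: (lg 64) (lg 65) (lg 66) (lg 67) (lg 68) (68^-1) (67^-1) (66^-1) (65^-1).
by move=> a b c d e x1 x2 x3 x4; lra.
Qed.

Lemma pow_16_17 k m : k = 44 -> (m <= k)%N -> 67 / 1000 * 17 ^+ m <= 16 ^+ m :> R.
Proof.
move=> -> m44; pose a : R := 16 / 17.
suff h : 67 / 1000 <= a ^+ m.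
  by rewrite -ler_pdivlMr ?exprn_gt0 // -expr_div_n.
have a1 : 0 <= a <= 1 by rewrite /a; lra.
apply: (@le_trans _ _ (a ^+ 44)); last by apply: ler_wiXn2l => //; lra.
have a2 : 177 / 200 <= a ^+ 2 by rewrite /a; lra.
have a4 : 783 / 1000 <= a ^+ 4 by rewrite (exprM a 2 2); nra.
have a8 : 613 / 1000 <= a ^+ 8 by rewrite (exprM a 4 2); nra.
have a10 : 542 / 1000 <= a ^+ 10 by rewrite (exprD a 8 2); nra.
have a11 : 510 / 1000 <= a ^+ 11 by rewrite (exprD a 10 1) expr1; have : 941 / 1000 <= a by [rewrite /a; lra]; nra.
have a22 : 260 / 1000 <= a ^+ 22 by rewrite (exprM a 11 2); nra.
by rewrite (exprM a 22 2); nra.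
Qed.

Lemma lg_lt m n : (0 < n)%N -> lg m < lg n -> (m < n)%N.
Proof.
move=> n0 h; rewrite ltnNge; apply/negP => nm.
by move: h; rewrite ltNge lg_le.
Qed.

Lemma lgS_le m : (0 < m)%N -> lg m.+1 <= lg m + m%:R^-1.
Proof.
move=> m0; have mp : 0 < m%:R :> R by rewrite ltr0n.
have sp : 0 < m.+1%:R :> R by rewrite ltr0n.
have := @ln_le_sub1 R (m.+1%:R / m%:R); rewrite divr_gt0 // => /(_ isT).
rewrite ln_div ?posrE // -/(lg m) -/(lg m.+1).
have -> : m.+1%:R / m%:R - 1 = m%:R^-1 :> R by rewrite -natr1; field; rewrite pnatr_eq0 -lt0n.
by move: (m%:R^-1) (lg _) (lg _) => a b c; lra.
Qed.

Lemma lg_le_scale (c : R) m : 0 < c -> (0 < m)%N -> lg m <= m%:R / c + ln c - 1.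
Proof.
move=> c0 m0; have := @ln_le_sub1 R (m%:R / c); rewrite divr_gt0 ?ltr0n // => /(_ isT).
rewrite ln_div ?posrE ?ltr0n // -/(lg m); lra.
Qed.

End LogBounds.

(** The auxiliary value has logarithm at most [C + U a], mainly [4000 w U] from the sizes of the
    [xi j], against [X P]. As [201/200 * 143000 / 34 > 4220], more than [220 w U] remains for
    [C <= 2000 u U], which is below [167 w U], and for the constants. *)
Lemma dl_numeric (R : realType) (U X P C a w u : R) :
  0 < U -> C <= 2000 * u * U -> a <= 4000 * w + 7 / 2 -> 201 / 200 * U <= 34 * X ->
  143 * (1000 * w) - 1 <= P -> 12 * u <= w -> 250 <= u -> C + U * a < X * P.
Proof.
move=> U0 hC ha hX hP hw hu.
have P0 : 0 <= P by lra.
have h1 := ler_wpM2r P0 hX; have h2 : U * a <= U * (4000 * w + 7 / 2) by rewrite ler_pM2l.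
have h3 : U * (143 * (1000 * w) - 1) <= U * P by rewrite ler_pM2l.
have h4 : U * (34 * (2000 * u + (4000 * w + 7 / 2))) < U * (201 / 200 * (143 * (1000 * w) - 1)).
  by rewrite ltr_pM2l //; lra.
move: h1 h2 h3 h4 hC; clear - U0.
have -> : 201 / 200 * U * P = 201 / 200 * (U * P) by ring.
have -> : 34 * X * P = 34 * (X * P) by ring.
have -> : U * (201 / 200 * (143 * (1000 * w) - 1)) = 201 / 200 * (U * (143 * (1000 * w) - 1)) by ring.
have -> : U * (34 * (2000 * u + (4000 * w + 7 / 2))) = 34 * (2000 * u * U) + 34 * (U * (4000 * w + 7 / 2)) by ring.
move: (U * P) (X * P) (2000 * u * U) (U * (4000 * w + 7 / 2)) (U * a) (U * (_ - 1)) => *; lra.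
Qed.

(** In units of [rr], with [s = ln 17] and [b = ln 2], the gain is [45 (s - 4 b) >= 2.706]. The
    losses are 1 for replacing [N0] by [N0 + 1], 0.5 since [p] may exceed [n] by [exp (1000 u)], and
    1.205 since [d] may fall short of [n] by [exp (2410 u)]. The remaining [0.001 rr], at least 500,
    absorbs the constants. *)
Lemma count_numeric (R : realType) (rr V a b s c c' x p L u : R) :
  rr = 2000 * u -> 250 <= u -> 1 <= V -> rr <= V -> 0 <= c -> c = 225 * b + a -> c' <= c + V^-1 ->
  x <= b + 45 * (b + s) -> b <= 7 / 10 -> 1353 / 500 <= 45 * (s - 4 * b) ->
  L - 2410 * u <= a -> p <= L + 1000 * u + 3 ->
  x + (45 * b + p) + (rr + (rr + 1) * V) * c' <= rr * (45 * (b + s) + a) + (45 * s + a) + (rr + 1) * V * c.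
Proof.
move=> rE u1 V1 rV c0 cE c'E xb b7 hs ha hp.
have V0 : 0 < V by lra.
have r0 : 0 <= rr by lra.
have h1 : (rr + (rr + 1) * V) * c' <= (rr + (rr + 1) * V) * (c + V^-1).
  by apply: ler_wpM2l => //; rewrite addr_ge0 // mulr_ge0 //; lra.
have h2 : rr * V^-1 <= 1 by rewrite ler_pdivrMr // mul1r.
have e : (rr + (rr + 1) * V) * (c + V^-1) = rr * c + (rr + 1) * V * c + rr * V^-1 + (rr + 1).
  by field; rewrite gt_eqF.
have h3 : rr * (1353 / 500) <= rr * (45 * (s - 4 * b)) by apply: ler_wpM2l.
rewrite e in h1; clear e; move: h1 h2 h3; rewrite cE.
have -> : rr * (45 * (b + s) + a) = rr * (45 * (s - 4 * b)) + rr * (225 * b + a) by ring.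
move: ((rr + 1) * V * _) (rr * (225 * b + a)) (rr * (45 * _)) (rr * V^-1) ((rr + (rr + 1) * V) * c') => z1 z2 z3 z4 z5.
rewrite rE; clear - u1 xb b7 ha hp; lra.
Qed.

Lemma lg_le_inv (R : realType) m n : (0 < m)%N -> (0 < n)%N -> natln R m <= natln R n -> (m <= n)%N.
Proof. by move=> m0 n0; rewrite /natln ler_ln ?posrE ?ltr0n // ler_nat. Qed.

(** * Numerical verification *)

Section NumericBounds.
Variable R : realType.
Local Notation lg := (@natln R).
(* With [r = 2 l] and [2 sg <= l ^ 2], two conditions fix the constants: [45 ln (17 / 16) > 2.706]
   makes the unknowns outnumber the equations in Siegel's lemma, and [143 (15 / 34) (16 / 17) ^ 44 > 4]
   makes the auxiliary values too small to be nonzero at every stage. The choice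
   [ln d = ln n - 2.41 l] lies between [ln n - 2.412 l], required by the count of equations, and
   [ln n - 2.4 l], required for [kappa * M] to be smaller than [n]. *)
Variables (l k n d y : nat) (u : R).
Hypotheses (k44 : k = 44) (lE : l%:R = 1000 * u) (u250 : 250 <= u).
Hypotheses (y0 : (0 < y)%N) (yl : (8 * y ^ 4 <= l ^ 2)%N).
Hypotheses (d0 : (0 < d)%N) (n0 : (0 < n)%N).
Hypothesis Ln : 143 * (1000 * u) * lg l <= lg n.
Hypotheses (d_ge : lg n - 2410 * u <= lg d) (d_le : lg d <= lg n - 2410 * u + 1).
Let r := (2 * l)%N.
Let sg := (4 * y ^ 4)%N.
Let A := (17 ^ k.+1 * d)%N.
Let cI := ((34 ^ k.+1 * d) ^ r * A)%N.
Let dl m := (15 * 32 ^ m.-1 * 17 ^ (k.+1 - m) * d)%N.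
Let N0 := (32 ^ k.+1 * d)%N.
Let M := ((2 ^ r).+1 * (15 * 32 ^ k * d))%N.

Let l0 : (0 < l)%N. Proof. by rewrite -(ltr0n R) lE; move: u250; lra. Qed.
Let r0 : (0 < r)%N. Proof. by rewrite muln_gt0 l0. Qed.
Let rE : r%:R = 2000 * u :> R. Proof. by rewrite natrM lE; lra. Qed.
Let A0 : (0 < A)%N. Proof. by rewrite muln_gt0 expn_gt0 d0. Qed.
Let cI0 : (0 < cI)%N. Proof. by rewrite muln_gt0 A0 expn_gt0 muln_gt0 expn_gt0 d0. Qed.
Let kE : k.+1%:R = 45 :> R. Proof. by rewrite k44. Qed.
Let kE' : k%:R = 44 :> R. Proof. by rewrite k44. Qed.

Lemma lg_scale_ge : 12 <= lg l.
Proof.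
have e1 := expR1_le R; have e0 := expR_ge0 (1 : R).
have e2 : expR (2 * 1 : R) <= 756 / 100 by apply: (expR_dbl_le e1); lra.
have e4 : expR (2 * (2 * 1) : R) <= 572 / 10 by apply: (expR_dbl_le e2); lra.
rewrite /natln -[leLHS]expRK ler_ln ?posrE ?expR_gt0 ?ltr0n // lE.
have -> : (12 : R) = 2 * (2 * 1) + (2 * (2 * 1) + 2 * (2 * 1)) by lra.
rewrite !expRD; have := expR_ge0 (2 * (2 * 1) : R); move: (expR _) e4 => z z1 z0.
have w1 : z * z <= 3272 by apply: le_trans (ler_pM z0 z0 z1 z1) _; lra.
have w0 : 0 <= z * z by exact: mulr_ge0.
have : z * (z * z) <= 572 / 10 * 3272 by exact: ler_pM.
by move: u250; lra.
Qed.

Lemma lg_scale_le : lg l <= u + 6.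
Proof.
have e : l%:R / 2 ^+ 10 = 1000 / 1024 * u :> R by rewrite lE; field.
have p2 : 0 < l%:R / 2 ^+ 10 :> R by rewrite divr_gt0 ?ltr0n ?exprn_gt0.
have h1 : ln (l%:R / 2 ^+ 10) = lg l - 10 * lg 2.
  by rewrite ln_div ?posrE ?ltr0n ?exprn_gt0 // -natrX -(@lgX R 2 10).
have := ln_le_sub1 p2; rewrite h1 e; have := lg2_le07 R; move: u250.
by move: (lg l) (lg 2) => a b; lra.
Qed.

Let lam12 := lg_scale_ge.
Let Lbig : 1716 * (1000 * u) <= lg n.
Proof. by apply: le_trans Ln; move: lam12 u250; move: (lg l) => a; nra. Qed.

Let l32 : lg 32 = 5 * lg 2. Proof. by rewrite -(@lgX R 2 5). Qed.
Let l34 : lg 34 = lg 2 + lg 17. Proof. by rewrite -lgM. Qed.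
Let l17 : lg 17 <= 7 / 2.
Proof. by have := lg2_le07 R; have : lg 17 <= lg 32 by [exact: lg_le]; rewrite l32; lra. Qed.
Let l15 : lg 15 <= 28 / 10.
Proof.
have := lg2_le07 R; have e : lg 16 = 4 * lg 2 by rewrite -(@lgX R 2 4).
by have : lg 15 <= lg 16 by [exact: lg_le]; rewrite e; lra.
Qed.
Let l21 : lg 21 <= 7 / 2.
Proof. by have := lg2_le07 R; have : lg 21 <= lg 32 by [exact: lg_le]; rewrite l32; lra. Qed.
Let l6 : lg 6 <= 21 / 10.
Proof.
have := lg2_le07 R; have e : lg 8 = 3 * lg 2 by rewrite -(@lgX R 2 3).
by have : lg 6 <= lg 8 by [exact: lg_le]; rewrite e; lra.
Qed.

Let lgA : lg A = 45 * lg 17 + lg d.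
Proof. by rewrite lgM ?expn_gt0 // lgX // kE. Qed.
Let lgcI : lg cI = 2000 * u * (45 * (lg 2 + lg 17) + lg d) + (45 * lg 17 + lg d).
Proof.
by rewrite lgM ?expn_gt0 ?muln_gt0 ?expn_gt0 ?d0 // lgA lgX ?muln_gt0 ?expn_gt0 ?d0 // rE lgM ?expn_gt0 // lgX // kE l34.
Qed.
Let sg0 : (0 < sg)%N.
Proof. by have := expn_gt0 y 4; rewrite y0 /sg; case: (y ^ 4)%N. Qed.
Let lg_sg : lg sg + lg 2 <= 2 * lg l.
Proof.
rewrite -lgM // -(@lgX R l 2) //; apply: lg_le; first by rewrite muln_gt0 sg0.
by apply: leq_trans yl; rewrite /sg mulnAC.
Qed.

(** The factor [2 ^ r] contributes at most [0.7 * 2000 u = 1400 u] to the logarithm, and [d] at most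
    [ln n - 2410 u + 1]. *)
Lemma lgM_le : lg M <= lg n - 1010 * u + 160.
Proof.
have h2 := lg2_le07 R; have h1 := lg2_ge R.
have hM : lg M = lg (2 ^ r).+1 + (lg 15 + 44 * lg 32 + lg d).
  by rewrite !lgM ?muln_gt0 ?expn_gt0 // lgX // kE'.
have hS : lg (2 ^ r).+1 <= lg 2 + 2000 * u * lg 2.
  rewrite -rE -lgX // -lgM ?expn_gt0 //; apply: lg_le => //.
  by rewrite mulSn mul1n -[(2 ^ r).+1]add1n leq_add2r expn_gt0.
rewrite hM l32; move: hS d_le l15 h2 u250; move: (lg 2) (lg 15) (lg d) (lg n) (lg _.+1) => a b c e f.
move=> *; nra.
Qed.

Let hyps_lt p : lg n - 1 <= lg p -> [/\ (M <= p)%N, (sg ^ 2 < p)%N, (6 * 2 ^ k * A < n)%N &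
  (4 * 2 ^ r < p)%N].
Proof.
move=> lp; have h2 := lg2_le07 R; have h1 := lg2_ge R.
have p0 : (0 < p)%N.
  rewrite lt0n; apply/eqP => p0; have e : lg p = 0 by rewrite p0 /natln ln0.
  by move: lp Lbig u250; rewrite e; move: (lg n) => a; lra.
have hl := lg_scale_le.
split; first 1 last.
- apply: (@lg_lt R _ _ p0); rewrite lgX //.
  by move: lg_sg lp Lbig hl u250 h1; lra.
- apply: (@lg_lt R _ _ n0); rewrite lgM ?muln_gt0 ?expn_gt0 // lgA lgM ?expn_gt0 // lgX // kE'.
  by move: d_le l17 l6 h2 u250; lra.
- apply: (@lg_lt R _ _ p0); rewrite lgM ?expn_gt0 // !(@lgX R 2) // rE -[4%N]/(2 ^ 2)%N lgX //.
  by move: lp Lbig h2 u250; nra.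
by apply: ltnW; apply: (@lg_lt R _ _ p0); move: lgM_le lp u250; lra.
Qed.

Let D1 : 1 <= d%:R :> R. Proof. by rewrite ler1n. Qed.

Let lgd_d : lg d <= d%:R.
Proof. by have := @ln_le_sub1 R d%:R; rewrite ltr0n d0 /natln => /(_ isT); lra. Qed.

Let lgd_big : 1000 <= lg d.
Proof. by move: d_ge Lbig u250; lra. Qed.

Let cI_le : (cI.+1 <= 2 ^ (d * r))%N.
Proof.
apply: (@lg_lt R); first by rewrite expn_gt0.
rewrite lgcI lgX // natrM rE; have h2 := lg2_le07 R; have h1 := lg2_ge R.
have h4 : lg d <= d%:R / 4 + 1.
  have := @lg_le_scale R (2 ^+ 2) d; rewrite exprn_gt0 // => /(_ isT d0).
  by rewrite lnXn // -mulr_natl -/(lg 2); move: (lg d) (lg 2) h2 => a b; lra.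
have h5 : 2000 * u * (45 * (lg 2 + lg 17) + lg d) <= 2000 * u * (190 + d%:R / 4).
  by apply: ler_wpM2l; [move: u250; lra | move: l17 h2 h4; lra].
have h6 : 2000 * u * (d%:R * (1 / 2)) <= 2000 * u * (d%:R * lg 2).
  by apply: ler_wpM2l; [move: u250; lra | apply: ler_wpM2l].
have h7 : 1000 <= d%:R :> R by apply: le_trans lgd_d.
have h8 : 2000 * 250 * (d%:R / 4 - 190) <= 2000 * u * (d%:R / 4 - 190).
  by apply: ler_wpM2r; [move: h7; lra | move: u250; lra].
move: h4 h5 h6 h7 h8 l17; move: (lg d) (lg 2) (lg 17) (d%:R) => a b c e h4 h5 h6 h7 h8 l17'.
have -> : e * (2000 * u) * b = 2000 * u * (e * b) by ring.
by lra.
Qed.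

Let dlC p : lg n - 1 <= lg p -> forall m, (m <= k)%N ->
  (cI * 2 ^ (d * r) * 2 ^ (r * (2 ^ m.+1 * A)) * (21 ^ (2 * (2 ^ m * A)) * sg ^ (r * (2 ^ m.+1 * A)))
   < p ^ dl m.+1)%N.
Proof.
move=> lp m mk; have [Mp _ _ rp] := hyps_lt lp.
have p0 : (0 < p)%N by apply: leq_ltn_trans rp.
have h2 := lg2_le07 R; have h1 := lg2_ge R.
have -> : (2 * (2 ^ m * A) = 2 ^ m.+1 * A)%N by rewrite expnS mulnA.
set U := (2 ^ m.+1 * A)%N.
have U0 : (0 < U)%N by rewrite muln_gt0 expn_gt0 A0.
apply: (@lg_lt R); first by rewrite expn_gt0 p0.
have rU0 : (0 < 2 ^ (r * U))%N by rewrite expn_gt0.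
have rd0 : (0 < 2 ^ (d * r))%N by rewrite expn_gt0.
have U21 : (0 < 21 ^ U)%N by rewrite expn_gt0.
have Usg : (0 < sg ^ (r * U))%N by rewrite expn_gt0 sg0.
have c1 : (0 < cI * 2 ^ (d * r))%N by rewrite muln_gt0 cI0.
have c2 : (0 < cI * 2 ^ (d * r) * 2 ^ (r * U))%N by rewrite muln_gt0 c1.
have c3 : (0 < 21 ^ U * sg ^ (r * U))%N by rewrite muln_gt0 U21.
have -> : lg (cI * 2 ^ (d * r) * 2 ^ (r * U) * (21 ^ U * sg ^ (r * U))) =
  lg cI + d%:R * (2000 * u) * lg 2 + U%:R * (2000 * u * (lg 2 + lg sg) + lg 21).
  rewrite (lgM R c2 c3) (lgM R c1 rU0) (lgM R cI0 rd0) (lgM R U21 Usg).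
  rewrite (lgX R (d * r) (ltn0Sn 1)) (lgX R (r * U) (ltn0Sn 1)) (lgX R U (ltn0Sn 20)) (lgX R (r * U) sg0).
  by rewrite (natrM _ d r) (natrM _ r U) rE; move: (lg _) (lg _) (lg _) => *; ring.
rewrite (lgX R _ p0).
(* [dl (m + 1) / U = (15/34) * (16/17) ^ m] is smallest at [m = 44], and
   [15 * 67/1000 = 201/200]. *)
have hX : 201 / 200 * U%:R <= 34 * (dl m.+1)%:R :> R.
  have := ler_wpM2r (_ : 0 <= 15 * U%:R) (@pow_16_17 R k m k44 mk); rewrite mulr_ge0 // => /(_ isT).
  have -> : 16 ^+ m * (15 * U%:R) = 17 ^+ m * (34 * (dl m.+1)%:R) :> R.
    have e : (16 ^ m * (15 * U) = 17 ^ m * (34 * dl m.+1))%N.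
      rewrite /U /A /dl /= subSS -{1}(subnK mk) -addnS expnD [(17 ^ m.+1)%N]expnS [(2 ^ m.+1)%N]expnS.
      by rewrite -[32%N]/(16 * 2)%N expnMn; ring.
    by rewrite -!natrX -!natrM e.
  have -> : 67 / 1000 * 17 ^+ m * (15 * U%:R) = 17 ^+ m * (201 / 200 * U%:R) :> R by field.
  by rewrite ler_pM2l // exprn_gt0.
have hU : 500 * d%:R <= U%:R :> R.
  rewrite -natrM ler_nat /U /A mulnA leq_mul2r; apply/orP; right.
  apply: (@leq_trans (2 ^ 1 * 17 ^ 2)); first by [].
  by rewrite leq_mul // leq_pexp2l // k44.
have v1 : 1 <= 2000 * u by move: u250; lra.
have h9 : lg cI + d%:R * (2000 * u) * lg 2 <= 2000 * u * U%:R.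
  rewrite lgcI; move: v1 hU l17 h2 lgd_d D1.
  move: (lg d) (lg 2) (lg 17) (d%:R) (U%:R) (2000 * u) => a b c e f v v1 hU l17' hb ha e1.
  have z1 : 0 <= (v - 1) * e by apply: mulr_ge0; lra.
  have z2 : 0 <= v * (e - 1) by apply: mulr_ge0; lra.
  have z3 : v * (45 * (b + c) + a) <= v * (190 + e) by apply: ler_wpM2l; lra.
  have z4 : v * e * b <= v * e * 1 by apply: ler_wpM2l; [apply: mulr_ge0; lra | lra].
  have z5 : v * (500 * e) <= v * f by apply: ler_wpM2l; lra.
  move: z1 z2 z3 z4 z5; have -> : (v - 1) * e = v * e - e by ring.
  have -> : v * (e - 1) = v * e - v by ring.
  have -> : v * (190 + e) = 190 * v + v * e by ring.
  have -> : v * (500 * e) = 500 * (v * e) by ring.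
  rewrite mulr1 [e * v]mulrC; move: (v * e * b) (v * _) (v * e) (v * f) => *; lra.
have UR : 0 < U%:R :> R by rewrite ltr0n.
have hp : 143 * (1000 * u) * lg l - 1 <= lg p by move: lp Ln; lra.
have h14 : 0 <= u * (lg l - 12) by apply: mulr_ge0; [move: u250; lra | move: lam12; lra].
apply: (dl_numeric UR h9 _ hX (w := u * lg l)) => //; last 2 first.
- by move: hp; move: (lg p) (lg l) => a b; lra.
- by move: h14; move: (lg l) => b; lra.
have h12 : 2000 * u * (lg 2 + lg sg) <= 2000 * u * (2 * lg l).
  by apply: ler_wpM2l; [move: u250; lra | move: lg_sg; lra].
by move: h12 l21; move: (lg l) (2000 * u * _) (lg 21) => a b c; lra.
Qed.

Let count p : lg p.+1 <= lg n + 1000 * u + 3 ->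
  ((34 ^ k.+1 + 2) * (2 ^ k.+1 * p.+1) * N0.+1 ^ (r + r.+1 * N0) <= cI * N0 ^ (r.+1 * N0))%N.
Proof.
move=> lp; have h2 := lg2_le07 R; have h17 := lg17_ge R.
have N00 : (0 < N0)%N by rewrite muln_gt0 expn_gt0 d0.
have e34 : lg (34 ^ k.+1 + 2) <= lg 2 + 45 * (lg 2 + lg 17).
  rewrite -l34 -kE -lgX // -lgM ?expn_gt0 //; apply: lg_le; first by rewrite addn_gt0 orbT.
  rewrite mul2n -addnn leq_add2l expnS; apply: (@leq_trans (34 * 1)) => //.
  by rewrite leq_mul2l expn_gt0.
have X0 : (0 < 34 ^ k.+1 + 2)%N by rewrite addn_gt0 orbT.
have Y0 : (0 < 2 ^ k.+1)%N by rewrite expn_gt0.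
have Yp0 : (0 < 2 ^ k.+1 * p.+1)%N by rewrite muln_gt0 Y0.
have XY0 : (0 < (34 ^ k.+1 + 2) * (2 ^ k.+1 * p.+1))%N by rewrite muln_gt0 X0 Yp0.
have Z0 : (0 < N0.+1 ^ (r + r.+1 * N0))%N by rewrite expn_gt0.
have W0 : (0 < N0 ^ (r.+1 * N0))%N by rewrite expn_gt0 N00.
have L0 : (0 < (34 ^ k.+1 + 2) * (2 ^ k.+1 * p.+1) * N0.+1 ^ (r + r.+1 * N0))%N.
  by rewrite muln_gt0 XY0 Z0.
have R0 : (0 < cI * N0 ^ (r.+1 * N0))%N by rewrite muln_gt0 cI0 W0.
apply: (@lg_le_inv R _ _ L0 R0).
rewrite (lgM R XY0 Z0) (lgM R X0 Yp0) (lgM R Y0 (ltn0Sn p)) (lgM R cI0 W0) lgcI.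
rewrite (lgX R k.+1 (ltn0Sn 1)) kE (lgX R _ (ltn0Sn N0)) (lgX R _ N00).
rewrite (natrD _ r (r.+1 * N0)) (natrM _ r.+1 N0) -(natr1 r) -rE.
have NR : 0 < N0%:R :> R by rewrite ltr0n.
apply: (@count_numeric R r%:R N0%:R (lg d) (lg 2) (lg 17) (lg N0) _ _ _ (lg n) u) => //.
- by rewrite ler1n.
- apply: le_trans (_ : d%:R <= _); first by apply: le_trans lgd_d; rewrite rE; move: d_ge Lbig u250; lra.
  by rewrite ler_nat leq_pmull // expn_gt0.
- exact: lg_ge0.
- rewrite lgM ?expn_gt0 // lgX // kE l32; move: (lg 2) => a; ring.
- exact: lgS_le.
Qed.

Lemma valuation_lt (xi : 'I_r -> A5) (q : 'I_r -> nat) p : good_family sg xi q ->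
  primitive_divisor p n -> ~~ (p %| n)%N -> lg n - 1 <= lg p -> lg p.+1 <= lg n + 1000 * u + 3 ->
  (logn p (fib n) < M)%N.
Proof.
move=> gf pp pn lp lp1; have [Mp sgp An rp] := hyps_lt lp.
have n6 : (6 < n)%N.
  apply: leq_ltn_trans An; rewrite -mulnA leq_pmulr // muln_gt0 expn_gt0 A0 //.
exact: (prim_valuation gf r0 d0 sg0 (erefl M) pp n6 Mp sgp pn An rp (dlC lp) cI_le (count lp1)).
Qed.

End NumericBounds.

Local Close Scope ring_scope.

(** * Choice of scales and the final contradiction *)

Lemma prim_part_le n B M S : 0 < B ->
  (forall p, primitive_divisor p n -> [/\ p \in S, p <= B & logn p (fib n) <= M]) ->
  prim_part n <= B ^ (M * size S).
Proof.
move=> B0 h; rewrite /prim_part -big_filter.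
set s := filter _ _; have us : uniq s by rewrite filter_uniq ?primes_uniq.
have sP p : p \in s -> primitive_divisor p n by rewrite mem_filter => /andP[].
have szs : size s <= size S by apply: uniq_leq_size => // p /sP/h[].
apply: (@leq_trans (B ^ (M * size s))); last by rewrite leq_pexp2l // leq_mul2l szs orbT.
elim: s sP {us szs} => [|p s IH] sP; first by rewrite big_nil muln0.
rewrite big_cons /= mulnS expnD leq_mul //.
  have [_ pB pM] := h _ (sP _ (mem_head _ _)).
  apply: (@leq_trans (B ^ logn p (fib n))); first exact: leq_expl.
  by rewrite leq_pexp2l.
by apply: IH => p' hp'; apply: sP; rewrite inE hp' orbT.
Qed.

(** [y] is the largest integer with [8 y ^ 4 <= l ^ 2], so that [(2 l) ^ 2 < 32 (y + 1) ^ 4]. The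
    threshold 297 is its value at [l = 250000]. *)
Lemma scale_y (l : nat) : 250 * 1000 <= l ->
  exists y, [/\ 297 <= y, 8 * y ^ 4 <= l ^ 2 & 2 * l <= 6 * y.+1 ^ 2].
Proof.
move=> hl; have h297 : 8 * 297 ^ 4 <= l ^ 2.
  apply: (@leq_trans (250 * 1000 * (250 * 1000))); last by rewrite -mulnn leq_mul.
  rewrite !expnS expn0; lia.
have ex : exists y, 8 * y ^ 4 <= l ^ 2 by exists 297.
have ub y : 8 * y ^ 4 <= l ^ 2 -> y <= l ^ 2.
  by apply: leq_trans; rewrite (expnD y 1 3) expn1 mulnCA; case: y => // y; rewrite leq_pmulr // muln_gt0 expn_gt0.
case: (ex_maxnP ex ub) => y hy hmax; exists y; split=> //; first exact: hmax.
have h : l ^ 2 < 8 * y.+1 ^ 4 by rewrite ltnNge; apply/negP => /hmax; rewrite ltnn.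
rewrite -(@leq_exp2r _ _ 2) // (expnMn 2) (expnMn 6) -expnM.
by apply: (@leq_trans (4 * (8 * y.+1 ^ 4))); [rewrite leq_mul2l /= ltnW | rewrite mulnA leq_mul2r orbT].
Qed.

Local Open Scope ring_scope.
Section Scale.
Variable R : realType.
Local Notation lg := (@natln R).

(** [l] is taken maximal with respect to [L = ln n], so it grows with [n] beyond [K]. The upper
    bound on [L] keeps [ln L] of the order of [ln l] even if [n] is far larger than required, and
    [K <= l + 1] controls [kappa]. *)
Lemma scale_l (K L : R) : 250 * 10 ^+ 3 <= K -> 143 * K * ln K <= L ->
  exists l : nat, [/\ (250 * 1000 <= l)%N, K <= l%:R + 1, 143 * l%:R * lg l <= L &
    L < 143 * (l%:R + 1) * lg l.+1].
Proof.
have -> : 10 ^+ 3 = 1000 :> R by rewrite -natrX.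
have [c cE] : exists c, c = (250 * 1000)%N by exists (250 * 1000)%N.
have cR : c%:R = 250 * 1000 :> R by rewrite cE natrM.
rewrite -cE -cR => cK KL.
have c3 : 3 <= c%:R :> R by rewrite cR; lra.
clear cE cR.
have K0 : 0 < K by lra.
have /andP[t1 t2] := truncn_itv (ltW K0).
have l2 := lg2_ge R.
pose P l := (c <= l)%N && (143 * l%:R * lg l <= L).
have lgP l : (c <= l)%N -> 1 / 2 <= lg l.
  move=> cl; apply: le_trans l2 _; apply: lg_le => //; apply: leq_trans cl.
  by rewrite -(ler_nat R); lra.
have PK : P (Num.truncn K).
  have ct : (c <= Num.truncn K)%N by rewrite truncn_ge_nat // ltW.
  rewrite /P ct; apply: le_trans KL; have h2 := lgP _ ct.
  have t0 : 0 < (Num.truncn K)%:R :> R by apply: lt_le_trans (_ : c%:R <= _); [lra | rewrite ler_nat].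
  have h1 : lg (Num.truncn K) <= ln K by rewrite /natln ler_ln ?posrE.
  apply: ler_pM => //; rewrite ?mulr_ge0 ?ler_pM2l //; first [exact: ltW | lra].
have ex : exists l, P l by exists (Num.truncn K).
have ub l : P l -> (l <= (Num.truncn L).+1)%N.
  move=> /andP[cl lL]; rewrite -(ler_nat R); apply: ltW; apply: le_lt_trans (truncnS_gt L).
  by apply: le_trans lL; have := lgP _ cl; have := ler0n R l; move: (l%:R) (lg l) => a b; nra.
case: (ex_maxnP ex ub) => l /andP[cl lL] hmax; exists l; split=> //.
  apply: le_trans (ltW t2) _; rewrite natr1 ler_nat ltnS; exact: hmax.
rewrite ltNge natr1; apply/negP => h; have /hmax : P l.+1 by rewrite /P (leqW cl).
by rewrite ltnn.
Qed.

Lemma scale_d (n : nat) (v : R) : (0 < n)%N -> v <= lg n ->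
  exists2 d, (0 < d)%N & lg n - v <= lg d <= lg n - v + 1.
Proof.
move=> n0 vL; have n0R : 0 < n%:R :> R by rewrite ltr0n.
pose x := n%:R * expR (- v); have x0 : 0 < x by rewrite mulr_gt0 // expR_gt0.
have lx : ln x = lg n - v by rewrite lnM ?posrE ?expR_gt0 // expRK.
have x1 : 1 <= x by rewrite -ler_ln ?posrE // ln1 lx subr_ge0.
have /andP[t1 t2] := truncn_itv (ltW x0).
exists (Num.truncn x).+1 => //; rewrite -lx; apply/andP; split.
  by rewrite /natln ler_ln ?posrE // ltW.
apply: (@le_trans _ _ (ln (x * 2))).
  have h : (Num.truncn x).+1%:R <= x * 2 by rewrite -natr1; move: t1 x1; move: (_%:R) => a; lra.
  by rewrite /natln ler_ln ?posrE // mulr_gt0.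
by rewrite lnM ?posrE // lerD2l; have := lg2_le07 R; rewrite /natln; lra.
Qed.

End Scale.

(** With [L = ln n]: [kappa M] is at most [n * exp (161 - 10 u)] and [ln L] at most [2 u + 19], so
    the first bound on [L] would force [6 u < 204]. *)
Lemma contradiction_numeric (R : realType) (u L lL lK lM : R) :
  250 <= u -> L <= 49 / 10 + 2 * lL + lK + lM -> lK <= 1000 * u + 1 ->
  lM <= L - 1010 * u + 160 -> lL <= 7 + 2 * (u + 6) -> False.
Proof. move=> *; lra. Qed.

Lemma lg_half_ge (R : realType) (n p : nat) : (0 < n)%N -> (0 < p)%N -> (n <= 2 * p)%N ->
  natln R n - 1 <= natln R p.
Proof.
move=> n0 p0 /(lg_le R n0); rewrite (lgM R (ltn0Sn 1) p0); have := lg2_le07 R.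
by move: (natln R n) (natln R 2) (natln R p) => a b c; lra.
Qed.

Lemma lg_succ_le (R : realType) (kap n p : nat) (u : R) : (0 < kap)%N -> (0 < n)%N ->
  (p <= kap * n + 1)%N -> natln R kap <= 1000 * u + 1 -> natln R p.+1 <= natln R n + 1000 * u + 3.
Proof.
move=> k0 n0 pu hk; have kn0 : (0 < kap * n)%N by rewrite muln_gt0 k0.
have h : (p.+1 <= 2 ^ 2 * (kap * n))%N by move: (kap * n)%N kn0 pu => z; lia.
have := lg_le R (ltn0Sn p) h.
rewrite (lgM R (expn_gt0 2 2 : (0 < 2 ^ 2)%N) kn0) (lgX R 2 (ltn0Sn 1)) (lgM R k0 n0).
by have := lg2_le07 R; move: hk; move: (natln R n) (natln R 2) (natln R kap) (natln R p.+1) => a b c e; lra.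
Qed.

Lemma ln_scale_le (R : realType) (l : nat) (L : R) : (0 < l)%N -> 1 <= L ->
  L <= 143 * (l%:R + 1) * natln R l.+1 -> ln L <= 7 + 2 * natln R l.
Proof.
move=> l0 L1 hL; have l2 := lg2_le07 R.
have hS : natln R l.+1 <= l.+1%:R.
  have := @ln_le_sub1 R l.+1%:R; rewrite ltr0n => /(_ isT).
  by rewrite -/(natln R l.+1); move: (natln R l.+1) (l.+1%:R) => a b; lra.
have h : L <= (2 ^ 10 * l ^ 2)%N%:R.
  apply: le_trans hL _; rewrite natr1.
  apply: (@le_trans _ _ (143 * l.+1%:R * l.+1%:R)); first by apply: ler_wpM2l => //; rewrite mulr_ge0.
  rewrite -!natrM ler_nat -mulnA mulnn; apply: (@leq_trans (143 * (2 * l) ^ 2)).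
    by rewrite leq_mul2l /= leq_exp2r // mul2n -addnn -addn1 leq_add2l.
  by rewrite expnMn mulnA leq_mul2r orbT.
have X0 : (0 < 2 ^ 10)%N by rewrite expn_gt0.
have Y0 : (0 < l ^ 2)%N by rewrite expn_gt0 l0.
have {}h : ln L <= natln R (2 ^ 10 * l ^ 2).
  by rewrite /natln ler_ln ?posrE //; [lra | rewrite ltr0n muln_gt0 X0].
move: h; rewrite (lgM R X0 Y0) (lgX R 10 (ltn0Sn 1)) (lgX R 2 l0).
by move: l2; move: (natln R 2) (natln R l) (ln L) => a b c; lra.
Qed.

(** Up to [2 n], [G] is bounded by a product of [2 kappa] factors [kappa n + 1 <= n ^ 2], each to
    the power [M], so [ln G <= 6 kappa M ln n]. With the lower bound on [ln G] this gives
    [n <= 72 (ln n) ^ 2 kappa M], and [ln 72 <= 7 ln 2 <= 4.9]. *)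
Lemma prim_upper (R : realType) (n kap M : nat) : (0 < kap)%N -> (kap < n)%N -> (0 < M)%N ->
  1 <= natln R n -> (fib n %/ fib_lcm (primes n) n <= (kap * n + 1) ^ (M * (2 * kap)) * (2 * n))%N ->
  (0 < fib n %/ fib_lcm (primes n) n)%N ->
  n%:R <= 12 * natln R n * natln R (fib n %/ fib_lcm (primes n) n) ->
  natln R n <= 49 / 10 + 2 * ln (natln R n) + natln R kap + natln R M.
Proof.
move=> k0 kn M0 L1 hG G0 hn; have n0 : (0 < n)%N by apply: leq_ltn_trans kn.
have l2 := lg2_le07 R.
have B0 : (0 < kap * n + 1)%N by rewrite addn1.
have hB : natln R (kap * n + 1) <= 2 * natln R n.
  rewrite -(@lgX R n 2) //; apply: lg_le => //.
  by apply: (@leq_trans (kap * n + n)); [rewrite leq_add2l | rewrite -mulSnr -mulnn leq_mul2r kn orbT].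
have := lg_le R G0 hG; rewrite lgM ?expn_gt0 ?B0 ?muln_gt0 // lgX // lgM // natrM natrM.
set G := (fib n %/ _)%N in hG G0 hn *; set L := natln R n in L1 hn hB *.
move=> hG'; have K1 : 1 <= kap%:R :> R by rewrite ler1n.
have M1 : 1 <= M%:R :> R by rewrite ler1n.
have KM1 : 1 <= kap%:R * M%:R :> R by rewrite -[leLHS]mulr1 ler_pM.
have h1 : M%:R * (2 * kap%:R) * natln R (kap * n + 1) <= M%:R * (2 * kap%:R) * (2 * L).
  by apply: ler_wpM2l => //; rewrite !mulr_ge0.
have h2 : L <= kap%:R * M%:R * L by rewrite ler_peMl //; lra.
have h3 : natln R G <= 6 * (kap%:R * M%:R * L).
  move: h1 h2 hG' L1 l2; have -> : M%:R * (2 * kap%:R) * (2 * L) = 4 * (kap%:R * M%:R * L) by ring.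
  by move: (kap%:R * M%:R * L) (natln R G) (M%:R * _ * _) (natln R 2) => *; lra.
have h4 : n%:R <= 72 * (L ^+ 2 * (kap%:R * M%:R)).
  apply: le_trans hn _; apply: (@le_trans _ _ (12 * L * (6 * (kap%:R * M%:R * L)))).
    by apply: ler_wpM2l => //; rewrite mulr_ge0 //; lra.
  by rewrite [leLHS](_ : _ = 72 * (L ^+ 2 * (kap%:R * M%:R))) //; ring.
have LL : 0 < L by lra.
have k0R : 0 < kap%:R :> R by rewrite ltr0n.
have M0R : 0 < M%:R :> R by rewrite ltr0n.
have n0R : 0 < n%:R :> R by rewrite ltr0n.
have P2 : 0 < L ^+ 2 by exact: exprn_gt0.
have P3 : 0 < kap%:R * M%:R :> R by exact: mulr_gt0.
have P4 : 0 < L ^+ 2 * (kap%:R * M%:R) by exact: mulr_gt0.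
have P5 : 0 < 72 * (L ^+ 2 * (kap%:R * M%:R)) by exact: mulr_gt0.
have h5 : ln n%:R <= ln (72 * (L ^+ 2 * (kap%:R * M%:R))) by rewrite ler_ln ?posrE.
have e1 : ln (72 * (L ^+ 2 * (kap%:R * M%:R))) = ln 72 + ln (L ^+ 2 * (kap%:R * M%:R)).
  by rewrite lnM ?posrE.
have e2 : ln (L ^+ 2 * (kap%:R * M%:R)) = ln (L ^+ 2) + ln (kap%:R * M%:R) by rewrite lnM ?posrE.
have e3 : ln (kap%:R * M%:R : R) = natln R kap + natln R M by rewrite lnM ?posrE.
have e4 : ln (L ^+ 2) = ln L + ln L by rewrite lnXn // mulr2n.
rewrite e1 e2 e3 e4 in h5.
have h72 : ln (72 : R) <= 49 / 10.
  have := @lg_le R 72 128 isT isT; rewrite -[128%N]/(2 ^ 7)%N lgX // /natln.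
  by move: l2; rewrite /natln; lra.
move: h5 h72; rewrite -/(natln R n) -/L; move: (natln R kap) (natln R M) (ln L) (ln 72) => *; lra.
Qed.

Theorem theorem1p2 (R : realType) (kappa : nat)
    (kappa_gt0 : (0 < kappa)%N)
    (kappa_large : 250 * 10 ^+ 3 <= ln (kappa%:R : R))
    (n : nat) (n_gt0 : (0 < n)%N)
    (n_large : expR (143 * ln (kappa%:R : R) * ln (ln (kappa%:R : R)))
               <= n%:R) :
  (exists p : nat, primitive_divisor p n /\
     forall k : nat, (1 <= k <= kappa)%N ->
       p <> (k * n - 1)%N /\ p <> (k * n + 1)%N)
  /\
  (exists q : nat,
     [/\ prime q, (q %| fib n)%N & ((kappa + 1) * n - 1 <= q)%N]).
Proof.
have LK : 143 * natln R kappa * ln (natln R kappa) <= natln R n.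
  by rewrite /natln -ler_expR lnK ?posrE ?ltr0n.
have [l [l250 Kl Ll lL]] := scale_l kappa_large LK.
pose u : R := l%:R / 1000.
have lE : l%:R = 1000 * u by rewrite /u; field.
have u250 : 250 <= u.
  rewrite ler_pdivlMr //; move: l250; rewrite -(ler_nat R) natrM; by apply.
have [y [y297 yl ry]] := scale_y l250.
clear l250 kappa_large.
have l0 : (0 < l)%N by rewrite -(ltr0n R) lE; move: u250; lra.
have [xi [q gf]] := good_family_ex R y297 ry.
have y0 : (0 < y)%N by apply: leq_trans y297.
(* The number of halvings is [k + 1 = 45]; [k] is kept opaque so that powers such as [17 ^ 45] are
   never evaluated. *)
have [k k44] : exists k, k = 44%N by exists 44%N.
rewrite lE in Kl Ll.
have lam12 := lg_scale_ge lE u250; have lamu := lg_scale_le lE u250.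
have Lbig : 1716 * (1000 * u) <= natln R n.
  by apply: le_trans Ll; move: lam12 u250; move: (natln R l) => a; nra.
have vL : 2410 * u <= natln R n by move: Lbig u250; lra.
have [d d0 /andP[d1 d2]] := scale_d n_gt0 vL.
pose M := ((2 ^ (2 * l)).+1 * (15 * 32 ^ k * d))%N.
have M0 : (0 < M)%N by rewrite !muln_gt0 expn_gt0 d0.
have hM : natln R M <= natln R n - 1010 * u + 160 := lgM_le k44 lE u250 d0 d2.
have l2 := lg2_le07 R.
have kn : (kappa < n)%N by apply: (@lg_lt R _ _ n_gt0); move: Kl Lbig u250; rewrite /natln; lra.
have n14 : (2 ^ 14 <= n)%N.
  by apply: ltnW; apply: (@lg_lt R _ _ n_gt0); rewrite (@lgX R 2 14) //; move: Lbig l2 u250; lra.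
have n5 : (5 < n)%N by apply: leq_trans n14.
have [p pp pk] : exists2 p, primitive_divisor p n &
    forall j : nat, (1 <= j <= kappa)%N -> p <> (j * n - 1)%N /\ p <> (j * n + 1)%N.
  pose S := [seq j * n - 1 | j <- iota 1 kappa]%N ++ [seq j * n + 1 | j <- iota 1 kappa]%N.
  case: (boolP (has (fun p => primitive_divisor p n && (p \notin S)) (primes (fib n)))).
    move=> /hasP[p _ /andP[pp pS]]; exists p => // j hj.
    have jk : j \in iota 1 kappa by rewrite mem_iota add1n ltnS.
    split=> e; move: pS; rewrite e mem_cat negb_or => /andP[/negP h1 /negP h2];
      [apply: h1 | apply: h2]; exact: map_f.
  move=> /hasPn hS; exfalso.
  have PS p : primitive_divisor p n -> p \in S.
    move=> pp; have /and3P[ppr pF _] := pp.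
    have /hS : p \in primes (fib n) by rewrite mem_primes ppr fib_gt0.
    by rewrite pp negbK.
  have bnd p : primitive_divisor p n ->
      [/\ p \in S, (p <= kappa * n + 1)%N & (logn p (fib n) <= M)%N].
    move=> pp; have pS := PS _ pp; split=> //.
      move: pS; rewrite mem_cat => /orP[] /mapP[j]; rewrite mem_iota add1n ltnS => /andP[_ jk] ->.
        by apply: leq_trans (leq_subr _ _) _; rewrite addn1 leqW // leq_mul2r jk orbT.
      by rewrite leq_add2r leq_mul2r jk orbT.
    have ppr : prime p by case/and3P: pp.
    have [pn np pu] : [/\ ~~ (p %| n)%N, (n <= p.+1)%N & (p <= kappa * n + 1)%N].
      move: pS; rewrite mem_cat => /orP[] /mapP[j]; rewrite mem_iota add1n ltnS => /andP[j1 jk] e.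
        have jn : (0 < j * n)%N by rewrite muln_gt0 j1.
        have eS : (p.+1 = j * n)%N by rewrite e -subSn // subn1.
        split.
        - apply/negP => h; have : (p %| p.+1)%N by rewrite eS dvdn_mull.
          by rewrite -addn1 dvdn_addr // dvdn1 => /eqP p1; move: ppr; rewrite p1.
        - by rewrite eS leq_pmull.
        by rewrite e; apply: leq_trans (leq_subr _ _) _; rewrite addn1 leqW // leq_mul2r jk orbT.
      split.
      - apply/negP => h; have : (p %| p)%N by exact: dvdnn.
        by rewrite {2}e dvdn_addr ?dvdn_mull // dvdn1 => /eqP p1; move: ppr; rewrite p1.
      - by rewrite e addn1; do 2 apply: leqW; rewrite leq_pmull.
      by rewrite e leq_add2r leq_mul2r jk orbT.
    apply: ltnW; apply: (valuation_lt k44 lE u250 y0 yl d0 n_gt0 Ll d1 d2 gf pp pn).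
      have : (n <= 2 * p)%N by apply: leq_trans np _; rewrite mul2n -addnn -addn1 leq_add2l prime_gt0.
      exact: lg_half_ge n_gt0 (prime_gt0 ppr).
    exact: lg_succ_le kappa_gt0 n_gt0 pu Kl.
  have pG := fib_part_dvd n5; have F0 := fib_gt0 n_gt0.
  have LF : (fib_lcm (primes n) n %| fib n)%N.
    by apply: dvd_fib_lcm => q'; rewrite mem_primes => /and3P[].
  have G0 : (0 < fib n %/ fib_lcm (primes n) n)%N.
    by rewrite divn_gt0 ?(dvdn_gt0 F0 LF) // dvdn_leq.
  have B0 : (0 < kappa * n + 1)%N by rewrite addn1.
  have pl := prim_part_le B0 bnd.
  have szS : size S = (2 * kappa)%N by rewrite size_cat !size_map size_iota mul2n addnn.
  rewrite szS in pl.
  have Gle : (fib n %/ fib_lcm (primes n) n <= (kappa * n + 1) ^ (M * (2 * kappa)) * (2 * n))%N.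
    apply: leq_trans (dvdn_leq _ pG) _; first by rewrite !muln_gt0 prim_part_gt0.
    by rewrite leq_mul2r pl orbT.
  have L1 : 1 <= natln R n by move: Lbig u250; lra.
  have := prim_upper kappa_gt0 kn M0 L1 Gle G0 (lg_fib_part_ge R n14).
  move=> hfin; apply: (contradiction_numeric u250 hfin _ hM); first by move: Kl; rewrite -/(natln R kappa); lra.
  apply: le_trans (ln_scale_le l0 L1 (ltW lL)) _.
  by move: lamu; move: (natln R l) => a; lra.
split; first by exists p.
(* Every primitive divisor has the form [j n - 1] or [j n + 1]; those with [j <= kappa] have just
   been avoided. *)
have [j j0 hj] := primitive_congr n5 pp.
have jk : (kappa < j)%N.
  by rewrite ltnNge; apply/negP => jk; have [] := pk j; [rewrite j0 | case: hj].
exists p; have /and3P[ppr pF _] := pp; split=> //.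
have h : ((kappa + 1) * n <= j * n)%N by rewrite leq_mul2r addn1 jk orbT.
case: hj => ->; first exact: leq_sub2r.
by apply: leq_trans (leq_subr _ _) _; apply: leq_trans h _; rewrite leq_addr.
Qed.
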